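(* Let $\mathcal{F}$ be a family of holomorphic functions in a domain $D\subseteq\mathbb{C}$. Let $a$ and $b\neq 0$ be two complex numbers such that $b\neq a$, and let $S_a$ and $S_b$ be compact subsets of $\mathbb{C}$ with $b\notin S_a$ and $a\notin S_b$. If, for each $f\in\mathcal{F}$ and each $z\in D$, $$f(z)=a\Rightarrow f'(z)\in S_a \qquad\text{and}\qquad f'(z)=b\Rightarrow f(z)\in S_b,$$ then $\mathcal{F}$ is normal in $D$.
   Context: A family $\mathcal{F}$ of holomorphic functions in $D$ is normal in $D$ (in the sense of Montel) if every sequence in $\mathcal{F}$ has a subsequence that converges locally uniformly in $D$ with respect to the spherical metric, i.e. either to a holomorphic function or to $\infty$. *)

(* Defs.v *)
From mathcomp Require Import all_boot all_order all_algebra.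
From mathcomp Require Import complex.
From mathcomp Require Import all_classical all_reals all_analysis.

Set Implicit Arguments.
Unset Strict Implicit.
Unset Printing Implicit Defensive.

Import Order.TTheory GRing.Theory Num.Theory.
Import numFieldNormedType.Exports.

Local Open Scope ring_scope.
Local Open Scope classical_set_scope.

(* R[i] carries no topology by itself; typed as a numClosedFieldType it gets
   the topology and normed-module structure induced by its norm. *)
Definition Cplx (R : realType) : numClosedFieldType := R[i].

Definition domain (R : realType) (D : set (Cplx R)) : Prop :=
  [/\ D !=set0, open D & connected D].

(* Functions on D are represented by total functions whose values off D are
   irrelevant. The derivative is the complex one, since the increments range
   over the scalar field Cplx R. *)
Definition holomorphic_in (R : realType) (D : set (Cplx R))
    (f : Cplx R -> Cplx R) : Prop :=
  forall z, D z -> derivable f z 1.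

(* The Riemann sphere: [Some z] is the finite point z, [None] is infinity. *)
Definition Sphere (R : realType) : Type := one_point_compactification (Cplx R).

Definition to_sphere (R : realType) (z : Cplx R) : Sphere R := Some z.

Definition infty (R : realType) : Sphere R := None.

Definition cabs (R : realType) (z : Cplx R) : R := complex.Re `|z|.

(* Chordal form of the spherical metric, normalised to diameter 1. *)
Definition chordal (R : realType) (p q : Sphere R) : R :=
  match p, q with
  | Some z, Some w =>
      cabs (z - w) /
        (Num.sqrt (1 + cabs z ^+ 2) * Num.sqrt (1 + cabs w ^+ 2))
  | Some z, None => (Num.sqrt (1 + cabs z ^+ 2))^-1
  | None, Some w => (Num.sqrt (1 + cabs w ^+ 2))^-1
  | None, None => 0
  end.

Definition spherical_cvg_locally_uniformly (R : realType) (D : set (Cplx R))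
    (u : nat -> Cplx R -> Sphere R) (g : Cplx R -> Sphere R) : Prop :=
  forall z, D z -> exists2 U : set (Cplx R), nbhs z U &
    forall e : R, 0 < e ->
      \forall n \near \oo, forall w, D w -> U w -> chordal (u n w) (g w) < e.

Definition normal_in (R : realType) (D : set (Cplx R))
    (F : set (Cplx R -> Cplx R)) : Prop :=
  forall f : nat -> Cplx R -> Cplx R, (forall n, F (f n)) ->
    exists2 phi : nat -> nat, {homo phi : m n / (m < n)%N} &
      let u := fun n z => to_sphere (f (phi n) z) in
      (exists2 h : Cplx R -> Cplx R, holomorphic_in D h &
         spherical_cvg_locally_uniformly D u (fun z => to_sphere (h z)))
      \/ spherical_cvg_locally_uniformly D u (fun=> infty R).

(* Main.v *)
(* Zalcman rescaling. Let |f'| <= A on the a-points of the family. If (|f'| - A - 1) / |f - a|^2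
   is not locally bounded, maximising it against the squared distance to the boundary of a disc
   gives points z_n and radii rho_n -> 0 such that g_n(x) = (f_n(z_n + rho_n x) - a) / rho_n has
   spherical derivative bounded on growing discs and at least A + 1 at 0. A limit g is entire with
   bounded spherical derivative. Where f_n' = b the distance from f_n to a is bounded below, so
   g_n is large there; hence g' = b nowhere or everywhere. In the first case g has exponential
   type (Harnack's inequality on discs where |g| > 1), so g' - b = h exp(c z), and c = 0 because
   b z + exp(c z) has unbounded spherical derivative. So g' is a constant k with |k| >= A + 1, but
   the zero of g is a limit of zeros of g_n, where |g_n'| <= A.

   The function theory needed (Goursat's lemma, Cauchy's estimate, Weierstrass' theorem,
   primitives, Harnack's inequality) uses Riemann sums and limits along an ultrafilter of
   indices instead of integrals and subsequences. *)
Require Import Defs.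
From mathcomp Require Import all_boot all_order all_algebra.
From mathcomp Require Import complex ring lra.
From mathcomp Require Import all_classical all_reals all_analysis.

Set Implicit Arguments.
Unset Strict Implicit.
Unset Printing Implicit Defensive.

Import Order.TTheory GRing.Theory Num.Theory.
Import numFieldNormedType.Exports.

Local Open Scope ring_scope.
Local Open Scope classical_set_scope.

(** Dividing by the first power of [rho] gives [g_n'(x) = f_n'(z_n + rho_n x)]: values of the
    derivative survive the rescaling, so the condition on [f' = b] and the bound on [f'] at the
    [a]-points pass to [g_n]. The compact sets enter through a bound [A] on [S_a] and the distance
    from [a] to [S_b], which division by [rho] sends to infinity. The level [A + 1] serves twice:
    where [|f'| >= A + 1] the value [a] is not taken, so the maximised quotient is finite and
    continuous; and the surplus 1 over [A] is the final contradiction. That [b] is nonzero excludes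
    exponentials: [exp(c z)] alone has bounded spherical derivative, and the term [b z] destroys
    this.

    Hurwitz's theorem and the alternative between boundedness and divergence to infinity both come
    from Harnack's inequality for [ln |f|]: a bounded zero-free function tiny at one point is tiny
    nearby, and one of modulus above 1 that is huge at one point is huge nearby. Along an
    ultrafilter bounded sequences converge and every property is decided, so an actual subsequence
    is extracted only once, at the end. *)

Section ComplexModulus.
Context {R : realType}.
Local Notation C := (Cplx R).
Implicit Types z w : C.

(** * Real-valued modulus, real and imaginary parts *)

Definition ofR (x : R) : C := (x%:C)%C.
Definition cRe (z : C) : R := complex.Re z.
Definition cIm (z : C) : R := complex.Im z.
Definition imagi : C := ('i)%C.

Lemma cabsE z : `|z| = ofR (cabs z).
Proof. by rewrite /cabs/ofR/=; case: z => a b; rewrite normc_def. Qed.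

Lemma cabs_def z : cabs z = Num.sqrt (cRe z ^+ 2 + cIm z ^+ 2).
Proof. by rewrite /cabs normc_def. Qed.

Lemma ofR_inj : injective ofR.
Proof. by move=> x y []. Qed.

Lemma ofRD x y : ofR (x + y) = ofR x + ofR y.
Proof. exact: (rmorphD (real_complex R)). Qed.
Lemma ofRN x : ofR (- x) = - ofR x.
Proof. exact: (rmorphN (real_complex R)). Qed.
Lemma ofRM x y : ofR (x * y) = ofR x * ofR y.
Proof. exact: (rmorphM (real_complex R)). Qed.
Lemma ofRV x : ofR (x^-1) = (ofR x)^-1.
Proof. exact: (fmorphV (real_complex R)). Qed.
Lemma ofR0 : ofR 0 = 0. Proof. by []. Qed.
Lemma ofR1 : ofR 1 = 1. Proof. by []. Qed.
Lemma ofRX x n : ofR (x ^+ n) = ofR x ^+ n.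
Proof. exact: (rmorphXn (real_complex R)). Qed.
Lemma ofR_nat n : ofR n%:R = n%:R.
Proof. exact: (rmorph_nat (real_complex R)). Qed.
Lemma ofR_eq0 x : (ofR x == 0) = (x == 0).
Proof. exact: (fmorph_eq0 (real_complex R)). Qed.

Lemma cabs_ge0 z : 0 <= cabs z.
Proof. by rewrite cabs_def sqrtr_ge0. Qed.
Lemma cabs0 : cabs (0 : C) = 0.
Proof. by rewrite /cabs normr0. Qed.
Lemma cabs_eq0 z : (cabs z == 0) = (z == 0).
Proof. by rewrite -ofR_eq0 -cabsE normr_eq0. Qed.
Lemma cabs_gt0 z : (0 < cabs z) = (z != 0).
Proof. by rewrite lt_def cabs_ge0 andbT cabs_eq0. Qed.
Lemma cabsM z w : cabs (z * w) = cabs z * cabs w.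
Proof. by apply: ofR_inj; rewrite ofRM -!cabsE normrM. Qed.
Lemma cabsN z : cabs (- z) = cabs z.
Proof. by rewrite /cabs normrN. Qed.
Lemma cabsB z w : cabs (z - w) = cabs (w - z).
Proof. by rewrite -cabsN opprB. Qed.
Lemma cabsV z : cabs (z^-1) = (cabs z)^-1.
Proof. by apply: ofR_inj; rewrite ofRV -!cabsE normfV. Qed.
Lemma cabsX z n : cabs (z ^+ n) = cabs z ^+ n.
Proof. by apply: ofR_inj; rewrite ofRX -!cabsE normrX. Qed.
Lemma cabs_ofR x : cabs (ofR x) = `|x|.
Proof. by rewrite cabs_def /= expr0n addr0 sqrtr_sqr. Qed.
Lemma cabs_nat n : cabs (n%:R : C) = n%:R.
Proof. by rewrite -ofR_nat cabs_ofR ger0_norm. Qed.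
Lemma cabs_i : cabs imagi = 1.
Proof. by rewrite cabs_def /= expr0n add0r expr1n sqrtr1. Qed.

Lemma lec_ofR x y : (ofR x <= ofR y) = (x <= y).
Proof. exact: lecR. Qed.
Lemma ltc_ofR x y : (ofR x < ofR y) = (x < y).
Proof. exact: ltcR. Qed.

Lemma cabsD z w : cabs (z + w) <= cabs z + cabs w.
Proof. by rewrite -lec_ofR ofRD -!cabsE ler_normD. Qed.
Lemma cabsBD z w : cabs (z - w) <= cabs z + cabs w.
Proof. by rewrite -(cabsN w) cabsD. Qed.
Lemma cabs_tri z w u : cabs (z - u) <= cabs (z - w) + cabs (w - u).
Proof. by apply: le_trans (cabsD _ _); rewrite addrA subrK. Qed.
Lemma cabs_le z w : cabs z <= cabs (z - w) + cabs w.
Proof. by apply: le_trans (cabsD _ _); rewrite subrK. Qed.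

Lemma cabs_sum (I : Type) (r : seq I) (P : pred I) (F : I -> C) :
  cabs (\sum_(i <- r | P i) F i) <= \sum_(i <- r | P i) cabs (F i).
Proof.
elim/big_rec2 : _ => [|i x y _ h]; first by rewrite cabs0.
by apply: le_trans (cabsD _ _) _; rewrite lerD2l.
Qed.

Lemma sqr_cabs z : cabs z ^+ 2 = cRe z ^+ 2 + cIm z ^+ 2.
Proof. by rewrite cabs_def sqr_sqrtr// addr_ge0// sqr_ge0. Qed.

Lemma Re_le_cabs z : `|cRe z| <= cabs z.
Proof.
by rewrite cabs_def -sqrtr_sqr ler_wsqrtr// lerDl sqr_ge0.
Qed.
Lemma Im_le_cabs z : `|cIm z| <= cabs z.
Proof.
by rewrite cabs_def -sqrtr_sqr ler_wsqrtr// lerDr sqr_ge0.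
Qed.
Lemma cabs_le_ReIm z : cabs z <= `|cRe z| + `|cIm z|.
Proof.
rewrite -(ler_pXn2r (ltn0Sn 1)) ?nnegrE ?cabs_ge0 ?addr_ge0//.
by rewrite sqr_cabs sqrrD !real_normK ?num_real// -addrA lerD2l lerDr
  pmulrn_lge0// mulr_ge0.
Qed.

Lemma ReD z w : cRe (z + w) = cRe z + cRe w.
Proof. by case: z w => [? ?] [? ?]. Qed.
Lemma ReN z : cRe (- z) = - cRe z.
Proof. by case: z. Qed.
Lemma ImD z w : cIm (z + w) = cIm z + cIm w.
Proof. by case: z w => [? ?] [? ?]. Qed.
Lemma ImN z : cIm (- z) = - cIm z.
Proof. by case: z. Qed.
Lemma ReM z w : cRe (z * w) =
  cRe z * cRe w - cIm z * cIm w.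
Proof. by case: z w => [? ?] [? ?]. Qed.
Lemma ImM z w : cIm (z * w) =
  cRe z * cIm w + cIm z * cRe w.
Proof. by case: z w => [? ?] [? ?]. Qed.
Lemma Re_ofR x : cRe (ofR x) = x. Proof. by []. Qed.
Lemma Re_i : cRe imagi = 0. Proof. by []. Qed.
Lemma Im_i : cIm imagi = 1. Proof. by []. Qed.
Lemma Im_ofR x : cIm (ofR x) = 0. Proof. by []. Qed.

Lemma c_eq z w : cRe z = cRe w -> cIm z = cIm w ->
  z = w.
Proof. by case: z w => [? ?] [? ?] /= -> ->. Qed.

Lemma imagi2 : imagi * imagi = -1 :> C.
Proof. by apply: c_eq; rewrite ?ReM ?ImM ?ReN ?ImN ?Re_i ?Im_i -?ofR1 ?Re_ofR ?Im_ofR; ring. Qed.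

Definition cconj z : C := (z^*)%C.

Lemma Re_conj z : cRe (cconj z) = cRe z. Proof. by case: z. Qed.
Lemma Im_conj z : cIm (cconj z) = - cIm z. Proof. by case: z. Qed.

Lemma mul_conj z : z * cconj z = ofR (cabs z ^+ 2).
Proof.
by apply: c_eq; rewrite ?ReM ?ImM ?Re_conj ?Im_conj ?Re_ofR ?Im_ofR ?sqr_cabs; ring.
Qed.

Lemma cabs_conj z : cabs (cconj z) = cabs z.
Proof. by rewrite !cabs_def; case: z => x y; rewrite /cRe /cIm /= sqrrN. Qed.

Lemma cabs_ball (z w : C) (e : R) :
  ball z (ofR e) w = (cabs (w - z) < e) :> Prop.
Proof.
by rewrite -[ball _ _]/(ball_ Num.norm z (ofR e)) /ball_/= cabsE ltc_ofR cabsB.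
Qed.

(** Balls have their radii in [C], but a positive element of [C] has imaginary part zero, so real
    radii describe the same topology. *)
Lemma nbhs_cabs z (A : set C) :
  nbhs z A <-> exists2 e : R, 0 < e & forall w, cabs (w - z) < e -> A w.
Proof.
split.
  move=> /nbhs_ballP[[e e'] /=].
  rewrite ltcE /= => /andP[/eqP ->] e0 zA; exists e => // w zw; apply: zA.
  by rewrite -[(_ +i* _)%C]/(ofR e) cabs_ball.
move=> [e e0 zA]; apply/nbhs_ballP; exists (ofR e).
  by rewrite /= -ofR0 ltc_ofR.
by move=> w; rewrite cabs_ball; exact: zA.
Qed.

End ComplexModulus.

(* Kept opaque, since failing unifications would otherwise unfold [Cplx R] down to
   pairs of reals, at prohibitive cost. *)
Opaque Cplx cabs ofR cRe cIm imagi cconj.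

(** * Complex differentiability in epsilon-delta form *)

Section ComplexDerivative.
Context {R : realType}.
Local Notation C := (Cplx R).
Implicit Types (f g q : C -> C) (z w d : C).

(** The little-o form with a non-strict bound: [w = z] is harmless, so no punctured neighbourhood
    and no division occur. *)
Definition cderiv f z d := forall e : R, 0 < e -> exists2 r : R, 0 < r &
  forall w, cabs (w - z) < r ->
  cabs (f w - f z - d * (w - z)) <= e * cabs (w - z).

Definition cont_at q z := forall e : R, 0 < e -> exists2 r : R, 0 < r &
  forall w, cabs (w - z) < r -> cabs (q w - q z) < e.

Lemma cont_atP q z : cont_at q z <-> {for z, continuous q}.
Proof.
split=> [H A|qz e e0].
  move=> /nbhs_cabs[e e0 eA]; have [r r0 rH] := H _ e0.
  by apply/nbhs_cabs; exists r => // w /rH /eA.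
have /qz : nbhs (q z) [set y | cabs (y - q z) < e].
  by apply/nbhs_cabs; exists e.
by move=> /nbhs_cabs[r r0 H]; exists r.
Qed.

Lemma cont_cst (c z : C) : cont_at (fun=> c) z.
Proof. by apply/cont_atP; exact: (@cst_continuous C C). Qed.

Lemma cont_id z : cont_at id z.
Proof. by apply/cont_atP; exact: cvg_id. Qed.

Lemma contD f g z : cont_at f z -> cont_at g z ->
  cont_at (fun w => f w + g w) z.
Proof.
move=> /cont_atP h1 /cont_atP h2; apply/cont_atP; exact: (continuousD h1 h2).
Qed.

Lemma contN f z : cont_at f z -> cont_at (fun w => - f w) z.
Proof. move=> /cont_atP h; apply/cont_atP; exact: (continuousN h). Qed.

Lemma contM f g z : cont_at f z -> cont_at g z ->
  cont_at (fun w => f w * g w) z.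
Proof.
move=> /cont_atP h1 /cont_atP h2; apply/cont_atP; exact: (continuousM h1 h2).
Qed.

Lemma contV f z : f z != 0 -> cont_at f z -> cont_at (fun w => (f w)^-1) z.
Proof.
move=> h0 /cont_atP h; apply/cont_atP; exact: (continuousV h0 h).
Qed.

Lemma cont_comp f g z : cont_at f z -> cont_at g (f z) ->
  cont_at (fun w => g (f w)) z.
Proof.
move=> /cont_atP h1 /cont_atP h2; apply/cont_atP.
exact: (continuous_comp h1 h2).
Qed.

(** Keeps the epsilon-delta form accessible once [cont_at] is opaque. *)
Lemma cont_cabsP q z : cont_at q z <->
  forall e : R, 0 < e -> exists2 r : R, 0 < r &
  forall w, cabs (w - z) < r -> cabs (q w - q z) < e.
Proof. by []. Qed.

Opaque cont_at.

(** Carathéodory's criterion: differentiability is continuity of a slope function, so the sum,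
    product and chain rules become algebra of continuous functions. *)
Lemma cderiv_slope f z d : cderiv f z d <->
  exists2 q, cont_at q z &
    q z = d /\ forall w, f w - f z = q w * (w - z).
Proof.
split=> [H|[q /cont_cabsP qc [qz qE]] e e0].
  exists (fun w => if w == z then d else (f w - f z) / (w - z)).
    apply/cont_cabsP => e e0.
    have e20 : 0 < e / 2 by rewrite divr_gt0.
    have [r r0 rH] := H _ e20; exists r => // w wr.
    rewrite eqxx; case: eqVneq => [_|wz]; first by rewrite subrr cabs0.
    have wz0 : w - z != 0 by rewrite subr_eq0.
    have -> : (f w - f z) / (w - z) - d = (f w - f z - d * (w - z)) / (w - z).
      by field.
    rewrite cabsM cabsV ltr_pdivrMr ?cabs_gt0//.
    apply: le_lt_trans (rH _ wr) _.
    by rewrite ltr_pM2r ?cabs_gt0// ltr_pdivrMr// ltr_pMr// ltr1n.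
  split; first by rewrite eqxx.
  move=> w; case: eqVneq => [->|wz]; first by rewrite !subrr mulr0.
  by rewrite divfK// subr_eq0.
have [r r0 rH] := qc _ e0; exists r => // w wr.
by rewrite qE -mulrBl cabsM -qz ler_wpM2r ?cabs_ge0// ltW// rH.
Qed.

Lemma cderiv_cont f z d : cderiv f z d -> cont_at f z.
Proof.
move=> /cderiv_slope[q qc [_ qE]].
have -> : f = (fun w => f z + q w * (w - z)).
  by apply/funext => w; rewrite -qE addrC subrK.
apply: contD; first exact: cont_cst.
by apply: contM => //; apply: contD; [exact: cont_id|exact: cont_cst].
Qed.

Lemma cderiv_cst (c z : C) : cderiv (fun=> c) z 0.
Proof.
move=> e e0; exists 1 => // w _.
by rewrite subrr mul0r subr0 cabs0 mulr_ge0 ?cabs_ge0// ltW.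
Qed.

Lemma cderiv_id z : cderiv id z 1.
Proof.
move=> e e0; exists 1 => // w _.
by rewrite mul1r subrr cabs0 mulr_ge0 ?cabs_ge0// ltW.
Qed.

Lemma cderivD f g z df dg : cderiv f z df -> cderiv g z dg ->
  cderiv (fun w => f w + g w) z (df + dg).
Proof.
move=> /cderiv_slope[p pc [<- pE]] /cderiv_slope[q qc [<- qE]].
apply/cderiv_slope; exists (fun w => p w + q w); first exact: contD.
by split=> // w; rewrite opprD addrACA pE qE mulrDl.
Qed.

Lemma cderivM f g z df dg : cderiv f z df -> cderiv g z dg ->
  cderiv (fun w => f w * g w) z (df * g z + f z * dg).
Proof.
move=> df' dg'; have gc := cderiv_cont dg'.
move: df' dg' => /cderiv_slope[p pc [<- pE]] /cderiv_slope[q qc [<- qE]].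
apply/cderiv_slope; exists (fun w => p w * g w + f z * q w).
  by apply: contD; apply: contM => //; exact: cont_cst.
split=> // w; have /eqP := pE w; rewrite subr_eq => /eqP ->.
by rewrite [RHS]mulrDl -[f z * q w * _]mulrA -qE; ring.
Qed.

Lemma cderivZ (c : C) f z df : cderiv f z df ->
  cderiv (fun w => c * f w) z (c * df).
Proof.
by move=> /(cderivM (cderiv_cst c z)); rewrite mul0r add0r.
Qed.

Lemma cderivN f z df : cderiv f z df -> cderiv (fun w => - f w) z (- df).
Proof.
move=> /(cderivZ (-1)); rewrite mulN1r.
by under eq_fun do rewrite mulN1r.
Qed.

Lemma cderivB f g z df dg : cderiv f z df -> cderiv g z dg ->
  cderiv (fun w => f w - g w) z (df - dg).
Proof. by move=> hf hg; apply: cderivD => //; exact: cderivN. Qed.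

Lemma cderivV f z df : cderiv f z df -> f z != 0 ->
  cderiv (fun w => (f w)^-1) z (- df / f z ^+ 2).
Proof.
move=> df' fz0; have fc := cderiv_cont df'.
move: df' => /cderiv_slope[p pc [<- pE]].
move=> e e0.
(* near [z] the slope of [1/f] is [- p w / (f w * f z)] *)
have /cont_cabsP H : cont_at (fun w => - p w / (f w * f z)) z.
  apply: contM; first exact: contN.
  apply: contV; first by rewrite mulf_neq0.
  by apply: contM => //; exact: cont_cst.
have [r r0 rH] := H _ e0.
have /cont_cabsP fc' := fc.
have fz1 : 0 < cabs (f z) by rewrite cabs_gt0.
have [r1 r10 r1H] := fc' _ fz1.
exists (Num.min r r1); first by rewrite lt_min r0.
move=> w; rewrite lt_min => /andP[/rH wr /r1H wr1].
have fw0 : f w != 0.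
  by apply/eqP => fw; move: wr1; rewrite fw sub0r cabsN ltxx.
have -> : (f w)^-1 - (f z)^-1 - - p z / f z ^+ 2 * (w - z) =
   (- p w / (f w * f z) - (- p z / (f z * f z))) * (w - z).
  have -> : (f w)^-1 - (f z)^-1 = - (f w - f z) / (f w * f z).
    by field; rewrite fw0 fz0.
  by rewrite pE; field; rewrite fw0 fz0.
by rewrite cabsM ler_wpM2r ?cabs_ge0// ltW.
Qed.

Lemma cderiv_comp f g z df dg : cderiv f z df -> cderiv g (f z) dg ->
  cderiv (fun w => g (f w)) z (dg * df).
Proof.
move=> df' dg'; have fc := cderiv_cont df'.
move: df' dg' => /cderiv_slope[p pc [<- pE]] /cderiv_slope[q qc [<- qE]].
apply/cderiv_slope; exists (fun w => q (f w) * p w); last first.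
  by split=> // w; rewrite qE pE mulrA.
by apply: contM => //; exact: (cont_comp fc qc).
Qed.

Lemma cderiv_near f g z d (r : R) : 0 < r ->
  (forall w, cabs (w - z) < r -> f w = g w) -> cderiv f z d -> cderiv g z d.
Proof.
move=> r0 fg H e e0; have [s s0 sH] := H _ e0.
exists (Num.min r s); first by rewrite lt_min r0.
move=> w; rewrite lt_min => /andP[wr ws].
by rewrite -!fg// ?subrr ?cabs0//; exact: sH.
Qed.

Lemma cderiv_derivable f z d : cderiv f z d -> derivable f z 1 /\ f^`() z = d.
Proof.
move=> H.
have cv : (fun h : C => h^-1 *: (f (h *: 1 + z) - f z)) @ 0^' --> d.
  move=> A /nbhs_cabs[e e0 eA].
  have e20 : 0 < e / 2 by rewrite divr_gt0.
  have [r r0 rH] := H _ e20.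
  apply/nbhs_cabs; exists r => // h; rewrite subr0 => hr h0.
  apply: eA.
  have := rH (h + z); rewrite addrK => /(_ hr) hH.
  have -> : h^-1 *: (f (h *: 1 + z) - f z) - d = (f (h + z) - f z - d * h) / h.
    rewrite /GRing.scale /= mulr1 mulrBl mulfK//.
    by rewrite mulrC.
  rewrite cabsM cabsV ltr_pdivrMr ?cabs_gt0//.
  apply: le_lt_trans hH _.
  by rewrite ltr_pM2r ?cabs_gt0// ltr_pdivrMr// ltr_pMr// ltr1n.
split; first by apply/cvg_ex; exists d.
by rewrite derive1E; apply/cvg_lim.
Qed.

Lemma derivable_cderiv f z : derivable f z 1 -> cderiv f z (f^`()%classic z).
Proof.
move=> df e e0; rewrite derive1E.
have /cvg_ex[/= d cv] := df.
have -> : 'D_1 f z = d by apply/cvg_lim.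
have /cv : nbhs d [set y | cabs (y - d) < e] by apply/nbhs_cabs; exists e.
move=> /nbhs_cabs[r r0 rH]; exists r => // w wr.
case: (eqVneq w z) => [->|wz].
  by rewrite !subrr mulr0 subr0 cabs0 mulr0.
have wz0 : w - z != 0 by rewrite subr_eq0.
have /= := rH (w - z); rewrite subr0 => /(_ wr wz0).
rewrite /GRing.scale /= mulr1 subrK => H.
have -> : f w - f z - d * (w - z) = ((w - z)^-1 * (f w - f z) - d) * (w - z).
  by rewrite mulrBl mulrAC mulVf// mul1r.
by rewrite cabsM ler_wpM2r ?cabs_ge0// ltW.
Qed.

End ComplexDerivative.

(** * Limits along an ultrafilter *)

Section UltraLimits.
Context {R : realType} {T : Type} {U : set_system T} {UU : UltraFilter U}.
Local Notation C := (Cplx R).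

Lemma ultra_dec (P : T -> Prop) :
  (\forall t \near U, P t) \/ (\forall t \near U, ~ P t).
Proof. exact: in_ultra_setVsetC. Qed.

Lemma ultra_const (P : Prop) : (\forall t \near U, P) -> P.
Proof. by move=> /filter_ex[]. Qed.

(** The limit is the supremum of the eventual lower bounds: a number above the supremum is not one,
    and the ultrafilter then decides that [x] stays below it. *)
Lemma ultra_real_lim (x : T -> R) (M : R) : (\forall t \near U, `|x t| <= M) ->
  exists l : R, forall e : R, 0 < e -> \forall t \near U, `|x t - l| < e.
Proof.
move=> xM; pose S := [set s : R | \forall t \near U, s <= x t].
have hS : has_sup S.
  split.
    by exists (- M); apply: filterS xM => t; rewrite ler_norml => /andP[].
  exists M => s Ss; apply: ultra_const; move: xM Ss; apply: filterS2 => t.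
  by rewrite ler_norml => /andP[_ h1] h2; exact: le_trans h2 h1.
exists (sup S) => e e0.
have [s Ss es] := sup_adherent e0 hS.
have : \forall t \near U, ~ (sup S + e / 2 <= x t).
  have [H|//] := ultra_dec (fun t => sup S + e / 2 <= x t).
  have : sup S + e / 2 <= sup S by apply: ub_le_sup => //; case: hS.
  by rewrite gerDl leNgt divr_gt0.
move: Ss; apply: filterS2 => t sx /negP; rewrite -ltNge => xs.
by rewrite ltr_norml; lra.
Qed.

Lemma ultra_lim (x : T -> C) (M : R) : (\forall t \near U, cabs (x t) <= M) ->
  exists l : C, forall e : R, 0 < e -> \forall t \near U, cabs (x t - l) < e.
Proof.
move=> xM.
have [|a aP] := @ultra_real_lim (fun t => cRe (x t)) M.
  by apply: filterS xM => t; apply: le_trans (Re_le_cabs _).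
have [|b bP] := @ultra_real_lim (fun t => cIm (x t)) M.
  by apply: filterS xM => t; apply: le_trans (Im_le_cabs _).
exists (ofR a + imagi * ofR b) => e e0.
have e2 : 0 < e / 2 by rewrite divr_gt0.
move: (aP _ e2) (bP _ e2); apply: filterS2 => t h1 h2.
apply: le_lt_trans (cabs_le_ReIm _) _.
rewrite ReD ImD ReN ImN ReD ImD ReM ImM Re_ofR Im_ofR Re_i Im_i !Re_ofR !Im_ofR.
by rewrite [e]splitr ltrD// !(mul0r, mul1r, mulr0, subr0, addr0, add0r).
Qed.

Lemma ultra_lim_le (x : T -> C) (l c : C) (K : R) :
  (forall e : R, 0 < e -> \forall t \near U, cabs (x t - l) < e) ->
  (\forall t \near U, cabs (x t - c) <= K) -> cabs (l - c) <= K.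
Proof.
move=> xl xK; rewrite leNgt; apply/negP => Kl.
have e0 : 0 < cabs (l - c) - K by rewrite subr_gt0.
apply: ultra_const; move: (xl _ e0) xK; apply: filterS2 => t h1 h2.
by have := cabs_tri l (x t) c; rewrite (cabsB l (x t)); lra.
Qed.

Lemma ultra_lim_unique (x : T -> C) (l l' : C) :
  (forall e : R, 0 < e -> \forall t \near U, cabs (x t - l) < e) ->
  (forall e : R, 0 < e -> \forall t \near U, cabs (x t - l') < e) -> l = l'.
Proof.
move=> xl xl'; apply/eqP; rewrite -subr_eq0 -cabs_eq0 eq_le cabs_ge0 andbT.
apply/ler_addgt0Pl => e e0; rewrite addr0.
by apply: ultra_lim_le xl _; apply: filterS (xl' _ e0) => t /ltW.
Qed.

End UltraLimits.

(** * Mean value inequality along segments *)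

Section MeanValue.
Context {R : realType}.
Local Notation C := (Cplx R).
Implicit Types (f g : C -> C).

Lemma is_derive_epsdelta (k : R -> R) (t d : R) :
  (forall e : R, 0 < e -> exists2 r : R, 0 < r & forall s, `|s - t| < r ->
     `|k s - k t - d * (s - t)| <= e * `|s - t|) -> is_derive t 1 k d.
Proof.
move=> H.
have cv : (fun h : R => h^-1 *: (k (h *: 1 + t) - k t)) @ 0^' --> d.
  apply/cvgrPdist_lt => e e0.
  have e20 : 0 < e / 2 by rewrite divr_gt0.
  have [r r0 rH] := H _ e20.
  near=> h.
  have h0 : h != 0 by near: h; exact: nbhs_dnbhs_neq.
  have hr : `|h| < r.
    near: h; apply: dnbhs0_lt; exact: r0.
  have := rH (h + t); rewrite addrK => /(_ hr) hH.
  rewrite distrC.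
  have -> : h^-1 *: (k (h *: 1 + t) - k t) - d = (k (h + t) - k t - d * h) / h.
    by rewrite /GRing.scale /= mulr1; field.
  rewrite normrM normfV ltr_pdivrMr ?normr_gt0//.
  apply: le_lt_trans hH _.
  by rewrite ltr_pM2r ?normr_gt0// ltr_pdivrMr// ltr_pMr// ltr1n.
apply: DeriveDef; first by apply/cvg_ex; exists d.
by apply/cvg_lim.
Unshelve. all: by end_near. Qed.

(** The factor [c] selects a real component along a segment: [1] and [- imagi] give the real and
    imaginary parts, a conjugate value gives the component in a chosen direction. *)
Lemma is_derive_path f (p q c d : C) (t : R) : cderiv f (p + ofR t * q) d ->
  is_derive t 1 (fun s : R => cRe (c * f (p + ofR s * q))) (cRe (c * d * q)).
Proof.
move=> df; apply: is_derive_epsdelta => e e0.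
(* The added ones keep the denominator positive when [c] or [q] vanishes. *)
have D : 0 < (cabs c + 1) * (cabs q + 1).
  by rewrite mulr_gt0// ltr_wpDl// cabs_ge0.
have [r r0 rH] := df _ (divr_gt0 e0 D).
exists (r / (cabs q + 1)); first by rewrite divr_gt0// ltr_wpDl// cabs_ge0.
move=> s; rewrite ltr_pdivlMr ?ltr_wpDl ?cabs_ge0// => str.
have E : (p + ofR s * q) - (p + ofR t * q) = ofR (s - t) * q.
  by rewrite ofRD ofRN; ring.
have := rH (p + ofR s * q); rewrite E cabsM cabs_ofR => H.
have {}H : cabs (f (p + ofR s * q) - f (p + ofR t * q) - d * (ofR (s - t) * q)) <=
    e / ((cabs c + 1) * (cabs q + 1)) * (`|s - t| * cabs q).
  apply: H; apply: le_lt_trans str; rewrite ler_wpM2l// lerDl//.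
have -> : cRe (c * f (p + ofR s * q)) - cRe (c * f (p + ofR t * q)) -
    cRe (c * d * q) * (s - t) =
   cRe (c * (f (p + ofR s * q) - f (p + ofR t * q) - d * (ofR (s - t) * q))).
  set A := f _; set B := f _.
  have -> : cRe (c * d * q) * (s - t) = cRe (c * d * q * ofR (s - t)).
    by rewrite [RHS]ReM Re_ofR Im_ofR mulr0 subr0.
  by rewrite -!ReN -!ReD; congr cRe; ring.
apply: le_trans (Re_le_cabs _) _; rewrite cabsM.
apply: (@le_trans _ _ ((cabs c + 1) *
  (e / ((cabs c + 1) * (cabs q + 1)) * (`|s - t| * (cabs q + 1))))).
  apply: ler_pM; rewrite ?cabs_ge0 ?lerDl//.
  apply: le_trans H _; rewrite ler_wpM2l ?ler_wpM2l ?lerDl// divr_ge0 ?ltW//.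
rewrite le_eqVlt; apply/orP; left; apply/eqP; have c1 : cabs c + 1 != 0 by rewrite gt_eqF// ltr_wpDl// cabs_ge0.
have q1 : cabs q + 1 != 0 by rewrite gt_eqF// ltr_wpDl// cabs_ge0.
by field; rewrite c1 q1.
Qed.

Lemma path_MVT (k dk : R -> R) :
  (forall t : R, 0 <= t <= 1 -> is_derive t 1 k (dk t)) ->
  exists2 t : R, 0 <= t <= 1 & k 1 - k 0 = dk t.
Proof.
move=> H; have [|||t] := @MVT_segment R k dk 0 1.
- exact: ler01.
- by move=> x; rewrite in_itv /= => /andP[/ltW x0 /ltW x1]; apply: H; rewrite x0.
- apply: derivable_within_continuous => x; rewrite in_itv /= => /H[].
  by [].
- by rewrite in_itv /= subr0 mulr1 => t01 E; exists t.
Qed.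

(** The mean value equality fails for complex values, so it is applied to the real component in the
    direction of the increment: multiplying [f] by the conjugate of [f z2 - f z1] makes the
    increment equal to its squared modulus. *)
Lemma mean_value_segment f f' (z1 z2 : C) (K : R) :
  (forall t : R, 0 <= t <= 1 -> cderiv f (z1 + ofR t * (z2 - z1))
     (f' (z1 + ofR t * (z2 - z1))) /\
     cabs (f' (z1 + ofR t * (z2 - z1))) <= K) ->
  cabs (f z2 - f z1) <= K * cabs (z2 - z1).
Proof.
move=> H; pose c := cconj (f z2 - f z1).
have [t t01|t t01] := @path_MVT
    (fun s => cRe (c * f (z1 + ofR s * (z2 - z1))))
    (fun s => cRe (c * f' (z1 + ofR s * (z2 - z1)) * (z2 - z1))).
  by apply: is_derive_path; exact: (H _ t01).1.
rewrite ofR0 ofR1 mul0r mul1r addr0 (addrC z1) subrK -ReN -ReD -mulrBr.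
rewrite mulrC mul_conj Re_ofR => E.
have [->|n0] := eqVneq (f z2 - f z1) 0.
  rewrite cabs0 mulr_ge0 ?cabs_ge0//.
  exact: le_trans (cabs_ge0 _) (H _ t01).2.
rewrite -(ler_pM2l (_ : 0 < cabs (f z2 - f z1))) ?cabs_gt0// -expr2 E.
apply: le_trans (ler_norm _) _; apply: le_trans (Re_le_cabs _) _.
rewrite !cabsM cabs_conj mulrA ler_wpM2r ?cabs_ge0//.
by rewrite ler_wpM2l ?cabs_ge0// (H _ t01).2.
Qed.

Lemma disc_convex (z z1 z2 : C) (r t : R) : 0 <= t <= 1 ->
  cabs (z1 - z) < r -> cabs (z2 - z) < r ->
  cabs (z1 + ofR t * (z2 - z1) - z) < r.
Proof.
move=> /andP[t0 t1] h1 h2.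
have -> : z1 + ofR t * (z2 - z1) - z =
   ofR (1 - t) * (z1 - z) + ofR t * (z2 - z) by rewrite ofRD ofRN ofR1; ring.
apply: le_lt_trans (cabsD _ _) _; rewrite !cabsM !cabs_ofR ger0_norm ?subr_ge0//.
(* For [t = 0] strictness comes from [z1]; for [t > 0] it comes from [z2]. *)
rewrite (ger0_norm t0); have [->|tn] := eqVneq t 0.
  by rewrite subr0 mul1r mul0r addr0.
have t00 : 0 < t by rewrite lt_def tn.
have : (1 - t) * cabs (z1 - z) <= (1 - t) * r.
  by rewrite ler_wpM2l ?subr_ge0// ltW.
have : t * cabs (z2 - z) < t * r by rewrite ltr_pM2l.
lra.
Qed.

Lemma mean_value_disc f f' (z z1 z2 : C) (r K : R) :
  (forall w, cabs (w - z) < r -> cderiv f w (f' w)) ->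
  (forall w, cabs (w - z) < r -> cabs (f' w) <= K) ->
  cabs (z1 - z) < r -> cabs (z2 - z) < r ->
  cabs (f z2 - f z1) <= K * cabs (z2 - z1).
Proof.
move=> df bf h1 h2; apply: (@mean_value_segment f f') => t t01.
by split; [apply: df|apply: bf]; exact: disc_convex.
Qed.

End MeanValue.

(** * Complex exponential and logarithm *)

Section ComplexExponential.
Context {R : realType}.
Local Notation C := (Cplx R).

Lemma epsdelta_is_derive (k : R -> R) (t d : R) : is_derive t 1 k d ->
  forall e, 0 < e -> exists2 r : R, 0 < r & forall s, `|s - t| < r ->
     `|k s - k t - d * (s - t)| <= e * `|s - t|.
Proof.
move=> [/cvg_ex[/= l cv] E] e e0.
have ld : l = d by rewrite -E; apply/esym/cvg_lim.
move: cv; rewrite ld => /cvgrPdist_lt/(_ _ e0).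
rewrite -[X in X -> _]/(nbhs _ _) => /nbhs_ballP[r /= r0 rH]; exists r => // s sr.
have [->|st] := eqVneq s t; first by rewrite !subrr mulr0 subr0 normr0 mulr0.
have st0 : s - t != 0 by rewrite subr_eq0.
have /= := rH (s - t); rewrite /ball /= sub0r normrN => /(_ sr st0).
rewrite /GRing.scale /= mulr1 subrK distrC => /ltW H.
have -> : k s - k t - d * (s - t) = ((s - t)^-1 * (k s - k t) - d) * (s - t).
  by field.
by rewrite normrM ler_wpM2r.
Qed.

Definition cexp (z : C) : C :=
  ofR (expR (cRe z)) * (ofR (cos (cIm z)) + imagi * ofR (sin (cIm z))).

Lemma cexpD z w : cexp (z + w) = cexp z * cexp w.
Proof.
rewrite /cexp ReD ImD expRD cosD sinD !(ofRM, ofRD, ofRN).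
set c1 := ofR (cos (cIm z)); set c2 := ofR (cos (cIm w)).
set s1 := ofR (sin (cIm z)); set s2 := ofR (sin (cIm w)).
have -> : c1 * c2 - s1 * s2 + imagi * (s1 * c2 + c1 * s2) =
  (c1 + imagi * s1) * (c2 + imagi * s2) by
  rewrite -[in LHS]mulN1r -imagi2; ring.
by ring.
Qed.

Lemma cexp0 : cexp 0 = 1.
Proof. by rewrite /cexp -ofR0 Re_ofR Im_ofR expR0 cos0 sin0 !ofR0 !ofR1; ring. Qed.

Lemma cexp_ofR (x : R) : cexp (ofR x) = ofR (expR x).
Proof. by rewrite /cexp Re_ofR Im_ofR cos0 sin0 ofR0 ofR1 mulr0 addr0 mulr1. Qed.

Lemma cabs_cexp z : cabs (cexp z) = expR (cRe z).
Proof.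
rewrite /cexp cabsM cabs_ofR ger0_norm ?expR_ge0//.
suff -> : cabs (ofR (cos (cIm z)) + imagi * ofR (sin (cIm z))) = 1
  by rewrite mulr1.
rewrite cabs_def ReD ImD ReM ImM !Re_ofR !Im_ofR Re_i Im_i.
by rewrite !(mul0r, mul1r, mulr0, subr0, addr0, add0r) cos2Dsin2 sqrtr1.
Qed.

Lemma cexp_neq0 z : cexp z != 0.
Proof. by rewrite -cabs_gt0 cabs_cexp expR_gt0. Qed.

Lemma cexp_periodic z : cexp (z + imagi * ofR (2 * pi)) = cexp z.
Proof.
rewrite /cexp ReD ImD ReM ImM !Re_ofR !Im_ofR Re_i Im_i.
rewrite !(mul0r, mul1r, mulr0, subr0, addr0, add0r).
by rewrite mulr_natl cosD2pi sinD2pi.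
Qed.

Lemma cexp_periodicn z (n : nat) :
  cexp (z + imagi * ofR (2 * pi * n%:R)) = cexp z.
Proof.
elim: n => [|n IH]; first by rewrite mulr0 ofR0 mulr0 addr0.
by rewrite -[n.+1%:R]natr1 mulrDr mulr1 ofRD mulrDr addrA cexp_periodic.
Qed.

Lemma cderiv_cexp0 : cderiv cexp 0 1.
Proof.
(* The first-order errors of [expR], [cos] and [sin] add up to at most [6 * e * cabs h], below
   [e0 * cabs h]. The cap by 1 keeps [e] and the factors [expR x], [sin y] under control in the
   products. *)
move=> e0 e00; pose e := Num.min 1 e0 / 8.
have m0 : 0 < Num.min 1 e0 by rewrite lt_min e00 ltr01.
have e_gt0 : 0 < e by rewrite divr_gt0.
have e_le1 : 8 * e <= 1 by rewrite mulrC divfK// ge_min lexx.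
have e_lee : 8 * e <= e0 by rewrite mulrC divfK// ge_min lexx orbT.
have [r1 r10 H1] := epsdelta_is_derive (is_derive_expR (0 : R)) e_gt0.
have [r2 r20 H2] := epsdelta_is_derive (is_derive_cos (0 : R)) e_gt0.
have [r3 r30 H3] := epsdelta_is_derive (is_derive_sin (0 : R)) e_gt0.
exists (Num.min (Num.min r1 r2) (Num.min r3 (e / 2))).
  by rewrite !lt_min r10 r20 r30 divr_gt0.
move=> h; rewrite subr0 !lt_min => /andP[/andP[h1 h2] /andP[h3 h4]].
have hx := Re_le_cabs h; have hy := Im_le_cabs h.
set x := cRe h in hx; set y := cIm h in hy.
have {}H1 : `|expR x - 1 - x| <= e * `|x|.
  by have := H1 x; rewrite expR0 subr0 mul1r; apply; exact: le_lt_trans h1.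
have {}H2 : `|cos y - 1| <= e * `|y|.
  have := H2 y; rewrite cos0 sin0 subr0 oppr0 mul0r subr0; apply.
  exact: le_lt_trans h2.
have {}H3 : `|sin y - y| <= e * `|y|.
  have := H3 y; rewrite cos0 sin0 !subr0 mul1r; apply.
  exact: le_lt_trans h3.
have x4 : `|x| <= e / 2 by rewrite (le_trans hx)// ltW.
have Ex : `|expR x - 1| <= e.
  rewrite -[expR x - 1](subrK x); apply: le_trans (ler_normD _ _) _.
  have : e * `|x| <= 1 * (e / 2).
    by apply: ler_pM => //; [exact: ltW|lra].
  lra.
have Ex2 : `|expR x| <= 2.
  rewrite -[expR x](subrK 1); apply: le_trans (ler_normD _ _) _.
  by rewrite normr1; lra.
have sy : `|sin y| <= 2 * `|y|.
  rewrite -[sin y](subrK y); apply: le_trans (ler_normD _ _) _.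
  have : e * `|y| <= 1 * `|y| by apply: ler_wpM2r => //; lra.
  lra.
apply: le_trans (cabs_le_ReIm _) _.
rewrite cexp0 /cexp mul1r !(ReD, ImD, ReN, ImN, ReM, ImM, Re_ofR, Im_ofR, Re_i, Im_i).
rewrite -/x -/y.
rewrite !(mul0r, mul1r, mulr0, subr0, addr0, add0r).
have -> : expR x * cos y - 1 - x = (expR x - 1 - x) + expR x * (cos y - 1) by ring.
have -> : expR x * sin y - y = (expR x - 1) * sin y + (sin y - y) by ring.
have A1 := ler_normD (expR x - 1 - x) (expR x * (cos y - 1)).
have A2 := ler_normD ((expR x - 1) * sin y) (sin y - y).
have A3 : `|expR x * (cos y - 1)| <= 2 * (e * `|y|).
  by rewrite normrM; apply: ler_pM.
have A4 : `|(expR x - 1) * sin y| <= e * (2 * `|y|).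
  by rewrite normrM; apply: ler_pM.
have A5 : e * `|x| <= e * cabs h by rewrite ler_wpM2l// ltW.
have A6 : e * `|y| <= e * cabs h by rewrite ler_wpM2l// ltW.
have A7 : 8 * e * cabs h <= e0 * cabs h by rewrite ler_wpM2r// cabs_ge0.
have A8 : 0 <= e * cabs h by rewrite mulr_ge0// ?cabs_ge0 ?ltW.
lra.
Qed.

Lemma cderiv_cexp z : cderiv cexp z (cexp z).
Proof.
have -> : cexp = (fun w => cexp z * cexp (w - z)).
  by apply/funext => w; rewrite -cexpD addrC subrK.
have H : cderiv (fun w : C => w - z) z (1 - 0).
  by apply: cderivB; [exact: cderiv_id|exact: cderiv_cst].
have H0 : cderiv cexp (z - z) 1 by rewrite subrr; exact: cderiv_cexp0.
have := cderivZ (cexp z) (cderiv_comp H H0).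
by rewrite subrr cexp0 subr0 !mulr1.
Qed.

Lemma cderiv_cexp_comp f (z d : C) : cderiv f z d ->
  cderiv (fun w => cexp (f w)) z (cexp (f z) * d).
Proof. by move=> H; apply: (cderiv_comp H); exact: cderiv_cexp. Qed.

(** The argument is [acos] of the normalised real part, with the sign of the imaginary part; its
    modulus is at most [pi], hence the constant 4. *)
Lemma cexp_surj (A : C) : A != 0 ->
  exists2 l, cexp l = A & cabs l <= `|ln (cabs A)| + 4.
Proof.
move=> A0; have A1 : 0 < cabs A by rewrite cabs_gt0.
pose x := cRe A / cabs A; pose y := cIm A / cabs A.
have xy : x ^+ 2 + y ^+ 2 = 1.
  rewrite /x /y !expr_div_n -mulrDl -sqr_cabs divff// expf_neq0// gt_eqF//.
have x1 : -1 <= x <= 1.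
  by rewrite -ler_norml -(@expr_le1 _ 2)// real_normK ?num_real//
     -xy lerDl sqr_ge0.
pose th := if 0 <= y then acos x else - acos x.
have cth : cos th = x.
  by rewrite /th; case: ifP => _; rewrite ?cosN acosK// in_itv.
have sth : sin th = y.
  have s2 : Num.sqrt (1 - x ^+ 2) = `|y|.
    by rewrite -xy addrAC subrr add0r sqrtr_sqr.
  rewrite /th; case: ifPn => y0; rewrite ?sinN sin_acos// s2.
    by rewrite ger0_norm.
  by rewrite ltr0_norm ?opprK// ltNge.
exists (ofR (ln (cabs A)) + imagi * ofR th).
  rewrite /cexp !(ReD, ImD, ReM, ImM, Re_ofR, Im_ofR, Re_i, Im_i).
  rewrite !(mul0r, mul1r, mulr0, subr0, addr0, add0r) lnK ?posrE// cth sth.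
  apply: c_eq;
  rewrite !(ReD, ImD, ReM, ImM, Re_ofR, Im_ofR, Re_i, Im_i) /x /y.
    by field; rewrite gt_eqF.
  by field; rewrite gt_eqF.
apply: le_trans (cabsD _ _) _; rewrite cabsM cabs_i mul1r !cabs_ofR lerD2l.
have -> : `|th| = acos x.
  by rewrite /th; case: ifP => _; rewrite ?normrN ger0_norm// acos_ge0.
apply: le_trans (acos_lepi _) _ => //.
by have h := @pihalf_lt2 R; lra.
Qed.

End ComplexExponential.

Opaque cexp.

(** * Goursat's lemma for Riemann sums on dyadic grids *)

Section Goursat.
Context {R : realType}.
Local Notation C := (Cplx R).

(* Riemann sum of the contour integral of [F] along a box of a grid with horizontal step
   [a] and vertical step [b]. *)
Definition bsum (a b : C) (F : nat -> nat -> C) (i1 i2 j1 j2 : nat) : C :=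
  b * (\sum_(j1 <= j < j2) (F i2 j - F i1 j)) -
  a * (\sum_(i1 <= i < i2) (F i j2 - F i j1)).

Lemma bsum_cati a b F i1 i2 i3 j1 j2 : (i1 <= i2 <= i3)%N ->
  bsum a b F i1 i3 j1 j2 = bsum a b F i1 i2 j1 j2 + bsum a b F i2 i3 j1 j2.
Proof.
move=> /andP[i12 i23]; rewrite /bsum (@big_cat_nat _ _ _ i2 i1 i3)//=.
rewrite (_ : \sum_(j1 <= j < j2) (F i3 j - F i1 j) =
  \sum_(j1 <= j < j2) (F i2 j - F i1 j) + \sum_(j1 <= j < j2) (F i3 j - F i2 j)).
  by ring.
by rewrite -big_split; apply: eq_bigr => j _ /=; ring.
Qed.

Lemma bsum_catj a b F i1 i2 j1 j2 j3 : (j1 <= j2 <= j3)%N ->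
  bsum a b F i1 i2 j1 j3 = bsum a b F i1 i2 j1 j2 + bsum a b F i1 i2 j2 j3.
Proof.
move=> /andP[j12 j23]; rewrite /bsum (@big_cat_nat _ _ _ j2 j1 j3)//=.
rewrite (_ : \sum_(i1 <= i < i2) (F i j3 - F i j1) =
  \sum_(i1 <= i < i2) (F i j2 - F i j1) + \sum_(i1 <= i < i2) (F i j3 - F i j2)).
  by ring.
by rewrite -big_split; apply: eq_bigr => j _ /=; ring.
Qed.

Lemma bsumB a b F F' i1 i2 j1 j2 :
  bsum a b (fun i j => F i j - F' i j) i1 i2 j1 j2 =
  bsum a b F i1 i2 j1 j2 - bsum a b F' i1 i2 j1 j2.
Proof.
rewrite /bsum.
by rewrite /= !sumrB; ring.
Qed.

(** Exact, without discretisation error: both terms of [bsum] equal [d * a * b] times the number of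
    cells. Hence near a point of differentiability only the remainder of the linear approximation
    contributes. *)
Lemma bsum_affine a b (c d : C) i1 i2 j1 j2 : (i1 <= i2)%N -> (j1 <= j2)%N ->
  bsum a b (fun i j => c + d * (i%:R * a + j%:R * b)) i1 i2 j1 j2 = 0.
Proof.
move=> i12 j12; rewrite /bsum.
rewrite (eq_bigr (fun=> d * a * (i2%:R - i1%:R))); last by move=> j _; ring.
rewrite [X in _ - a * X](eq_bigr (fun=> d * b * (j2%:R - j1%:R))); last first.
  by move=> j _; ring.
rewrite !sumr_const_nat -[_ *+ (j2 - j1)]mulr_natr -[_ *+ (i2 - i1)]mulr_natr.
rewrite (natrB _ i12) (natrB _ j12).
move: (i1%:R : C) (i2%:R : C) (j1%:R : C) (j2%:R : C) => u1 u2 u3 u4.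
by ring.
Qed.

Lemma bsum_bound a b F i1 i2 j1 j2 (K : R) : (i1 <= i2)%N -> (j1 <= j2)%N ->
  (forall i j, (i1 <= i <= i2)%N -> (j1 <= j <= j2)%N -> cabs (F i j) <= K) ->
  cabs (bsum a b F i1 i2 j1 j2) <=
    2 * K * (cabs b * (j2 - j1)%:R + cabs a * (i2 - i1)%:R).
Proof.
move=> i12 j12 H; apply: le_trans (cabsBD _ _) _; rewrite !cabsM.
have S1 : cabs (\sum_(j1 <= j < j2) (F i2 j - F i1 j)) <= 2 * K * (j2 - j1)%:R.
  apply: le_trans (cabs_sum _ _ _) _.
  rewrite mulr_natr -sumr_const_nat big_nat [leRHS]big_nat.
  apply: ler_sum => j /andP[h1 h2]; apply: le_trans (cabsBD _ _) _.
  rewrite mulr_natl mulr2n; apply: lerD; apply: H;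
  by rewrite ?i12 ?leqnn ?h1 ?(ltnW h2).
have S2 : cabs (\sum_(i1 <= i < i2) (F i j2 - F i j1)) <= 2 * K * (i2 - i1)%:R.
  apply: le_trans (cabs_sum _ _ _) _.
  rewrite mulr_natr -sumr_const_nat big_nat [leRHS]big_nat.
  apply: ler_sum => j /andP[h1 h2]; apply: le_trans (cabsBD _ _) _.
  rewrite mulr_natl mulr2n; apply: lerD; apply: H;
  by rewrite ?j12 ?leqnn ?h1 ?(ltnW h2).
rewrite mulrDr; apply: lerD.
  by rewrite mulrCA ler_wpM2l ?cabs_ge0.
by rewrite mulrCA ler_wpM2l ?cabs_ge0.
Qed.

(** Each step halves a dyadic interval and keeps one half; the supremum of the left endpoints lies
    in all of them. *)
Lemma dyadic_nested (p : nat -> nat) : (p 0 = 0)%N ->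
  (forall k, (p k.+1 = (p k).*2 \/ p k.+1 = (p k).*2.+1)%N) ->
  exists2 s : R, 0 <= s <= 1 &
    forall k, (p k)%:R / 2 ^+ k <= s <= (p k).+1%:R / 2 ^+ k.
Proof.
move=> p0 pS; pose u k : R := (p k)%:R / 2 ^+ k.
have E2 k : (2 ^+ k : R) != 0 by rewrite expf_neq0.
have P2 k : (0 < 2 ^+ k :> R) by rewrite exprn_gt0.
have du k : u k <= u k.+1 /\ u k.+1 + 1 / 2 ^+ k.+1 <= u k + 1 / 2 ^+ k.
  have h (x y : R) : x / 2 ^+ k = 2 * x / 2 ^+ k.+1.
    by rewrite exprS; field; rewrite E2.
  rewrite /u !(h (p k)%:R 0) !(h 1 0) -!mulrDl !ler_pM2r ?invr_gt0//.
  by case: (pS k) => ->; rewrite -?[_.*2.+1%:R]natr1 -muln2 natrM; lra.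
have mono k m : u k <= u (k + m)%N /\
    u (k + m)%N + 1 / 2 ^+ (k + m) <= u k + 1 / 2 ^+ k.
  elim: m => [|m [IH1 IH2]]; first by rewrite addn0.
  by rewrite addnS; have [] := du (k + m)%N; lra.
have ub k m : u m <= u k + 1 / 2 ^+ k.
  have p1 m' : (0 : R) <= 1 / 2 ^+ m' by rewrite divr_ge0 ?ltW.
  case: (leqP k m) => [/subnKC <-|/ltnW/subnKC <-].
    by have [_] := mono k (m - k)%N; have := p1 (k + (m - k))%N; lra.
  by have [] := mono m (k - m)%N; have := p1 (m + (k - m))%N; lra.
have hS : has_sup [set u k | k in setT].
  split; first by exists (u 0%N), 0%N.
  by exists (u 0%N + 1 / 2 ^+ 0) => _ [k _ <-]; exact: ub.
exists (sup [set u k | k in setT]).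
  have u0 : u 0%N = 0 by rewrite /u p0 mul0r.
  rewrite -{1}u0; apply/andP; split.
    by apply: ub_le_sup; [case: hS|exists 0%N].
  apply: ge_sup; first by case: hS.
  by move=> _ [k _ <-]; apply: le_trans (ub 0%N k) _; rewrite u0 expr0; lra.
move=> k; apply/andP; split; first by apply: ub_le_sup; [case: hS|exists k].
apply: ge_sup; first by case: hS.
move=> _ [m _ <-]; apply: le_trans (ub k m) _.
by rewrite /u -mulrDl natr1.
Qed.

Context (G : C -> C) (x y a b : R).
Hypotheses (a0 : 0 < a) (b0 : 0 < b).

Let pt (s t : R) : C := ofR (x + a * s) + imagi * ofR (y + b * t).
Let ma n : C := ofR (a / 2 ^+ n).
Let mb n : C := imagi * ofR (b / 2 ^+ n).
Let F n (i j : nat) := G (pt (i%:R / 2 ^+ n) (j%:R / 2 ^+ n)).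
Let box k p q m := bsum (ma (k + m)) (mb (k + m)) (F (k + m))
  (p * 2 ^ m) (p.+1 * 2 ^ m) (q * 2 ^ m) (q.+1 * 2 ^ m).
(** The bound scales like the area of a box of generation [k], so the bounds of the four children
    add up to that of the parent. It is asked only for fine enough subdivisions [m]. *)
Let good (e : R) k p q :=
  exists m0, forall m, (m0 <= m)%N -> cabs (box k p q m) <= e / 4 ^+ k.

Let good_merge e k p q :
  good e k.+1 p.*2 q.*2 -> good e k.+1 p.*2.+1 q.*2 ->
  good e k.+1 p.*2 q.*2.+1 -> good e k.+1 p.*2.+1 q.*2.+1 -> good e k p q.
Proof.
move=> [m1 H1] [m2 H2] [m3 H3] [m4 H4].
(* The successor is the shift of generation: the parent cut with [m.+1] and its children cut with
   [m] live on the same grid. *)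
exists (maxn (maxn m1 m2) (maxn m3 m4)).+1 => -[//|m].
rewrite ltnS !geq_max => /andP[/andP[/H1 {}H1 /H2 {}H2] /andP[/H3 {}H3 /H4 {}H4]].
have -> : box k p q m.+1 =
   box k.+1 p.*2 q.*2 m + box k.+1 p.*2.+1 q.*2 m +
   (box k.+1 p.*2 q.*2.+1 m + box k.+1 p.*2.+1 q.*2.+1 m).
  rewrite /box !addSn !addnS.
  have E r : (r * 2 ^ m.+1 = r.*2 * 2 ^ m)%N by rewrite expnS mulnA muln2.
  rewrite !E !doubleS -!bsum_cati; last first.
  - by rewrite !leq_mul2r !leqnSn ?leqW ?orbT.
  - by rewrite !leq_mul2r !leqnSn ?leqW ?orbT.
  by rewrite -bsum_catj// !leq_mul2r !leqnSn ?leqW ?orbT.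
apply: le_trans (cabsD _ _) _.
have := cabsD (box k.+1 p.*2 q.*2 m) (box k.+1 p.*2.+1 q.*2 m).
have := cabsD (box k.+1 p.*2 q.*2.+1 m) (box k.+1 p.*2.+1 q.*2.+1 m).
have -> : e / 4 ^+ k = 4 * (e / 4 ^+ k.+1).
  by rewrite exprS; field; rewrite expf_neq0.
move: H1 H2 H3 H4; lra.
Qed.

Hypothesis dG : forall s t : R, 0 <= s <= 1 -> 0 <= t <= 1 ->
  exists d, cderiv G (pt s t) d.

(** Subtracting the linear approximation at [pt s t] does not change the sum by [bsum_affine]; the
    remainder is small against the diameter, and diameter times perimeter is comparable to the
    area. *)
Let good_local (e s t : R) : 0 < e -> 0 <= s <= 1 -> 0 <= t <= 1 ->
  exists k0, forall k p q, (k0 <= k)%N ->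
    p%:R / 2 ^+ k <= s <= p.+1%:R / 2 ^+ k ->
    q%:R / 2 ^+ k <= t <= q.+1%:R / 2 ^+ k -> good e k p q.
Proof.
move=> e0 s01 t01; have [d dd] := dG s01 t01.
have ab0 : 0 < a + b by rewrite addr_gt0.
(* One factor [(a + b) / 2 ^+ k] comes from the diameter, the other from the side lengths, and 2
   from [bsum_bound]; together they leave exactly [e / 4 ^+ k]. *)
have E0 : 0 < e / (2 * (a + b) ^+ 2) by rewrite divr_gt0// mulr_gt0// exprn_gt0.
have [r r0 rH] := dd _ E0.
have [k0 Hk0] : exists k0, forall k, (k0 <= k)%N -> (a + b) / 2 ^+ k < r.
  have /archi_boundP : 0 <= (a + b) / r by rewrite divr_ge0 ?ltW.
  set n := Num.bound _ => nb; exists n => k nk.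
  rewrite ltr_pdivrMr ?exprn_gt0// mulrC -ltr_pdivrMr//.
  apply: lt_le_trans nb _; rewrite -natrX ler_nat.
  by apply: leq_trans nk _; rewrite ltnW// ltn_expl.
exists k0 => k p q kk0 sp tq; exists 0%N => m _.
set n := (k + m)%N.
have E2 l : (2 ^+ l : R) != 0 by rewrite expf_neq0.
have P2 l : (0 < 2 ^+ l :> R) by rewrite exprn_gt0.
have dist c i (u : R) : c%:R / 2 ^+ k <= u <= c.+1%:R / 2 ^+ k ->
    (c * 2 ^ m <= i <= c.+1 * 2 ^ m)%N -> `|i%:R / 2 ^+ n - u| <= 1 / 2 ^+ k.
  move=> /andP[u1 u2] /andP[i1 i2].
  have E l : l%:R / 2 ^+ k = (l * 2 ^ m)%:R / 2 ^+ n :> R.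
    by rewrite natrM natrX /n exprD; field; rewrite !E2.
  have h1 : c%:R / 2 ^+ k <= i%:R / 2 ^+ n :> R.
    by rewrite E ler_pM2r ?invr_gt0// ler_nat.
  have h2 : i%:R / 2 ^+ n <= c.+1%:R / 2 ^+ k :> R.
    by rewrite E ler_pM2r ?invr_gt0// ler_nat.
  have h3 : c.+1%:R / 2 ^+ k = c%:R / 2 ^+ k + 1 / 2 ^+ k :> R.
    by rewrite -mulrDl natr1.
  by rewrite ler_norml; apply/andP; split; lra.
pose A (i j : nat) := G (pt s t) + d * (pt 0 0 - pt s t) +
  d * (i%:R * ma n + j%:R * mb n).
have ptE (i j : nat) : pt (i%:R / 2 ^+ n) (j%:R / 2 ^+ n) =
    pt 0 0 + (i%:R * ma n + j%:R * mb n).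
  rewrite /pt /ma /mb !mulr0 !addr0 -!ofR_nat !ofRD.
  rewrite !ofRM; ring.
have K i j : (p * 2 ^ m <= i <= p.+1 * 2 ^ m)%N ->
    (q * 2 ^ m <= j <= q.+1 * 2 ^ m)%N ->
    cabs (F n i j - A i j) <= e / (2 * (a + b) ^+ 2) * ((a + b) / 2 ^+ k).
  move=> hi hj.
  have D : cabs (pt (i%:R / 2 ^+ n) (j%:R / 2 ^+ n) - pt s t) <= (a + b) / 2 ^+ k.
    have -> : pt (i%:R / 2 ^+ n) (j%:R / 2 ^+ n) - pt s t =
      ofR (a * (i%:R / 2 ^+ n - s)) + imagi * ofR (b * (j%:R / 2 ^+ n - t)).
      by rewrite /pt !(ofRD, ofRM, ofRN); ring.
    apply: le_trans (cabsD _ _) _; rewrite cabsM cabs_i mul1r !cabs_ofR !normrM.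
    rewrite (gtr0_norm a0) (gtr0_norm b0) mulrDl.
    rewrite -[(2 ^+ k)^-1]mul1r.
    by apply: lerD; rewrite ler_pM2l//; [exact: dist sp hi|exact: dist tq hj].
  have -> : F n i j - A i j = G (pt (i%:R / 2 ^+ n) (j%:R / 2 ^+ n)) - G (pt s t) -
      d * (pt (i%:R / 2 ^+ n) (j%:R / 2 ^+ n) - pt s t).
    by rewrite /F /A ptE; ring.
  apply: le_trans (rH _ _) _; first exact: le_lt_trans D (Hk0 _ kk0).
  by rewrite ler_wpM2l// ltW.
have le2 c : (c * 2 ^ m <= c.+1 * 2 ^ m)%N by rewrite leq_mul2r leqnSn orbT.
have := bsum_bound (ma n) (mb n) (le2 p) (le2 q) K.
rewrite bsumB bsum_affine// subr0 -/(box k p q m) => /le_trans; apply.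
have sub c : (c.+1 * 2 ^ m - c * 2 ^ m = 2 ^ m)%N by rewrite -mulnBl subSn ?subnn ?mul1n.
rewrite !sub /ma /mb cabsM cabs_i mul1r !cabs_ofR !gtr0_norm ?divr_gt0//.
rewrite le_eqVlt; apply/orP; left; apply/eqP.
rewrite /n exprD natrX (_ : 4 = 2 * 2 :> R); last by rewrite -natrM.
rewrite exprMn; field; rewrite !E2 /=.
by rewrite gt_eqF.
Qed.

(* The bisection is run on Riemann sums: [good] boxes merge into good boxes and small boxes
   are good, so a bad box would contain a nested sequence of bad boxes. *)
Lemma goursat_rectangle (e : R) : 0 < e ->
  exists n0, forall n, (n0 <= n)%N ->
    cabs (bsum (ma n) (mb n) (F n) 0 (2 ^ n) 0 (2 ^ n)) <= e.
Proof.
move=> e0; suff [m0 H] : good e 0 0 0.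
  exists m0 => n /H; rewrite /box !mul0n !mul1n add0n expr0 divr1.
  by [].
apply: contrapT => bad0.
pose bad k (pq : nat * nat) := ~ good e k pq.1 pq.2.
pose child (pq pq' : nat * nat) :=
  (pq'.1 = pq.1.*2 \/ pq'.1 = pq.1.*2.+1) /\
  (pq'.2 = pq.2.*2 \/ pq'.2 = pq.2.*2.+1).
have step k pq : bad k pq -> exists pq', child pq pq' /\ bad k.+1 pq'.
  move=> H; apply: contrapT => /forallNP N; apply: H.
  have {}N p' q' : (p' = pq.1.*2 \/ p' = pq.1.*2.+1) ->
      (q' = pq.2.*2 \/ q' = pq.2.*2.+1) -> good e k.+1 p' q'.
    by move=> hp hq; apply: contrapT => h; apply: (N (p', q')).
  by apply: good_merge; apply: N; auto.
pose X := {kpq : nat * (nat * nat) | bad kpq.1 kpq.2}.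
have stepX (u : X) : {v : X | (sval v).1 = (sval u).1.+1 /\
    child (sval u).2 (sval v).2}.
  apply: cid; case: u => [[k pq] /= H]; have [pq' [h1 h2]] := step _ _ H.
  by exists (exist _ (k.+1, pq') h2).
pose u0 : X := exist _ (0%N, (0%N, 0%N)) bad0.
pose u := fix u n := if n is n'.+1 then sval (stepX (u n')) else u0.
have uk n : (sval (u n)).1 = n.
  by elim: n => //= n IH; case: (stepX (u n)) => v /= [-> _]; rewrite IH.
have uc n : child (sval (u n)).2 (sval (u n.+1)).2.
  by rewrite /=; case: (stepX (u n)) => v /= [].
have [|k|s s01 sP] := @dyadic_nested (fun n => (sval (u n)).2.1).
- by [].
- by have [] := uc k.
have [|k|t t01 tP] := @dyadic_nested (fun n => (sval (u n)).2.2).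
- by [].
- by have [] := uc k.
have [k0 H] := good_local e0 s01 t01.
have := svalP (u k0); rewrite /bad uk; apply.
by apply: H.
Qed.

End Goursat.

(** * Cauchy's estimate from sums over circles *)

Section CauchyEstimate.
Context {R : realType}.
Local Notation C := (Cplx R).
Implicit Types (f g S : C -> C).

Definition holo_on (z : C) (r : R) f :=
  forall w, cabs (w - z) < r -> exists d, cderiv f w d.

Let circ (n j : nat) : C := cexp (imagi * ofR (2 * pi * (j%:R / 2 ^+ n))).

Let cabs_circ n j : cabs (circ n j) = 1.
Proof.
by rewrite cabs_cexp ReM Re_i Im_i Re_ofR Im_ofR mul0r mulr0 subr0 expR0.
Qed.

(* Goursat's lemma for the [2 pi i]-periodic function [w |-> S (z0 + cexp w)]: the vertical
   sides of a period strip carry the sums over two circles, the horizontal ones cancel. *)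
Lemma circle_sums S (z0 : C) (r0 rho r : R) : 0 < rho -> rho < r -> r < r0 ->
  (forall w, 0 < cabs (w - z0) < r0 -> exists d, cderiv S w d) ->
  forall e : R, 0 < e -> exists n,
   cabs (\sum_(0 <= j < 2 ^ n)
      (S (z0 + ofR r * circ n j) - S (z0 + ofR rho * circ n j))) <= e * 2 ^+ n.
Proof.
move=> rho0 rhor rr0 dS e e0.
have r_gt0 : 0 < r by exact: lt_trans rhor.
(* The exponential maps the rectangle with corner [ln rho], width [a] and height one period onto the
   annulus between the circles. *)
pose a := ln r - ln rho; pose b : R := 2 * pi.
have a0 : 0 < a by rewrite subr_gt0 ltr_ln.
have b0 : 0 < b by rewrite mulr_gt0// pi_gt0.
pose G w := S (z0 + cexp w).
have expE (s t : R) : cexp (ofR (ln rho + a * s) + imagi * ofR (0 + b * t)) =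
    ofR (expR (ln rho + a * s)) * cexp (imagi * ofR (b * t)).
  by rewrite cexpD add0r cexp_ofR.
have dG (s t : R) : 0 <= s <= 1 -> 0 <= t <= 1 ->
    exists d, cderiv G (ofR (ln rho + a * s) + imagi * ofR (0 + b * t)) d.
  move=> /andP[s0 s1] _; set p := _ + _.
  have [|d dd] := dS (z0 + cexp p).
    rewrite addrC addKr cabs_cexp expR_gt0/= /p ReD ReM Re_i Im_i !Re_ofR !Im_ofR.
    rewrite mul0r mulr0 subr0 addr0; apply: le_lt_trans rr0.
    rewrite -[leRHS]lnK ?posrE// ler_expR.
    by have := ler_wpM2l (ltW a0) s1; rewrite /a; lra.
  have dz : cderiv (fun w => z0 + cexp w) p (0 + cexp p).
    by apply: cderivD; [exact: cderiv_cst|exact: cderiv_cexp].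
  by exists (d * (0 + cexp p)); exact: (cderiv_comp dz dd).
have [n0 H] := goursat_rectangle a0 b0 dG e0.
exists n0; have := H n0 (leqnn _); rewrite /bsum.
have E2 : (2 ^+ n0 : R) != 0 by rewrite expf_neq0.
have P2 : (0 < 2 ^+ n0 :> R) by rewrite exprn_gt0.
rewrite [X in _ - _ * X]big1 ?mulr0 ?subr0; last first.
  move=> i _; rewrite natrX divff// mul0r /G !expE.
  rewrite mulr1 mulr0 ofR0 mulr0 -[imagi * ofR b]add0r /b cexp_periodic.
  by rewrite subrr.
rewrite (eq_bigr (fun j => S (z0 + ofR r * circ n0 j) -
    S (z0 + ofR rho * circ n0 j))); last first.
  move=> j _; rewrite /G !expE natrX divff// mul0r mulr0 mulr1 addr0.
  by rewrite /a addrCA subrr addr0 !lnK.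
set X := \sum_(_ <= _ < _) _; rewrite cabsM cabsM cabs_i mul1r cabs_ofR.
rewrite gtr0_norm ?divr_gt0// => h.
have b1 : 1 <= b by have := @pi_ge2 R; rewrite /b; lra.
rewrite -ler_pdivrMr//; apply: le_trans h.
by rewrite mulrAC ler_pM2r ?invr_gt0// ler_peMl// cabs_ge0.
Qed.

(** The quotient [S w = (f w - f z0) / (w - z0)] is holomorphic off [z0], so its averages over two
    circles nearly agree: on a small circle the average is close to [d], on a circle of radius [r]
    it is at most [M / r]. *)
Lemma cauchy_estimate0 f (z0 d : C) (r0 M : R) : 0 < r0 -> holo_on z0 r0 f ->
  (forall w, cabs (w - z0) < r0 -> cabs (f w - f z0) <= M) ->
  cderiv f z0 d -> cabs d * r0 <= M.
Proof.
move=> r00 hf fM df.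
have M0 : 0 <= M by have := fM z0; rewrite !subrr !cabs0; exact.
(* The circles must lie inside the open disc; if [M < cabs d * r0], the midpoint of [M / cabs d] and
   [r0] is a radius that contradicts the bound. *)
suff H r : 0 < r -> r < r0 -> cabs d <= M / r.
  rewrite leNgt; apply/negP => Md.
  have d0 : 0 < cabs d.
    by rewrite lt_def cabs_ge0 andbT; apply: contraL Md => /eqP ->; rewrite mul0r -leNgt.
  have h1 : M / cabs d < r0 by rewrite ltr_pdivrMr// mulrC.
  have h0 : 0 <= M / cabs d by rewrite divr_ge0// ltW.
  have r1 : 0 < (M / cabs d + r0) / 2 by rewrite divr_gt0// ltr_wpDl.
  have := H _ r1; rewrite ler_pdivlMr// => /(_ _).
  have -> : cabs d * ((M / cabs d + r0) / 2) = (M + cabs d * r0) / 2.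
    by field; rewrite gt_eqF.
  by move=> h; have := h ltac:(lra); lra.
move=> r_gt0 rr0; apply/ler_addgt0Pl => e e0.
pose S w := (f w - f z0) / (w - z0).
have dS w : 0 < cabs (w - z0) < r0 -> exists d, cderiv S w d.
  move=> /andP[w0 wr]; have [d' dd'] := hf _ wr.
  have wz : w - z0 != 0 by rewrite -cabs_gt0.
  have D1 : cderiv (fun w => f w - f z0) w (d' - 0).
    by apply: cderivB => //; exact: cderiv_cst.
  have D2 : cderiv (fun w : C => w - z0) w (1 - 0).
    by apply: cderivB; [exact: cderiv_id|exact: cderiv_cst].
  by eexists; apply: (cderivM D1 (cderivV D2 wz)).
have e2 : 0 < e / 2 by rewrite divr_gt0.
have [s s0 sH] := df _ e2.
pose rho := Num.min s r / 2.
have rho0 : 0 < rho by rewrite divr_gt0// lt_min s0.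
have [rhos rhor] : rho < s /\ rho < r.
  have h1 : Num.min s r <= s by rewrite ge_min lexx.
  have h2 : Num.min s r <= r by rewrite ge_min lexx orbT.
  by rewrite /rho; split; lra.
have [n Hn] := circle_sums rho0 rhor rr0 dS e2.
have P2 : (0 < 2 ^+ n :> R) by rewrite exprn_gt0.
have sr : cabs (\sum_(0 <= j < 2 ^ n) S (z0 + ofR r * circ n j)) <= M / r * 2 ^+ n.
  apply: le_trans (cabs_sum _ _ _) _.
  rewrite -natrX mulr_natr -[in leRHS](subn0 (2 ^ n)%N) -sumr_const_nat.
  apply: ler_sum => j _; rewrite /S [z0 + _ - z0]addrC addKr !cabsM cabsV cabsM.
  rewrite cabs_circ mulr1 cabs_ofR gtr0_norm// ler_pM2r ?invr_gt0//.
  by apply: fM; rewrite addrC addKr cabsM cabs_circ mulr1 cabs_ofR gtr0_norm.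
have srho : cabs (\sum_(0 <= j < 2 ^ n) (S (z0 + ofR rho * circ n j) - d))
    <= e / 2 * 2 ^+ n.
  apply: le_trans (cabs_sum _ _ _) _.
  rewrite -natrX mulr_natr -[in leRHS](subn0 (2 ^ n)%N) -sumr_const_nat.
  apply: ler_sum => j _.
  have E : cabs (z0 + ofR rho * circ n j - z0) = rho.
    by rewrite addrC addKr cabsM cabs_circ mulr1 cabs_ofR gtr0_norm.
  have nz : z0 + ofR rho * circ n j - z0 != 0 by rewrite -cabs_gt0 E.
  have -> : S (z0 + ofR rho * circ n j) - d =
    (f (z0 + ofR rho * circ n j) - f z0 - d * (z0 + ofR rho * circ n j - z0)) /
    (z0 + ofR rho * circ n j - z0) by rewrite /S; field.
  rewrite cabsM cabsV ler_pdivrMr ?cabs_gt0//.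
  by apply: sH; rewrite E.
rewrite -(ler_pM2r P2) mulrDl.
have -> : cabs d * 2 ^+ n = cabs (\sum_(0 <= j < 2 ^ n) d).
  by rewrite sumr_const_nat subn0 -[d *+ _]mulr_natr cabsM cabs_nat natrX.
set A := \sum_(_ <= _ < _) S _ in sr.
set B := \sum_(_ <= _ < _) (S _ - d) in srho.
set D := \sum_(_ <= _ < _) (S _ - S _) in Hn.
have -> : \sum_(0 <= j < 2 ^ n) d = A - B - D.
  rewrite /A /B /D !sumrB; set a1 := \sum_(_ <= _ < _) S _.
  by ring.
have := cabsBD (A - B) D; have := cabsBD A B; lra.
Qed.

Lemma cauchy_estimate f (z0 d : C) (r0 M : R) : 0 < r0 -> holo_on z0 r0 f ->
  (forall w, cabs (w - z0) < r0 -> cabs (f w) <= M) ->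
  cderiv f z0 d -> cabs d * r0 <= 2 * M.
Proof.
move=> r00 hf fM; apply: cauchy_estimate0 => // w wr.
apply: le_trans (cabsBD _ _) _; rewrite mulr_natl mulr2n lerD ?fM//.
by rewrite subrr cabs0.
Qed.

End CauchyEstimate.

(** * Weierstrass' theorem, higher derivatives and Taylor remainder *)

Section HolomorphicFunctions.
Context {R : realType}.
Local Notation C := (Cplx R).
Implicit Types (f g : C -> C).

Definition cder f : C -> C := (f^`())%classic.

Lemma cderE f z d : cderiv f z d -> cder f z = d.
Proof. by move=> /cderiv_derivable[]. Qed.

Lemma cder_derive1 f z : cder f z = (f^`()%classic z).
Proof. by []. Qed.

Opaque cder.

Lemma holo_cderiv f z r w : holo_on z r f -> cabs (w - z) < r ->
  cderiv f w (cder f w).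
Proof. by move=> h /h[d dd]; rewrite (cderE dd). Qed.

Lemma holo_sub f z r z' r' : cabs (z' - z) + r' <= r -> holo_on z r f ->
  holo_on z' r' f.
Proof.
by move=> zr h w wr; apply: h; have := cabs_tri w z' z; lra.
Qed.

Lemma holoB f g z r : holo_on z r f -> holo_on z r g ->
  holo_on z r (fun w => f w - g w).
Proof.
move=> hf hg w wr; have [d dd] := hf _ wr; have [d' dd'] := hg _ wr.
by exists (d - d'); exact: cderivB.
Qed.

Lemma cderB f g z r w : holo_on z r f -> holo_on z r g -> cabs (w - z) < r ->
  cder (fun w => f w - g w) w = cder f w - cder g w.
Proof.
by move=> hf hg wr; apply: cderE; apply: cderivB; apply: holo_cderiv wr.
Qed.

Lemma cauchy_bound f z r r' M : 0 < r' -> holo_on z r f ->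
  (forall w, cabs (w - z) < r -> cabs (f w) <= M) ->
  forall w, cabs (w - z) + r' <= r -> cabs (cder f w) * r' <= 2 * M.
Proof.
move=> r'0 hf fM w wr.
apply: (@cauchy_estimate R f w) => //; first exact: holo_sub hf.
- by move=> x xr; apply: fM; have := cabs_tri x w z; lra.
- by apply: (holo_cderiv hf); lra.
Qed.

Section Weierstrass.
Context {T : Type} {U : set_system T} {UU : UltraFilter U}.
Context (F : T -> C -> C) (f : C -> C) (z : C) (r : R).
Hypothesis cvF : forall e : R, 0 < e -> \forall n \near U, holo_on z r (F n) /\
  forall w, cabs (w - z) < r -> cabs (F n w - f w) <= e.

(** Cauchy's estimate for [F n - F m] makes the derivatives uniformly close near [w]; their limit
    along [U] at [w] is the derivative, by an argument with three thirds of [e0] through one fixed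
    [F m]. *)
Lemma holo_limit : holo_on z r f.
Proof.
move=> w wr.
have [s sE] : exists s, 2 * s = r - cabs (w - z).
  by exists ((r - cabs (w - z)) / 2); field.
have s0 : 0 < s by move: wr; lra.
have key n m (e : R) :
    holo_on z r (F n) /\ (forall w, cabs (w - z) < r -> cabs (F n w - f w) <= e) ->
    holo_on z r (F m) /\ (forall w, cabs (w - z) < r -> cabs (F m w - f w) <= e) ->
    forall x, cabs (x - w) < s -> cabs (cder (F n) x - cder (F m) x) <= 4 * e / s.
  move=> [hn bn] [hm bm] x xs.
  have xw := cabs_tri x w z.
  rewrite -(cderB hn hm); last by lra.
  rewrite ler_pdivlMr//; have -> : 4 * e = 2 * (2 * e) by ring.
  apply: (cauchy_bound s0 (holoB hn hm)); last by lra.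
  move=> y yr; have -> : F n y - F m y = (F n y - f y) - (F m y - f y) by ring.
  by apply: le_trans (cabsBD _ _) _; have := bn _ yr; have := bm _ yr; lra.
have ws : cabs (w - w) < s by rewrite subrr cabs0.
have [m1 Hm1] := filter_ex (cvF ltr01).
have [|d dP] := @ultra_lim R T U _ (fun n => cder (F n) w)
    (4 * 1 / s + cabs (cder (F m1) w)).
  apply: filterS (cvF ltr01) => n Hn.
  have h1 := key _ _ _ Hn Hm1 _ ws.
  have h2 := cabs_le (cder (F n) w) (cder (F m1) w).
  apply: (le_trans h2).
  by rewrite lerD2r.
exists d => e0 e00.
(* Chosen so that the bound [4 * e / s] of [key] becomes [e0 / 3]. *)
have [e eE] : exists e, e = e0 * s / 12 by eexists.
have e_gt0 : 0 < e by rewrite eE divr_gt0// mulr_gt0.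
have [m Hm] := filter_ex (cvF e_gt0).
have KE : 4 * e / s = e0 / 3 by rewrite eE; field; rewrite gt_eqF.
have dm : cabs (d - cder (F m) w) <= e0 / 3.
  apply: ultra_lim_le dP _; apply: filterS (cvF e_gt0) => n Hn.
  by rewrite -KE; exact: (key _ _ _ Hn Hm).
have e3 : 0 < e0 / 3 by rewrite divr_gt0.
have [dl dl0 dlH] := holo_cderiv Hm.1 wr e3.
exists (Num.min dl s); first by rewrite lt_min dl0.
move=> x; rewrite lt_min => /andP[/dlH xd xs].
have xr : cabs (x - z) < r.
  by have := cabs_tri x w z; lra.
(* The differentiability of [f] is what is being proved, so the mean value inequality is applied to
   [F n - F m] and then passed to the limit in [n]. *)
have A : cabs ((f x - F m x) - (f w - F m w)) <= e0 / 3 * cabs (x - w).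
  apply/ler_addgt0Pl => e' e'0; have e'2 : 0 < e' / 2 by rewrite divr_gt0.
  have [n [Hn Hn']] := filter_ex (filterI (cvF e_gt0) (cvF e'2)).
  have B : cabs ((F n x - F m x) - (F n w - F m w)) <= e0 / 3 * cabs (x - w).
    apply: (@mean_value_disc R (fun x => F n x - F m x)
      (fun x => cder (F n) x - cder (F m) x) w w x s); last 2 first.
    - exact: ws.
    - exact: xs.
      move=> y ys; have yr : cabs (y - z) < r.
        by have := cabs_tri y w z; lra.
      by apply: cderivB; apply: holo_cderiv yr; [exact: Hn.1|exact: Hm.1].
    by move=> y ys; rewrite -KE; exact: (key _ _ _ Hn Hm).
  have -> : f x - F m x - (f w - F m w) =
    (F n x - F m x - (F n w - F m w)) - (F n x - f x) + (F n w - f w) by ring.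
  have := cabsD (F n x - F m x - (F n w - F m w) - (F n x - f x)) (F n w - f w).
  have := cabsBD (F n x - F m x - (F n w - F m w)) (F n x - f x).
  by have := Hn'.2 _ xr; have := Hn'.2 _ wr; lra.
have -> : f x - f w - d * (x - w) = ((f x - F m x) - (f w - F m w)) +
  (F m x - F m w - cder (F m) w * (x - w)) - (d - cder (F m) w) * (x - w) by ring.
have D : cabs ((d - cder (F m) w) * (x - w)) <= e0 / 3 * cabs (x - w).
  by rewrite cabsM ler_wpM2r ?cabs_ge0.
have := cabsBD ((f x - F m x) - (f w - F m w) +
  (F m x - F m w - cder (F m) w * (x - w))) ((d - cder (F m) w) * (x - w)).
have := cabsD ((f x - F m x) - (f w - F m w))
  (F m x - F m w - cder (F m) w * (x - w)).
lra.
Qed.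

(** Cauchy's estimate for [F n - f], now known to be holomorphic. *)
Lemma cder_limit r' e : 0 < r' -> 0 < e -> \forall n \near U,
  forall w, cabs (w - z) + r' <= r -> cabs (cder (F n) w - cder f w) <= e.
Proof.
move=> r'0 e0; have E : 0 < e * r' / 2 by rewrite divr_gt0// mulr_gt0.
apply: filterS (cvF E) => n [hn bn] w wr.
have hf := holo_limit.
rewrite -(cderB hn hf); last by lra.
rewrite -(ler_pM2r r'0).
have -> : e * r' = 2 * (e * r' / 2) by field.
exact: (cauchy_bound r'0 (holoB hn hf)).
Qed.

End Weierstrass.

(** A free ultrafilter replaces the passage to convergent subsequences. *)
Lemma nat_ultra : exists2 U : set_system nat, UltraFilter U & \oo `<=` U.
Proof.
by have [U [UU sU]] := ultraFilterLemma eventually_filter; exists U.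
Qed.

Lemma harmonic_small (e : R) : 0 < e -> exists N, forall n, (N <= n)%N ->
  n.+1%:R^-1 < e.
Proof.
move=> e0; have /archi_boundP : 0 <= e^-1 by rewrite invr_ge0 ltW.
set N := Num.bound _ => Ne; exists N => n Nn.
rewrite invf_plt ?posrE//; apply: lt_le_trans Ne _.
by rewrite ler_nat leqW.
Qed.

(* Cauchy's estimate makes [f] and then [f'] locally Lipschitz, so the difference quotients
   of [f] converge to [f'] locally uniformly. *)
Lemma holo_cder f z r : holo_on z r f -> holo_on z r (cder f).
Proof.
move=> hf w wr.
have /cont_cabsP/(_ _ ltr01)[s1 s10 s1H] := cderiv_cont (holo_cderiv hf wr).
pose s := Num.min s1 (r - cabs (w - z)).
have s0 : 0 < s by rewrite lt_min s10 subr_gt0.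
have hs : holo_on w s f.
  have sr : s <= r - cabs (w - z) by rewrite ge_min lexx orbT.
  by apply: holo_sub hf; lra.
pose M := cabs (f w) + 1.
have M0 : 0 < M by rewrite ltr_wpDl ?cabs_ge0.
have fM x : cabs (x - w) < s -> cabs (f x) <= M.
  have ss1 : s <= s1 by rewrite ge_min lexx.
  move=> xs; have /ltW := s1H x (lt_le_trans xs ss1).
  by have := cabs_le (f x) (f w); rewrite /M; lra.
pose L := 4 * M / s.
have s2 k : (0 < k)%N -> 0 < s / k%:R by move=> k0; rewrite divr_gt0// ltr0n.
have f1 x : cabs (x - w) < s / 2 -> cabs (cder f x) <= L.
  move=> xs; have := cauchy_bound (s2 2%N isT) hs fM (w := x).
  have -> : L = 2 * M / (s / 2) by rewrite /L; field; rewrite gt_eqF.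
  by move=> h'; rewrite ler_pdivlMr ?divr_gt0//; apply: h'; lra.
pose q h x := (f (x + h) - f x) / h.
have dq h x : h != 0 -> cabs h < s / 4 -> cabs (x - w) < s / 4 ->
    cderiv (q h) x ((cder f (x + h) - cder f x) / h).
  move=> h0 hs4 xs4.
  have h1 : cabs (x + h - w) < s.
    by have := cabsD (x - w) h; rewrite addrAC; lra.
  have D1 : cderiv (fun y : C => y + h) x (1 + 0).
    by apply: cderivD; [exact: cderiv_id|exact: cderiv_cst].
  have := cderiv_comp D1 (holo_cderiv hs h1); rewrite addr0 mulr1 => D2.
  have D3 : cderiv f x (cder f x) by apply: (holo_cderiv hs); lra.
  have := cderivM (cderivB D2 D3) (cderiv_cst h^-1 x).
  by rewrite mulr0 addr0.
pose K := 16 * L / s.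
(* The increment of [cder f] divided by [h] is the derivative of the difference quotient [q h],
   which is bounded by [L]; Cauchy's estimate for [q h] gives the Lipschitz constant without a
   second derivative of [f]. *)
have lip h x : cabs h < s / 4 -> cabs (x - w) < s / 8 ->
    cabs (cder f (x + h) - cder f x) <= K * cabs h.
  move=> hs4 xs8; have [->|h0] := eqVneq h 0.
    by rewrite addr0 subrr cabs0 mulr0.
  rewrite -ler_pdivrMr ?cabs_gt0// -cabsV -cabsM.
  have -> : (cder f (x + h) - cder f x) / h = cder (q h) x.
    by apply/esym/cderE; apply: dq => //; lra.
  have hq : holo_on w (s / 4) (q h) by move=> y ys; eexists; exact: dq.
  have qL y : cabs (y - w) < s / 4 -> cabs (q h y) <= L.
    move=> ys; rewrite /q cabsM cabsV ler_pdivrMr ?cabs_gt0//.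
    have {2}-> : h = y + h - y by rewrite addrC addKr.
    apply: (@mean_value_disc R f (cder f) w y (y + h) (s / 2)); last 2 first.
    - by lra.
    - by have := cabsD (y - w) h; rewrite addrAC; lra.
    - by move=> u us; apply: (holo_cderiv hs); lra.
    - exact: f1.
  have := cauchy_bound (s2 8%N isT) hq qL (w := x).
  have -> : K = 2 * L / (s / 8) by rewrite /K; field; rewrite gt_eqF.
  by move=> h'; rewrite ler_pdivlMr ?divr_gt0//; apply: h'; lra.
have K0 : 0 < K by rewrite /K /L !(divr_gt0, mulr_gt0).
have cq h x : h != 0 -> cabs h < s / 8 -> cabs (x - w) < s / 8 ->
    cabs (q h x - cder f x) <= K * cabs h.
  move=> h0 hs8 xs8.
  have H : cabs ((f (x + h) - cder f x * (x + h)) - (f x - cder f x * x)) <=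
     K * cabs h * cabs (x + h - x).
    apply: (@mean_value_segment R (fun y => f y - cder f x * y)
      (fun y => cder f y - cder f x * 1)) => t /andP[t0 t1].
    rewrite [x + h - x]addrC addKr.
    have th : cabs (ofR t * h) <= cabs h.
      by rewrite cabsM cabs_ofR ger0_norm// ler_piMl ?cabs_ge0.
    split.
      apply: cderivB; last by apply: cderivZ; exact: cderiv_id.
      apply: (holo_cderiv hs).
      by have := cabsD (x - w) (ofR t * h); rewrite addrAC; lra.
    rewrite mulr1; apply: le_trans (lip _ _ _ xs8) _; first by lra.
    by rewrite ler_wpM2l// ltW.
  have -> : q h x - cder f x =
      ((f (x + h) - cder f x * (x + h)) - (f x - cder f x * x)) / h.
    by rewrite /q; field.
  rewrite cabsM cabsV ler_pdivrMr ?cabs_gt0//; move: H.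
  by rewrite [x + h - x]addrC addKr.
have [U UU sU] := nat_ultra.
suff H : holo_on w (s / 8) (cder f) by apply: H; rewrite subrr cabs0 s2.
apply: (@holo_limit nat U UU (fun n => q (ofR n.+1%:R^-1))) => e e0.
have m0 : 0 < Num.min (s / 8) (e / K) by rewrite lt_min s2// divr_gt0.
have [N NH] := harmonic_small m0.
apply: sU; exists N => // n /= /NH; rewrite lt_min => /andP[n1 n2].
have : 0 < n.+1%:R^-1 :> R by rewrite invr_gt0.
move: n.+1%:R^-1 n1 n2 => t n1 n2 t0.
have n0 : ofR t != 0 :> C by rewrite ofR_eq0 gt_eqF.
have nE : cabs (ofR t : C) = t by rewrite cabs_ofR gtr0_norm.
split.
  by move=> x xs; eexists; apply: dq => //; rewrite ?nE; lra.
move=> x xs; apply: le_trans (cq _ _ n0 _ xs) _; first by rewrite nE.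
by rewrite nE mulrC -ler_pdivlMr// ltW.
Qed.

(** Cauchy's estimate used twice: [4 * M / r] bounds the first derivative on the half disc, and
    [32 * M / r ^+ 2] the second on the quarter disc. The mean value inequality is applied to
    [cder f] and then to [f] minus its linear part. *)
Lemma taylor_bound f z r M h : 0 < r -> holo_on z r f ->
  (forall w, cabs (w - z) < r -> cabs (f w) <= M) -> cabs h < r / 4 ->
  cabs (f (z + h) - f z - cder f z * h) <= 32 * M / r ^+ 2 * cabs h ^+ 2.
Proof.
move=> r0 hf fM hr.
have r4 : 0 < r / 4 by rewrite divr_gt0.
have f1 x : cabs (x - z) < r / 2 -> cabs (cder f x) <= 4 * M / r.
  move=> xs; have := @cauchy_bound f z r (r / 2) M ltac:(lra) hf fM x.
  have -> : 4 * M / r = 2 * M / (r / 2) by field; rewrite gt_eqF.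
  by move=> h'; rewrite ler_pdivlMr ?divr_gt0//; apply: h'; lra.
have hf1 : holo_on z (r / 2) (cder f).
  by apply: holo_sub (holo_cder hf); rewrite subrr cabs0; lra.
have f2 x : cabs (x - z) < r / 4 -> cabs (cder (cder f) x) <= 32 * M / r ^+ 2.
  move=> xs; have := @cauchy_bound (cder f) z (r / 2) (r / 4) _ r4 hf1 f1 x.
  have -> : 32 * M / r ^+ 2 = 2 * (4 * M / r) / (r / 4) by field; rewrite gt_eqF.
  by move=> h'; rewrite ler_pdivlMr ?divr_gt0//; apply: h'; lra.
set K := 32 * M / r ^+ 2 in f2 *.
have K0 : 0 <= K.
  by apply: le_trans (cabs_ge0 _) (f2 z _); rewrite subrr cabs0.
have H : cabs ((f (z + h) - cder f z * (z + h)) - (f z - cder f z * z)) <=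
     K * cabs h * cabs (z + h - z).
  apply: (@mean_value_segment R (fun y => f y - cder f z * y)
      (fun y => cder f y - cder f z * 1)) => t /andP[t0 t1].
  rewrite [z + h - z]addrC addKr.
  have th : cabs (ofR t * h) <= cabs h.
    by rewrite cabsM cabs_ofR ger0_norm// ler_piMl ?cabs_ge0.
  have D : cabs (z + ofR t * h - z) <= cabs h by rewrite addrC addKr.
  split.
    apply: cderivB; last by apply: cderivZ; exact: cderiv_id.
    by apply: (holo_cderiv hf); lra.
  rewrite mulr1.
  have := @mean_value_disc R (cder f) (cder (cder f)) z z (z + ofR t * h)
    (r / 4) K _ f2.
  rewrite subrr cabs0 => /(_ _ r4 (le_lt_trans D hr)) h1.
  apply: le_trans (h1 _) _; last by rewrite ler_wpM2l.
  by move=> y ys; apply: (holo_cderiv hf1); lra.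
move: H; rewrite [z + h - z]addrC addKr -mulrA -expr2.
by congr (cabs _ <= _); ring.
Qed.

(** Points where [cabs f] exceeds [n] would converge along [U] to a point of the closed disc, where
    continuity bounds [f]. *)
Lemma bounded_on_disc f z r : (forall w, cabs (w - z) <= r -> cont_at f w) ->
  exists M, forall w, cabs (w - z) <= r -> cabs (f w) <= M.
Proof.
move=> cf; apply: contrapT => /forallNP N.
have {}N n : exists w, cabs (w - z) <= r /\ n%:R < cabs (f w).
  have /existsNP[w /not_implyP[w1 /negP]] := N n%:R.
  by rewrite -ltNge => w2; exists w.
have [w wP] := choice N.
have [U UU sU] := nat_ultra.
have [|l lP] := @ultra_lim R nat U UU w (r + cabs z).
  apply: filterE => n; have := cabs_le (w n) z; have := (wP n).1; lra.
have lr : cabs (l - z) <= r.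
  by apply: ultra_lim_le lP _; apply: filterE => n; exact: (wP n).1.
have /cont_cabsP/(_ _ ltr01)[d d0 dH] := cf _ lr.
have /archi_boundP := addr_ge0 (cabs_ge0 (f l)) ler01.
set n0 := Num.bound _ => n0H.
have sn : \forall n \near U, (n0 <= n)%N by apply: sU; exists n0.
have [n [n1 n2]] := filter_ex (filterI (lP _ d0) sn).
have := dH _ n1; have := cabs_le (f (w n)) (f l); have := (wP n).2.
have : (n0%:R <= n%:R :> R) by rewrite ler_nat.
lra.
Qed.

End HolomorphicFunctions.

(** * Primitives as limits of Riemann sums *)

Section Primitive.
Context {R : realType}.
Local Notation C := (Cplx R).
Implicit Types (f g : C -> C).

Lemma cderiv_sum (n : nat) (F : nat -> C -> C) (d : nat -> C) (z : C) :
  (forall k, (k < n)%N -> cderiv (F k) z (d k)) ->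
  cderiv (fun w => \sum_(0 <= k < n) F k w) z (\sum_(0 <= k < n) d k).
Proof.
elim: n => [|n IH] H.
  rewrite big_geq//; apply: (@cderiv_near _ (fun=> 0) _ _ _ 1) => //.
    by move=> w _; rewrite big_geq.
  exact: cderiv_cst.
rewrite big_nat_recr//=.
have -> : (fun w => \sum_(0 <= k < n.+1) F k w) =
    (fun w => \sum_(0 <= k < n) F k w + F n w).
  by apply/funext => w; rewrite big_nat_recr.
apply: cderivD; last exact: H.
by apply: IH => k kn; apply: H; exact: ltnW.
Qed.

(* Riemann sums of [z * f (t * z)] for [t] in [[0, 1]]. *)
Definition riemann_primitive f (n : nat) (z : C) : C :=
  \sum_(0 <= k < n.+1) (z * ofR n.+1%:R^-1) * f (z * ofR (k%:R / n.+1%:R)).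

(** With [psi w = w * f w], the derivative [d] of the sum is a Riemann sum of the derivative of
    [psi] along the radius. Since [z * f z] telescopes into increments of [psi], [z * (d - f z)] is
    a sum of [n.+1] second-order Taylor remainders. *)
Lemma riemann_primitive_deriv f (r0 r : R) : r < r0 -> holo_on 0 r0 f ->
  exists K N, forall n z, (N <= n)%N -> cabs z < r -> exists2 d,
   cderiv (riemann_primitive f n) z d & cabs (d - f z) <= K / n.+1%:R.
Proof.
move=> rr0 hf.
have [r_le0|r_gt0] := leP r 0.
  by exists 0, 0%N => n z _ zr; have := cabs_ge0 z; lra.
pose psi z := z * f z.
have dpsi w : cabs (w - 0) < r0 -> cderiv psi w (1 * f w + w * cder f w).
  by move=> wr; apply: cderivM; [exact: cderiv_id|exact: (holo_cderiv hf)].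
have [s [sr ss0]] : exists s, r < s /\ s < r0 by exists ((r + r0) / 2); lra.
have [M MP] : exists M, forall w, cabs (w - 0) <= s -> cabs (psi w) <= M.
  apply: bounded_on_disc => w ws; apply: (cderiv_cont (d := 1 * f w + w * cder f w)).
  by apply: dpsi; lra.
have sr0 : 0 < s - r by lra.
have hpsi w : cabs w < r -> holo_on w (s - r) psi.
  move=> wr x xw; eexists; apply: dpsi.
  by rewrite subr0; have := cabs_le x w; lra.
have bpsi w : cabs w < r -> forall x, cabs (x - w) < s - r -> cabs (psi x) <= M.
  by move=> wr x xw; apply: MP; rewrite subr0; have := cabs_le x w; lra.
have [K KE] : exists K, K = 32 * M / (s - r) ^+ 2 by eexists.
have K0 : 0 <= K.
  have M0 : 0 <= M by apply: le_trans (cabs_ge0 _) (MP 0 _); rewrite subrr cabs0; lra.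
  by rewrite KE divr_ge0 ?exprn_ge0 ?mulr_ge0//; lra.
(* The threshold makes a step of length [cabs z / n.+1] shorter than [(s - r) / 4], as
   [taylor_bound] requires. *)
have [N NP] := @harmonic_small R ((s - r) / (4 * r)) ltac:(by rewrite divr_gt0// mulr_gt0).
exists (K * r), N => n z Nn zr.
have := NP _ Nn; have : 0 < n.+1%:R^-1 :> R by rewrite invr_gt0.
rewrite /riemann_primitive.
have E1 : n.+1%:R * n.+1%:R^-1 = 1 :> R by rewrite divff.
set t := n.+1%:R^-1 in E1 * => t0 ts.
pose zeta k : C := z * ofR (k%:R * t).
have zetar k : (k <= n.+1)%N -> cabs (zeta k) <= cabs z.
  move=> kn; rewrite cabsM cabs_ofR ler_piMr ?cabs_ge0// ger0_norm.
    by rewrite /t ler_pdivrMr// mul1r ler_nat.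
  by rewrite mulr_ge0// ltW.
pose dps w := f w + w * cder f w.
have dpsE w : cabs w < r -> cder psi w = dps w.
  by move=> wr; rewrite (cderE (dpsi _ _)) ?subr0 ?mul1r//; lra.
exists (\sum_(0 <= k < n.+1) ofR t * dps (zeta k)).
  apply: cderiv_sum => k kn.
  have zk : cabs (zeta k - 0) < r0.
    by have := zetar k (ltnW kn); rewrite subr0; lra.
  have D1 : cderiv (fun w : C => w * ofR (k%:R * t)) z (1 * ofR (k%:R * t) + z * 0).
    by apply: cderivM; [exact: cderiv_id|exact: cderiv_cst].
  have D2 := cderiv_comp D1 (holo_cderiv hf zk).
  have D3 : cderiv (fun w : C => w * ofR t) z (1 * ofR t + z * 0).
    by apply: cderivM; [exact: cderiv_id|exact: cderiv_cst].
  have := cderivM D3 D2.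
  set a := (X in cderiv _ _ X -> _); set b := (X in _ -> cderiv _ _ X).
  suff -> : a = b by [].
  by rewrite /a /b /dps /zeta; ring.
(* The telescoping identity is divided by [z]; at [z = 0] the derivative of the sum is exactly
   [f 0]. *)
have [z0|zn0] := eqVneq z 0.
  have zeta0 k : zeta k = 0 by rewrite /zeta z0 mul0r.
  under eq_bigr do rewrite zeta0.
  rewrite sumr_const_nat subn0 -[_ *+ n.+1]mulr_natr /dps mul0r addr0 z0.
  rewrite mulrAC -ofR_nat -ofRM mulrC -[t * _]mulrC E1 ofR1 mulr1 subrr cabs0.
  by rewrite mulr_ge0 ?mulr_ge0 ?(ltW r_gt0)// ltW.
have zp : 0 < cabs z by rewrite cabs_gt0.
have key : z * ((\sum_(0 <= k < n.+1) ofR t * dps (zeta k)) - f z) =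
   - \sum_(0 <= k < n.+1) (psi (zeta k + z * ofR t) - psi (zeta k) -
      cder psi (zeta k) * (z * ofR t)).
  have zS k : zeta k + z * ofR t = zeta k.+1.
    by rewrite /zeta -natr1 !(ofRM, ofRD) ofR1; ring.
  rewrite sumrB.
  have -> : \sum_(0 <= k < n.+1) (psi (zeta k + z * ofR t) - psi (zeta k)) =
      psi (zeta n.+1) - psi (zeta 0%N).
    under eq_bigr do rewrite zS.
    exact: (telescope_sumr (fun k => psi (zeta k))).
  have -> : zeta 0%N = 0 by rewrite /zeta mul0r ofR0 mulr0.
  have -> : zeta n.+1 = z by rewrite /zeta E1 ofR1 mulr1.
  rewrite [X in - (_ - X)](eq_big_nat _ _ (F2 := fun k => z * (ofR t * dps (zeta k)))); last first.
    move=> k /andP[_ kn]; rewrite dpsE; first by ring.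
    by apply: le_lt_trans (zetar _ _) zr; exact: ltnW.
  by rewrite mulrBr mulr_sumr /psi; ring.
rewrite -(ler_pM2l zp) -cabsM key cabsN.
apply: le_trans (cabs_sum _ _ _) _.
apply: (@le_trans _ _ (\sum_(0 <= k < n.+1) (K * (cabs z * t) ^+ 2))).
  rewrite big_nat [leRHS]big_nat; apply: ler_sum => k /andP[_ kn].
  have zk : cabs (zeta k) < r by apply: le_lt_trans (zetar _ _) zr; exact: ltnW.
  have cE : cabs (z * ofR t) = cabs z * t by rewrite cabsM cabs_ofR gtr0_norm.
  rewrite -cE KE; apply: (taylor_bound sr0 (hpsi _ zk) (bpsi _ zk)).
  rewrite cE; apply: (@le_lt_trans _ _ (r * t)).
    by rewrite ler_wpM2r ?ltW.
  have -> : (s - r) / 4 = r * ((s - r) / (4 * r)) by field; rewrite gt_eqF.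
  by rewrite ltr_pM2l.
rewrite sumr_const_nat subn0 -[_ *+ n.+1]mulr_natr.
have -> : K * (cabs z * t) ^+ 2 * n.+1%:R = cabs z * (K * cabs z * t * (n.+1%:R * t)).
  by ring.
by rewrite E1 mulr1 ler_wpM2l ?cabs_ge0// ler_wpM2r ?(ltW t0)// ler_wpM2l// ltW.
Qed.

(** The Riemann sums all vanish at 0, so closeness of their derivatives gives closeness of the sums
    on discs. They converge along [U], and Weierstrass' theorem identifies the derivative of the
    limit with [f]. *)
Lemma primitive0 f (r0 : R) : holo_on 0 r0 f ->
  exists F, forall w, cabs w < r0 -> cderiv F w (f w).
Proof.
move=> hf; have [U UU sU] := nat_ultra.
pose P n := riemann_primitive f n.
have P0 n : P n 0 = 0.
  by rewrite /P /riemann_primitive big1// => k _; rewrite !mul0r.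
have C1 (r e : R) : r < r0 -> 0 < e -> \forall n \near U, forall w, cabs w < r ->
    exists2 d, cderiv (P n) w d & cabs (d - f w) <= e.
  move=> rr0 e0; have [K [N H]] := riemann_primitive_deriv rr0 hf.
  have K1 : 0 < `|K| + 1 by rewrite ltr_wpDl.
  have [N' H'] := harmonic_small (divr_gt0 e0 K1).
  apply: sU; exists (maxn N N') => // n /=; rewrite geq_max => /andP[/H {}H /H' {}H'].
  move=> w /H[d dd dle]; exists d => //; apply: le_trans dle _.
  have t0 : 0 <= n.+1%:R^-1 :> R by rewrite invr_ge0.
  apply: (@le_trans _ _ ((`|K| + 1) / n.+1%:R)).
    by rewrite ler_wpM2r//; have := ler_norm K; lra.
  by move: H'; rewrite ltr_pdivlMr// mulrC => /ltW.
have C2 (r e : R) n m : 0 <= e ->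
   (forall w, cabs w < r -> exists2 d, cderiv (P n) w d & cabs (d - f w) <= e) ->
   (forall w, cabs w < r -> exists2 d, cderiv (P m) w d & cabs (d - f w) <= e) ->
   forall w, cabs w < r -> cabs (P n w - P m w) <= 2 * e * r.
  move=> e0 Hn Hm w wr.
  have := @mean_value_disc R (fun w => P n w - P m w)
    (fun w => cder (P n) w - cder (P m) w) 0 0 w r (2 * e).
  rewrite !P0 !subr0 cabs0 => H; apply: (le_trans (H _ _ _ wr)).
  - move=> x; rewrite subr0 => xr.
    have [d dd _] := Hn _ xr; have [d' dd' _] := Hm _ xr.
    by rewrite (cderE dd) (cderE dd'); exact: cderivB.
  - move=> x; rewrite subr0 => xr.
    have [d dd d1] := Hn _ xr; have [d' dd' d2] := Hm _ xr.
    rewrite (cderE dd) (cderE dd').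
    have -> : d - d' = (d - f x) - (d' - f x) by ring.
    by apply: le_trans (cabsBD _ _) _; lra.
  - exact: le_lt_trans (cabs_ge0 _) wr.
  - by rewrite ler_wpM2l ?mulr_ge0// ltW.
have C3 w : exists l, cabs w < r0 ->
    forall e : R, 0 < e -> \forall n \near U, cabs (P n w - l) < e.
  have [wr0|wr0] := ltP (cabs w) r0; last by exists 0.
  pose r := (cabs w + r0) / 2.
  have [wr rr0] : cabs w < r /\ r < r0 by rewrite /r; split; lra.
  have H := C1 _ _ rr0 ltr01.
  have [m Hm] := filter_ex H.
  have [|l lP] := @ultra_lim R nat U UU (fun n => P n w) (2 * 1 * r + cabs (P m w)).
    apply: filterS H => n Hn; have := C2 _ _ _ _ ler01 Hn Hm _ wr.
    by have := cabs_le (P n w) (P m w); lra.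
  by exists l.
have [F FP] := choice C3; exists F => w wr0.
pose r := (cabs w + r0) / 2.
have [wr rr0] : cabs w < r /\ r < r0 by rewrite /r; split; lra.
have r_gt0 : 0 < r by exact: le_lt_trans (cabs_ge0 _) wr.
have cvF (e : R) : 0 < e -> \forall n \near U, holo_on 0 r (P n) /\
    forall w, cabs (w - 0) < r -> cabs (P n w - F w) <= e.
  move=> e0; have e1 : 0 < e / (2 * r) by rewrite divr_gt0// mulr_gt0.
  have H := C1 _ _ rr0 e1; apply: filterS (H) => n Hn; split.
    by move=> x; rewrite subr0 => /Hn[d dd _]; exists d.
  move=> x; rewrite subr0 => xr; rewrite cabsB.
  apply: (@ultra_lim_le _ _ U _ (fun n => P n x)).
    by apply: FP; exact: lt_trans rr0.
  apply: filterS H => m Hm.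
  have -> : e = 2 * (e / (2 * r)) * r by field; rewrite gt_eqF.
  exact: C2 (ltW e1) Hm Hn _ xr.
have hF : holo_on 0 r F by apply: (holo_limit cvF).
have wr' : cabs (w - 0) < r by rewrite subr0.
suff -> : f w = cder F w by exact: (holo_cderiv hF wr').
apply: (@ultra_lim_unique _ _ U _ (fun n => cder (P n) w)) => e e0.
  have e2 : 0 < e / 2 by lra.
  by apply: filterS (C1 _ _ rr0 e2) => n /(_ _ wr)[d dd]; rewrite (cderE dd); lra.
have e2 : 0 < e / 2 by lra.
have r' : 0 < r - cabs w by lra.
apply: filterS (cder_limit cvF r' e2) => n /(_ w).
by rewrite subr0 => h; have := h ltac:(lra); lra.
Qed.

Lemma primitive f (z0 : C) (r0 : R) : holo_on z0 r0 f ->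
  exists F, forall w, cabs (w - z0) < r0 -> cderiv F w (f w).
Proof.
move=> hf; have D (w c : C) : cderiv (fun w : C => w + c) w 1.
  rewrite -[1]addr0; apply: cderivD; [exact: cderiv_id|exact: cderiv_cst].
have [|F FP] := @primitive0 (fun w => f (w + z0)) r0.
  move=> w; rewrite subr0 => wr; have wz : cabs (w + z0 - z0) < r0 by rewrite addrK.
  by eexists; exact: (cderiv_comp (D w z0) (holo_cderiv hf wz)).
exists (fun w => F (w + - z0)) => w wr.
have := cderiv_comp (D w (- z0)) (FP _ wr).
by rewrite subrK mulr1.
Qed.

End Primitive.

(** * Holomorphic logarithm, Schwarz's lemma for a half-plane, Harnack's inequality *)

Section Harnack.
Context {R : realType}.
Local Notation C := (Cplx R).
Implicit Types (f F : C -> C).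

Lemma cderiv0_const f z (r : R) : (forall w, cabs (w - z) < r -> cderiv f w 0) ->
  forall w, cabs (w - z) < r -> f w = f z.
Proof.
move=> df w wr; apply/eqP; rewrite -subr_eq0 -cabs_eq0 eq_le cabs_ge0 andbT.
have zr : cabs (z - z) < r.
  by rewrite subrr cabs0; exact: le_lt_trans (cabs_ge0 _) wr.
rewrite -[leRHS](mul0r (cabs (w - z))).
by apply: (@mean_value_disc R f (fun=> 0) z z w r) => // x xr; rewrite cabs0.
Qed.

(** For a primitive [H] of the logarithmic derivative, [f * cexp (- H)] has derivative 0, hence is a
    constant [c]. Adding the real number [ln (cabs c)] to [H] suffices, as only the real part of the
    logarithm is prescribed. *)
Lemma log_of_zero_free f z (r : R) : 0 < r -> holo_on z r f ->
  (forall w, cabs (w - z) < r -> f w != 0) ->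
  exists L, forall w, cabs (w - z) < r ->
    cderiv L w (cder f w / f w) /\ cRe (L w) = ln (cabs (f w)).
Proof.
move=> r0 hf f0.
have [|H HP] := @primitive R (fun w => cder f w / f w) z r.
  move=> w wr; eexists; apply: cderivM.
    exact: (holo_cderiv (holo_cder hf) wr).
  by apply: cderivV; [exact: (holo_cderiv hf wr)|exact: f0].
have zr : cabs (z - z) < r by rewrite subrr cabs0.
pose c := f z * cexp (- H z).
have c0 : 0 < cabs c by rewrite cabs_gt0 mulf_neq0 ?cexp_neq0 ?f0.
have E w : cabs (w - z) < r -> f w = c * cexp (H w).
  move=> wr.
  have : f w * cexp (- H w) = c.
    apply: (@cderiv0_const (fun w => f w * cexp (- H w)) z r) => // x xr.
    have := cderivM (holo_cderiv hf xr) (cderiv_cexp_comp (cderivN (HP _ xr))).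
    rewrite (_ : _ + _ = 0)//; have := f0 _ xr.
    by move: (cder f x) (f x) (cexp _) => u v e v0; field.
  by move=> <-; rewrite -mulrA -cexpD addNr cexp0 mulr1.
exists (fun w => H w + ofR (ln (cabs c))) => w wr; split.
  by rewrite -[X in cderiv _ _ X]addr0; apply: cderivD; [exact: HP|exact: cderiv_cst].
rewrite ReD Re_ofR (E _ wr) cabsM lnM ?posrE ?c0// ?cabs_gt0 ?cexp_neq0//.
by rewrite cabs_cexp expRK addrC.
Qed.

(** The Cayley transform [psi] sends the right half-plane into the unit disc and [F z] to 0;
    [cauchy_estimate0] with bound 1 applies to it, and its derivative at [z] is that of [F] divided
    by [2 * cRe (F z)]. *)
Lemma schwarz_halfplane_center F z (r : R) : 0 < r -> holo_on z r F ->
  (forall w, cabs (w - z) < r -> 0 < cRe (F w)) ->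
  cabs (cder F z) * r <= 2 * cRe (F z).
Proof.
move=> r0 hF F0; have zr : cabs (z - z) < r by rewrite subrr cabs0.
pose b := cconj (F z); pose psi w := (F w - F z) / (F w + b).
have Fz0 := F0 _ zr.
have nz w : cabs (w - z) < r -> F w + b != 0.
  move=> wr; apply/eqP => E; have := F0 _ wr.
  have : cRe (F w + b) = 0 by rewrite E -ofR0 Re_ofR.
  by rewrite ReD Re_conj; lra.
have dpsi w (wr : cabs (w - z) < r) :=
  cderivM (cderivB (holo_cderiv hF wr) (cderiv_cst (F z) w))
   (cderivV (cderivD (holo_cderiv hF wr) (cderiv_cst b w)) (nz _ wr)).
have hpsi : holo_on z r psi by move=> w wr; eexists; exact: dpsi.
have psiz : psi z = 0 by rewrite /psi subrr mul0r.
have := @cauchy_estimate0 R psi z _ r 1 r0 hpsi _ (dpsi z zr).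
have -> : F z + b = ofR (2 * cRe (F z)).
  by apply: c_eq; rewrite ?ReD ?ImD ?Re_conj ?Im_conj ?Re_ofR ?Im_ofR; ring.
rewrite subrr mul0r addr0 subr0 cabsM cabsV cabs_ofR gtr0_norm ?mulr_gt0//.
rewrite mulrAC ler_pdivrMr ?mulr_gt0// mul1r; apply => w wr.
rewrite psiz subr0 /psi cabsM cabsV ler_pdivrMr ?cabs_gt0 ?nz// mul1r.
rewrite -(@ler_pXn2r _ 2) ?nnegrE ?cabs_ge0// !sqr_cabs.
rewrite !ReD !ImD !ReN !ImN Re_conj Im_conj lerD2r.
have : 0 <= cRe (F w) * cRe (F z) by rewrite mulr_ge0 ?ltW// F0.
by rewrite !expr2; lra.
Qed.

(* Transport to the centre by the automorphism [t |-> (t + v) / (1 + conj v * t)] of the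
   unit disc. *)
Lemma schwarz_halfplane F z (r : R) w : 0 < r -> holo_on z r F ->
  (forall w, cabs (w - z) < r -> 0 < cRe (F w)) -> cabs (w - z) < r ->
  cabs (cder F w) * (r ^+ 2 - cabs (w - z) ^+ 2) <= 2 * r * cRe (F w).
Proof.
move=> r0 hF F0 wr.
have [v vE] : exists v, v = (w - z) / ofR r by eexists.
have [vb vbE] : exists u, u = cconj v by eexists.
have rC : ofR r != 0 :> C by rewrite ofR_eq0 gt_eqF.
have cv : cabs v = cabs (w - z) / r by rewrite vE cabsM cabsV cabs_ofR gtr0_norm.
have v1 : cabs v < 1 by rewrite cv ltr_pdivrMr// mul1r.
have v2 : 0 < 1 - cabs v ^+ 2.
  by rewrite subr_gt0 expr_lt1// cabs_ge0.
(* The identity showing that the automorphism keeps the unit disc inside itself. *)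
have id2 (t : C) : cabs (1 + vb * t) ^+ 2 - cabs (t + v) ^+ 2 =
    (1 - cabs v ^+ 2) * (1 - cabs t ^+ 2).
  rewrite vbE !sqr_cabs !(ReD, ImD, ReM, ImM) Re_conj Im_conj -[1]ofR1 Re_ofR Im_ofR.
  by ring.
have t1 (t : C) : cabs (t - 0) < 1 -> cabs (t + v) < cabs (1 + vb * t).
  rewrite subr0 => t1; rewrite -(@ltr_pXn2r _ 2) ?nnegrE ?cabs_ge0// -subr_gt0 id2.
  by rewrite mulr_gt0// subr_gt0 expr_lt1// cabs_ge0.
have n0 t : cabs (t - 0) < 1 -> 1 + vb * t != 0.
  by move=> /t1 h; rewrite -cabs_gt0; exact: le_lt_trans (cabs_ge0 _) h.
pose phi (t : C) := z + ofR r * ((t + v) * (1 + vb * t)^-1).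
have phir t : cabs (t - 0) < 1 -> cabs (phi t - z) < r.
  move=> ht; rewrite /phi addrC addKr !cabsM cabsV cabs_ofR gtr0_norm//.
  rewrite -[ltRHS]mulr1 ltr_pM2l// ltr_pdivrMr ?mul1r ?t1//.
  by rewrite cabs_gt0 n0.
have dphi t (ht : cabs (t - 0) < 1) := cderivD (cderiv_cst z t)
  (cderivZ (ofR r) (cderivM (cderivD (cderiv_id t) (cderiv_cst v t))
  (cderivV (cderivD (cderiv_cst 1 t) (cderivZ vb (cderiv_id t))) (n0 _ ht)))).
have h00 : cabs ((0 : C) - 0) < 1 by rewrite subrr cabs0.
have phi0 : phi 0 = w.
  by rewrite /phi mulr0 addr0 add0r invr1 mulr1 vE; field.
have dphi0 := dphi 0 h00.
have hFp : holo_on 0 1 (fun t => F (phi t)).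
  move=> t ht; eexists; apply: (cderiv_comp (dphi t ht)).
  exact: (holo_cderiv hF (phir _ ht)).
have := @schwarz_halfplane_center _ 0 1 ltr01 hFp
  (fun t ht => F0 _ (phir _ ht)).
have DF : cderiv F (phi 0) (cder F w).
  by rewrite phi0; exact: (holo_cderiv hF wr).
rewrite (cderE (cderiv_comp dphi0 DF)) -/phi phi0 mulr1.
have -> : cder F w * (0 + ofR r * ((1 + 0) * (1 + vb * 0)^-1 +
    (0 + v) * (- (0 + vb * 1) / (1 + vb * 0) ^+ 2))) =
  cder F w * ofR (r * (1 - cabs v ^+ 2)).
  by rewrite ofRM ofRD ofRN ofR1 -mul_conj -vbE; field.
rewrite cabsM cabs_ofR gtr0_norm ?mulr_gt0// => H.
have -> : r ^+ 2 - cabs (w - z) ^+ 2 = r * (r * (1 - cabs v ^+ 2)).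
  by rewrite cv; field; rewrite gt_eqF.
have := ler_wpM2l (ltW r0) H; lra.
Qed.

(* [Re F] times [(r + s t) / (r - s t)] is nondecreasing along the radius from [z] to [w]. *)
Lemma harnack_re F z (r : R) w : 0 < r -> holo_on z r F ->
  (forall w, cabs (w - z) < r -> 0 < cRe (F w)) -> cabs (w - z) < r ->
  cRe (F z) * (r - cabs (w - z)) <= cRe (F w) * (r + cabs (w - z)).
Proof.
move=> r0 hF F0 wr.
pose q := w - z; have [s sE] : exists s, s = cabs q by eexists.
have s0 : 0 <= s by rewrite sE cabs_ge0.
have sr : s < r by rewrite sE.
have pr (t : R) : 0 <= t <= 1 -> t * s < r.
  by move=> /andP[t0 t1]; apply: le_lt_trans sr; rewrite ler_piMl.
have pr0 (t : R) : 0 <= t <= 1 -> 0 <= t * s.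
  by move=> /andP[t0 t1]; rewrite mulr_ge0.
(* The monotone factor is taken as a function of a complex variable, so that its product with [F] is
   differentiated by the complex rules and restricted to the real segment by [is_derive_path]. *)
pose g (x : C) := (ofR r + x * ofR s) * (ofR r - x * ofR s)^-1.
have gden (t : R) : 0 <= t <= 1 -> ofR r - ofR t * ofR s != 0.
  move=> t01; rewrite -ofRM -ofRN -ofRD ofR_eq0 gt_eqF// subr_gt0; exact: pr.
have tq (t : R) : 0 <= t <= 1 -> cabs (z + ofR t * q - z) = t * s.
  move=> /andP[t0 _]; rewrite addrC addKr cabsM cabs_ofR ger0_norm//.
  by rewrite sE.
pose dg (t : R) := ofR (2 * r * s / (r - t * s) ^+ 2) : C.
have Dg (t : R) : 0 <= t <= 1 -> cderiv g (ofR t) (dg t).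
  move=> t01; have D1 : cderiv (fun x : C => x * ofR s) (ofR t) (1 * ofR s + ofR t * 0).
    by apply: cderivM; [exact: cderiv_id|exact: cderiv_cst].
  have := cderivM (cderivD (cderiv_cst (ofR r) (ofR t)) D1)
    (cderivV (cderivB (cderiv_cst (ofR r) (ofR t)) D1) (gden _ t01)).
  set a := (X in cderiv _ _ X -> _); suff -> : a = dg t by [].
  have := gden _ t01; rewrite /a /dg => h.
  rewrite !ofRM ofRV ofRX ofRD ofRN ofRM ofR_nat; field.
  exact: h.
have DF (t : R) : 0 <= t <= 1 ->
    cderiv (fun x => F (z + x * q)) (ofR t) (cder F (z + ofR t * q) * q).
  move=> t01; have D1 : cderiv (fun x : C => z + x * q) (ofR t) q.
    rewrite -[q in X in cderiv _ _ X]addr0 -[q in X in cderiv _ _ X]mul1r addrC.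
    apply: cderivD; first exact: cderiv_cst.
    rewrite -[X in cderiv _ _ X]addr0 -[0 in X in cderiv _ _ X](mulr0 (ofR t)).
    by apply: cderivM; [exact: cderiv_id|exact: cderiv_cst].
  apply: (cderiv_comp D1); apply: (holo_cderiv hF).
  by rewrite tq//; exact: pr.
pose Psi x := F (z + x * q) * g x.
pose dPsi (t : R) := cder F (z + ofR t * q) * q * g (ofR t) + F (z + ofR t * q) * dg t.
have DPsi (t : R) : 0 <= t <= 1 -> cderiv Psi (0 + ofR t * 1) (dPsi t).
  by move=> t01; rewrite add0r mulr1; apply: cderivM; [exact: DF|exact: Dg].
have [t t01|t t01 E] := @path_MVT R (fun t => cRe (1 * Psi (0 + ofR t * 1)))
    (fun t => cRe (1 * dPsi t * 1)).
  by apply: is_derive_path; exact: DPsi.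
have gE (x : R) : g (ofR x) = ofR ((r + x * s) / (r - x * s)).
  by rewrite /g ofRM ofRV !(ofRD, ofRN, ofRM).
have ReMr (u : C) (x : R) : cRe (u * ofR x) = cRe u * x.
  by rewrite ReM Re_ofR Im_ofR mulr0 subr0.
(* By [schwarz_halfplane] the relative decrease of [cRe F] is at most
   [2 * r * s / (r ^+ 2 - (t * s) ^+ 2)], which is exactly the logarithmic derivative of the
   factor. *)
have pos : 0 <= cRe (1 * dPsi t * 1).
  rewrite mulr1 mul1r /dPsi /dg gE ReD !ReMr.
  have ts := pr _ t01; have ts0 := pr0 _ t01.
  have zt : cabs (z + ofR t * q - z) < r by rewrite tq.
  have := schwarz_halfplane r0 hF F0 zt; rewrite tq//.
  set u := cRe (F _); set D := cder F _ => H.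
  have h1 : - (cabs D * s) <= cRe (D * q).
    have := Re_le_cabs (D * q); rewrite cabsM -sE ler_norml => /andP[h _].
    exact: h.
  move: (t * s) ts ts0 H => x xr x0 H.
  have d1 : 0 < r - x by lra.
  have d2 : 0 < r + x by lra.
  have -> : cRe (D * q) * ((r + x) / (r - x)) + u * (2 * r * s / (r - x) ^+ 2) =
    (cRe (D * q) * ((r - x) * (r + x)) + 2 * r * u * s) / (r - x) ^+ 2.
    by field; rewrite gt_eqF.
  rewrite divr_ge0 ?exprn_ge0 ?(ltW d1)//.
  have h2 := ler_wpM2r (ltW (mulr_gt0 d1 d2)) h1.
  have h3 := ler_wpM2r s0 H.
  have e : (r - x) * (r + x) = r ^+ 2 - x ^+ 2 by ring.
  rewrite e in h2 *; move: h2 h3; rewrite !mulNr.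
  have -> : cabs D * s * (r ^+ 2 - x ^+ 2) = cabs D * (r ^+ 2 - x ^+ 2) * s by ring.
  by lra.
move: pos; rewrite -E !add0r !mulr1 !mul1r /Psi !gE !ReMr ofR0 ofR1 !mul0r !mul1r.
have -> : z + q = w by rewrite /q addrC subrK.
have -> : cabs (w - z) = s by rewrite sE.
rewrite !addr0 subr0 divff ?gt_eqF// mulr1 subr_ge0.
by rewrite mulrA ler_pdivlMr ?subr_gt0.
Qed.

Lemma harnack_ln f z (r : R) w : 0 < r -> holo_on z r f ->
  (forall w, cabs (w - z) < r -> 1 < cabs (f w)) -> cabs (w - z) < r ->
  ln (cabs (f z)) * (r - cabs (w - z)) <= ln (cabs (f w)) * (r + cabs (w - z)).
Proof.
move=> r0 hf f1 wr.
have f0 x : cabs (x - z) < r -> f x != 0.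
  by move=> /f1 h; rewrite -cabs_gt0; exact: lt_trans h.
have [L LP] := log_of_zero_free r0 hf f0.
have zr : cabs (z - z) < r by rewrite subrr cabs0.
rewrite -(LP _ wr).2 -(LP _ zr).2; apply: harnack_re => //.
  by move=> x xr; eexists; exact: (LP _ xr).1.
by move=> x xr; rewrite (LP _ xr).2 ln_gt0// f1.
Qed.

End Harnack.

(** * Entire functions with bounded spherical derivative *)

Section EntireFunctions.
Context {R : realType}.
Local Notation C := (Cplx R).
Implicit Types (f g : C -> C).

Definition entire f := forall w, exists d, cderiv f w d.

Lemma entire_holo f z r : entire f -> holo_on z r f.
Proof. by move=> ef w _; exact: ef. Qed.
Arguments entire_holo [f] z r _.

Lemma entire_cderiv f w : entire f -> cderiv f w (cder f w).
Proof. by move=> ef; have [d dd] := ef w; rewrite (cderE dd). Qed.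
Arguments entire_cderiv [f] w _.

Lemma entire_cder f : entire f -> entire (cder f).
Proof.
move=> ef w; have H := holo_cder (entire_holo w 1 ef); apply: H.
by rewrite subrr cabs0 ltr01.
Qed.

Lemma entire_const f : entire f -> (forall w, cder f w = 0) ->
  forall w, f w = f 0.
Proof.
move=> ef f0 w; apply: (@cderiv0_const R f 0 (cabs w + 1)).
  by move=> x _; rewrite -(f0 x); exact: entire_cderiv.
by rewrite subr0 ltrDl.
Qed.

Lemma liouville f (M : R) : entire f -> (forall w, cabs (f w) <= M) ->
  forall w, f w = f 0.
Proof.
move=> ef fM; apply: entire_const => // w; apply/eqP.
rewrite -cabs_eq0 eq_le cabs_ge0 andbT; apply/ler_addgt0Pl => e e0; rewrite addr0.
have M0 : 0 <= M by exact: le_trans (cabs_ge0 _) (fM 0).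
have r0 : 0 < (2 * M + 1) / e by rewrite divr_gt0//; lra.
have := cauchy_estimate r0 (entire_holo w _ ef) (fun x _ => fM x) (entire_cderiv w ef).
rewrite mulrA ler_pdivrMr// => h.
have : cabs (cder f w) * (2 * M + 1) <= e * (2 * M + 1) by lra.
by rewrite ler_pM2r//; lra.
Qed.

(** A minimising sequence of the distance is bounded, and its limit along [U] is a minimiser. *)
Lemma nearest_sublevel g (z : C) (c : R) : (forall w, cont_at g w) ->
  (exists w, cabs (g w) <= c) -> exists2 z1, cabs (g z1) <= c &
    forall w, cabs (g w) <= c -> cabs (z1 - z) <= cabs (w - z).
Proof.
move=> cg [w0 w0c].
pose S := [set r | exists2 w, cabs (g w) <= c & r = cabs (w - z)].
have lS : has_inf S.
  split; first by exists (cabs (w0 - z)), w0.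
  by exists 0 => _ [w _ ->]; exact: cabs_ge0.
have H n : exists w, cabs (g w) <= c /\ cabs (w - z) < inf S + n.+1%:R^-1.
  have n0 : 0 < n.+1%:R^-1 :> R by rewrite invr_gt0.
  have [_ [w wc ->] wr] := inf_adherent n0 lS.
  by exists w.
have [w wP] := choice H.
have [U UU sU] := nat_ultra.
have [|l lP] := @ultra_lim R nat U UU w (inf S + 1 + cabs z).
  apply: filterE => n; have := cabs_le (w n) z; have := (wP n).2.
  have : n.+1%:R^-1 <= 1 :> R by rewrite invf_le1// ler1n.
  by move: n.+1%:R^-1 => t; lra.
exists l.
  apply/ler_addgt0Pl => e e0; have /cont_cabsP/(_ _ e0)[d d0 dH] := cg l.
  have [n /dH h] := filter_ex (lP _ d0).
  have := (wP n).1; have := cabs_le (g l) (g (w n)); rewrite (cabsB (g l) (g (w n))); lra.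
move=> x xc; apply: (@le_trans _ _ (inf S)); last first.
  by apply: ge_inf; [case: lS|exists x].
apply/ler_addgt0Pl => e e0; have e2 : 0 < e / 2 by rewrite divr_gt0.
have [N NH] := harmonic_small e2.
have sn : \forall n \near U, (N <= n)%N by apply: sU; exists N.
have [n [n1 /NH n2]] := filter_ex (filterI (lP _ e2) sn).
have := (wP n).2; have := cabs_tri l (w n) z; rewrite (cabsB l (w n)).
by move: n.+1%:R^-1 n2 n1 => t; lra.
Qed.

(* At the point of [{|g| <= 1}] nearest to [z], Harnack's inequality bounds the
   normal derivative of [ln |g|] from below, and [|g'| <= 2 K] bounds it from above. *)
Lemma log_growth g (K : R) : entire g ->
  (forall w, cabs (cder g w) <= K * (1 + cabs (g w) ^+ 2)) ->
  cabs (g 0) <= 1 -> forall z, 1 < cabs (g z) -> ln (cabs (g z)) <= 4 * K * cabs z.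
Proof.
move=> eg gK g0 z gz.
have [||z1 z11 z1P] := @nearest_sublevel g z 1.
- by move=> w; exact: cderiv_cont (entire_cderiv w eg).
- by exists 0.
have [r rE] : exists r, r = cabs (z1 - z) by eexists.
have rz : r <= cabs z by have := z1P _ g0; rewrite sub0r cabsN -rE.
have zz1 : z1 - z != 0.
  by rewrite subr_eq0; apply/eqP => e; move: z11; rewrite e leNgt gz.
have r0 : 0 < r by rewrite rE cabs_gt0.
have g1 w : cabs (w - z) < r -> 1 < cabs (g w).
  by move=> wr; rewrite ltNge; apply/negP => /z1P; rewrite -rE leNgt wr.
have K0 : 0 <= K.
  have h : 0 < 1 + cabs (g z) ^+ 2 by rewrite ltr_pwDl// sqr_ge0.
  by rewrite -(ler_pM2r h) mul0r; exact: le_trans (cabs_ge0 _) (gK z).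
have d1 : cabs (cder g z1) <= 2 * K.
  apply: le_trans (gK z1) _; rewrite mulrC ler_wpM2r//.
  by have : cabs (g z1) ^+ 2 <= 1 by [rewrite expr_le1 ?cabs_ge0]; lra.
suff H (e : R) : 0 < e -> ln (cabs (g z)) <= 2 * ((2 * K + e) * r).
  apply: (@le_trans _ _ (4 * K * r)); last by rewrite ler_wpM2l// mulr_ge0.
  apply/ler_addgt0Pl => e e0; have e1 : 0 < e / (2 * r) by rewrite divr_gt0// mulr_gt0.
  apply: le_trans (H _ e1) _; rewrite le_eqVlt; apply/orP; left; apply/eqP.
  by field; rewrite gt_eqF.
move=> e0; have [d d0 dH] := entire_cderiv z1 eg _ e0.
(* A small step from [z1] towards [z], short enough for the linear approximation at [z1]. At the
   resulting [w], Harnack's inequality carries the weight [r - cabs (w - z) = t * r], which cancels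
   against [cabs (g w) - 1], of order [t * r]. *)
pose t := Num.min 1 (d / r) / 2.
have m0 : 0 < Num.min 1 (d / r) by rewrite lt_min ltr01 divr_gt0.
have m1 : Num.min 1 (d / r) <= 1 by rewrite ge_min lexx.
have m2 : Num.min 1 (d / r) <= d / r by rewrite ge_min lexx orbT.
have [t0 t1 td] : [/\ 0 < t, t < 1 & t < d / r] by rewrite /t; split; lra.
move: t t0 t1 td => {m0 m1 m2} t t0 t1; rewrite ltr_pdivlMr// => td.
pose w := z1 + ofR t * (z - z1).
have wz : cabs (w - z) = (1 - t) * r.
  have -> : w - z = ofR (1 - t) * (z1 - z) by rewrite /w ofRD ofRN ofR1; ring.
  by rewrite cabsM cabs_ofR gtr0_norm ?subr_gt0// -rE.
have wz1 : cabs (w - z1) = t * r.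
  by rewrite /w addrC addKr cabsM cabs_ofR gtr0_norm// cabsB -rE.
have wr : cabs (w - z) < r by rewrite wz; have := mulr_gt0 t0 r0; lra.
have := harnack_ln r0 (entire_holo z r eg) g1 wr; rewrite wz.
have -> : r - (1 - t) * r = t * r by ring.
have lw : ln (cabs (g w)) <= cabs (g w) - 1.
  have := @le_ln1Dx R (cabs (g w) - 1); rewrite [1 + _]addrC subrK; apply.
  by have := g1 _ wr; lra.
have gw : cabs (g w) <= 1 + (2 * K + e) * (t * r).
  have -> : g w = (g w - g z1 - cder g z1 * (w - z1)) + g z1 + cder g z1 * (w - z1).
    by ring.
  apply: le_trans (cabsD _ _) _; rewrite [cabs (cder g z1 * _)]cabsM wz1.
  have := cabsD (g w - g z1 - cder g z1 * (w - z1)) (g z1).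
  have := dH w; rewrite wz1 => /(_ td).
  have := ler_wpM2r (ltW (mulr_gt0 t0 r0)) d1.
  lra.
have lw0 : 0 < ln (cabs (g w)) by rewrite ln_gt0// g1.
move=> H.
have tr0 : 0 < t * r by rewrite mulr_gt0.
have : ln (cabs (g z)) * (t * r) <= 2 * ((2 * K + e) * r) * (t * r).
  apply: (le_trans H); apply: (@le_trans _ _ (ln (cabs (g w)) * (2 * r))).
    rewrite ler_wpM2l ?(ltW lw0)//.
    by have := mulr_gt0 t0 r0; lra.
  have := ler_wpM2r (ltW r0) (le_trans lw (_ : _ <= (2 * K + e) * (t * r))).
  by move=> h; have := h ltac:(lra); lra.
by rewrite ler_pM2r.
Qed.

(** The Clunie-Hayman theorem. Division by [A = 1 + cabs (g 0)] makes the value at 0 small enough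
    for [log_growth], at the cost of replacing [K] by [K * A]. *)
Lemma exponential_type g (K : R) : entire g ->
  (forall w, cabs (cder g w) <= K * (1 + cabs (g w) ^+ 2)) ->
  exists A c, [/\ 1 <= A, 0 <= c & forall z, cabs (g z) <= A * expR (c * cabs z)].
Proof.
move=> eg gK; have K0 : 0 <= K.
  have h : 0 < 1 + cabs (g 0) ^+ 2 by rewrite ltr_pwDl// sqr_ge0.
  by rewrite -(ler_pM2r h) mul0r; exact: le_trans (cabs_ge0 _) (gK 0).
have [A AE] : exists A, A = 1 + cabs (g 0) by eexists.
have A1 : 1 <= A by rewrite AE lerDl cabs_ge0.
have A0 : 0 < A by lra.
pose G w := ofR A^-1 * g w.
have GE w : cabs (G w) = cabs (g w) / A.
  by rewrite /G cabsM cabs_ofR gtr0_norm ?invr_gt0// mulrC.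
have dG w : cderiv G w (ofR A^-1 * cder g w) by apply: cderivZ; exact: entire_cderiv.
have eG : entire G by move=> w; eexists; exact: dG.
exists A, (4 * (K * A)); split=> //; first by rewrite !mulr_ge0// ltW.
move=> z; have [Gz|Gz] := leP (cabs (G z)) 1.
  move: Gz; rewrite GE ler_pdivrMr// mul1r => /le_trans; apply.
  rewrite ler_peMr ?(ltW A0)// -[leLHS]expR0 ler_expR.
  by rewrite mulr_ge0 ?cabs_ge0// !mulr_ge0// ltW.
have := @log_growth G (K * A) eG _ _ z Gz => H.
have {}H : ln (cabs (G z)) <= 4 * (K * A) * cabs z.
  apply: H; last by rewrite GE ler_pdivrMr// mul1r AE; lra.
  move=> w; rewrite (cderE (dG w)) GE cabsM cabs_ofR gtr0_norm ?invr_gt0//.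
  rewrite mulrC ler_pdivrMr//; apply: le_trans (gK w) _.
  have -> : K * A * (1 + (cabs (g w) / A) ^+ 2) * A = K * (A ^+ 2 + cabs (g w) ^+ 2).
    by field; rewrite gt_eqF.
  by rewrite ler_wpM2l// lerD2r expr_ge1// ltW.
have Gp : 0 < cabs (G z) by exact: lt_trans Gz.
move: H; rewrite -ler_expR lnK ?posrE// GE ler_pdivrMr// mulrC.
by [].
Qed.

(** Stands in for Hadamard's factorisation. With [r = cabs z + 1], the function [V], a constant
    minus a logarithm of [h], has positive real part for [cabs w < 3 * r]. Its derivative at [z] is
    bounded through [cRe (V z)], and that by Harnack through [cRe (V 0)], which grows linearly in
    [r]; dividing by [r] removes the dependence on [z]. *)
Lemma log_derivative_bounded h (A c : R) : entire h -> (forall w, h w != 0) ->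
  1 <= A -> 0 <= c -> (forall z, cabs (h z) <= A * expR (c * cabs z)) ->
  exists M, forall z, cabs (cder h z / h z) <= M.
Proof.
move=> eh h0 A1 c0 hA.
pose c1 := `|ln A + 1 - ln (cabs (h 0))| + 3 * c.
(* Here 6 is the factor 2 of [schwarz_halfplane_center] times a Harnack quotient of at most 3
   between [z] and 0, and [c1 * r] bounds [cRe (V 0)]. *)
exists (6 * c1) => z.
have [r rE] : exists r, r = cabs z + 1 by eexists.
have zr : cabs z < r by rewrite rE ltrDl.
have r1 : 1 <= r by rewrite rE lerDr cabs_ge0.
have r0 : 0 < r by lra.
have r30 : 0 < 3 * r by lra.
have [L LP] := log_of_zero_free r30 (entire_holo 0 _ eh) (fun w _ => h0 w).
pose B := ln A + 1 + 3 * c * r.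
pose V w := ofR B - L w.
have dV w : cabs w < 3 * r -> cderiv V w (0 - cder h w / h w).
  move=> wr; apply: cderivB; first exact: cderiv_cst.
  by apply: (LP _ _).1; rewrite subr0.
have V0 w : cabs w < 3 * r -> 0 < cRe (V w).
  move=> wr; rewrite /V ReD ReN Re_ofR (LP _ _).2 ?subr0// subr_gt0.
  have hw : 0 < cabs (h w) by rewrite cabs_gt0.
  apply: (@le_lt_trans _ _ (ln A + c * cabs w)).
    rewrite -(expRK (c * cabs w)) -lnM ?posrE ?expR_gt0//; last lra.
    by rewrite ler_ln ?posrE ?mulr_gt0 ?expR_gt0//; lra.
  have := ler_wpM2l c0 (ltW wr); rewrite /B; lra.
have hV1 : holo_on z r V.
  by move=> w wz; eexists; apply: dV; have := cabs_le w z; lra.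
have hV2 : holo_on z (2 * r) V.
  by move=> w wz; eexists; apply: dV; have := cabs_le w z; lra.
have z3 : cabs z < 3 * r by lra.
have H1 := schwarz_halfplane_center r0 hV1 (fun w wz => V0 w ltac:(have := cabs_le w z; lra)).
have H2 := @harnack_re R V z (2 * r) 0 ltac:(lra) hV2
  (fun w wz => V0 w ltac:(have := cabs_le w z; lra)).
rewrite sub0r cabsN in H2.
have {}H2 := H2 ltac:(lra).
have c00 : 0 < 3 * r by [].
have V00 : cRe (V 0) <= c1 * r.
  rewrite /V ReD ReN Re_ofR (LP _ _).2 ?subr0 ?cabs0// /B /c1 mulrDl.
  have := ler_norm (ln A + 1 - ln (cabs (h 0))).
  have := ler_wpM2r (ltW r0) (ler_norm (ln A + 1 - ln (cabs (h 0)))).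
  have := ler_wpM2l (normr_ge0 (ln A + 1 - ln (cabs (h 0)))) r1.
  lra.
have V0z : 0 < cRe (V 0) by apply: V0; rewrite cabs0.
have Vz := V0 _ z3.
have Vle : cRe (V z) <= 3 * cRe (V 0).
  rewrite -(ler_pM2r r0).
  have h1 : cRe (V z) * r <= cRe (V z) * (2 * r - cabs z).
    by rewrite ler_wpM2l ?(ltW Vz)//; lra.
  have h2 : cRe (V 0) * (2 * r + cabs z) <= cRe (V 0) * (3 * r).
    by rewrite ler_wpM2l ?(ltW V0z)//; lra.
  lra.
rewrite (cderE (dV _ z3)) sub0r cabsN in H1.
by rewrite -(ler_pM2r r0); lra.
Qed.

(** The zero-free function [h = cder g - b] has exponential type by Cauchy's estimate, so its
    logarithmic derivative is bounded and, by Liouville, a constant [c1]. If [c1] is nonzero, then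
    [g] is [b * w] plus an exponential and a constant, against the spherical bound. *)
Lemma affine_of_omitted_derivative g (K : R) (b : C) : entire g -> b != 0 ->
  (forall w, cabs (cder g w) <= K * (1 + cabs (g w) ^+ 2)) ->
  (forall w, cder g w != b) -> forall w, cder g w = cder g 0.
Proof.
move=> eg b0 gK gb.
have K0 : 0 <= K.
  have h : 0 < 1 + cabs (g 0) ^+ 2 by rewrite ltr_pwDl// sqr_ge0.
  by rewrite -(ler_pM2r h) mul0r; exact: le_trans (cabs_ge0 _) (gK 0).
have eg' := entire_cder eg.
have [h hD dh] : exists2 h, forall w, h w = cder g w - b &
    forall w, cderiv h w (cder (cder g) w - 0).
  exists (fun w => cder g w - b) => // w.
  by apply: cderivB; [exact: entire_cderiv|exact: cderiv_cst].
have eh : entire h by move=> w; eexists; exact: dh.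
have h0 w : h w != 0 by rewrite hD subr_eq0.
have [A [c [A1 c0 gA]]] := exponential_type eg gK.
have [q qM] : exists M, forall z, cabs (cder h z / h z) <= M.
  have cb := cabs_ge0 b; have ec : 1 <= expR c by rewrite -[leLHS]expR0 ler_expR.
  have Ae : A * 1 <= A * expR c by rewrite ler_wpM2l//; lra.
  apply: (@log_derivative_bounded h (2 * (A * expR c) + cabs b) c) => //; first lra.
  move=> z; have ez : 1 <= expR (c * cabs z).
    by rewrite -[leLHS]expR0 ler_expR mulr_ge0// cabs_ge0.
  have := @cauchy_estimate R g z _ 1 (A * expR c * expR (c * cabs z)) ltr01
    (entire_holo z 1 eg) _ (entire_cderiv z eg).
  rewrite mulr1 => H.
  have {}H : cabs (cder g z) <= 2 * (A * expR c * expR (c * cabs z)).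
    apply: H => w wz; apply: le_trans (gA w) _; rewrite -mulrA -expRD.
    rewrite ler_wpM2l ?ler_expR//; first lra.
    rewrite -[X in X + _]mulr1 -mulrDr ler_wpM2l//.
    by have := cabs_le w z; lra.
  have := cabsBD (cder g z) b; rewrite -hD.
  have := ler_wpM2l cb ez; lra.
have eq : entire (fun z => cder h z / h z).
  move=> w; eexists; apply: cderivM.
    by apply: entire_cderiv; exact: entire_cder.
  by apply: cderivV; [exact: dh|].
have [c1 qc] : exists c1, forall w, cder h w / h w = c1.
  exists (cder h 0 / h 0) => w.
  exact: (@liouville (fun z => cder h z / h z) q eq qM w).
have h'E w : cder h w = c1 * h w by rewrite -(qc w) divfK.
have [c10|c1n0] := eqVneq c1 0.
  have h'0 x : cder h x = 0 by rewrite h'E c10 mul0r.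
  move=> w.
  have hw := entire_const eh h'0 w.
  rewrite hD in hw.
  rewrite hD in hw.
  exact: (addIr _ hw).
have hE w : h w = h 0 * cexp (c1 * w).
  have E : entire (fun w => h w * cexp (- (c1 * w))).
    move=> x; eexists; apply: cderivM; first exact: dh.
    by apply: cderiv_cexp_comp; apply: cderivN; apply: cderivZ; exact: cderiv_id.
  have E0 x : cder (fun w => h w * cexp (- (c1 * w))) x = 0.
    apply: cderE.
    have := cderivM (entire_cderiv x eh)
      (cderiv_cexp_comp (cderivN (cderivZ c1 (cderiv_id x)))).
    by rewrite h'E (_ : _ + _ = 0)//; ring.
  have H : h w * cexp (- (c1 * w)) = h 0 * cexp (- (c1 * 0)).
    exact: (@entire_const (fun w => h w * cexp (- (c1 * w))) E E0 w).
  move: H; rewrite mulr0 oppr0 cexp0 mulr1 => <-.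
  by rewrite -mulrA -cexpD addNr cexp0 mulr1.
have gE w : g w = b * w + h 0 / c1 * cexp (c1 * w) + (g 0 - h 0 / c1).
  pose G w := g w - (b * w + h 0 / c1 * cexp (c1 * w)).
  have DG x : cderiv G x 0.
    have := cderivB (entire_cderiv x eg) (cderivD (cderivZ b (cderiv_id x))
      (cderivZ (h 0 / c1) (cderiv_cexp_comp (cderivZ c1 (cderiv_id x))))).
    have -> : cder g x = b + h 0 * cexp (c1 * x) by rewrite -hE hD addrC subrK.
    by rewrite mulr1 (_ : _ - _ = 0)//; field.
  have eG : entire G by move=> x; exists 0.
  have : g w - (b * w + h 0 / c1 * cexp (c1 * w)) =
      g 0 - (b * 0 + h 0 / c1 * cexp (c1 * 0)).
    exact: (@entire_const G eG (fun x => cderE (DG x)) w).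
  by rewrite !mulr0 cexp0 mulr1 add0r => <-; ring.
(* One step of [exp (c1 z) |-> - (b z + k) c1 / h 0] from [W n] gives a point where [g] is
   of size [ln n] while [g'] is of size [n]. *)
exfalso.
pose k := g 0 - h 0 / c1.
pose W (n : nat) : C := imagi * ofR (2 * pi * n%:R) / c1.
(* The value of the exponential that cancels [b * W n + k] in [g]. A logarithm [l] of it, shifted by
   the period [W n], gives a point where [g] is just [b / c1 * l]. *)
pose An n := - (b * W n + k) * c1 / h 0.
have hh0 := h0 0.
have key n : 1 <= cabs (An n) ->
   cabs (h 0) * cabs (An n) - cabs b <=
   K * (1 + (cabs (b / c1) * (ln (cabs (An n)) + 4)) ^+ 2).
  move=> An1; have An0 : An n != 0 by rewrite -cabs_gt0; lra.
  have [l lE lle] := cexp_surj An0.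
  rewrite ger0_norm in lle; last by rewrite ln_ge0.
  pose z := W n + l / c1.
  have eE : cexp (c1 * z) = An n.
    have -> : c1 * z = l + imagi * ofR (2 * pi * n%:R) by rewrite /z /W; field.
    by rewrite cexp_periodicn.
  have gz : g z = b / c1 * l.
    by rewrite gE eE /An -/k /z; field; rewrite c1n0 hh0.
  have g'z : cder g z = h 0 * An n + b by rewrite -eE -hE hD subrK.
  have := gK z; rewrite gz g'z => H.
  have h1 := cabs_le (h 0 * An n) (- b); rewrite opprK cabsN [cabs (h 0 * _)]cabsM in h1.
  apply: (@le_trans _ _ (cabs (h 0 * An n + b))); first by lra.
  apply: le_trans H _; rewrite ler_wpM2l// lerD2l cabsM.
  rewrite ler_pXn2r ?nnegrE ?mulr_ge0 ?cabs_ge0//; last first.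
    by rewrite addr_ge0// ln_ge0.
  by rewrite ler_wpM2l ?cabs_ge0.
have large (X : R) : exists n, X <= cabs (An n).
  have hp : 0 < cabs (h 0) by rewrite cabs_gt0.
  have cp : 0 < cabs c1 by rewrite cabs_gt0.
  have bp : 0 < cabs b by rewrite cabs_gt0.
  have pi1 : 1 <= pi :> R by have := @pi_ge2 R; lra.
  have X0 : 0 <= (`|X| * cabs (h 0) / cabs c1 + cabs k) * (cabs c1 / cabs b).
    by rewrite !(mulr_ge0, addr_ge0, invr_ge0, cabs_ge0, normr_ge0).
  have /archi_boundP := X0; set n := Num.bound _ => nX; exists n.
  rewrite /An !cabsM cabsV cabsN ler_pdivlMr// -ler_pdivrMr//.
  have WE : cabs (W n) = 2 * pi * n%:R / cabs c1.
    rewrite /W !cabsM cabsV cabs_i mul1r cabs_ofR ger0_norm//.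
    by rewrite !mulr_ge0//; lra.
  have h1 := cabs_le (b * W n) (- k); rewrite opprK cabsN cabsM WE in h1.
  have h2 : `|X| * cabs (h 0) / cabs c1 + cabs k < n%:R * (cabs b / cabs c1).
    move: nX; rewrite -ltr_pdivlMr ?divr_gt0//.
    by rewrite (_ : (n%:R / _) = n%:R * (cabs b / cabs c1))//; field; rewrite !gt_eqF.
  have h3 : n%:R * (cabs b / cabs c1) <= cabs b * (2 * pi * n%:R / cabs c1).
    have -> : cabs b * (2 * pi * n%:R / cabs c1) =
       (2 * pi) * (n%:R * (cabs b / cabs c1)) by ring.
    by apply: ler_peMl; [rewrite mulr_ge0// divr_ge0 ?cabs_ge0|lra].
  have h4 : X * cabs (h 0) / cabs c1 <= `|X| * cabs (h 0) / cabs c1.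
    by rewrite !ler_wpM2r ?invr_ge0 ?cabs_ge0// ler_norm.
  lra.
have hp : 0 < cabs (h 0) by rewrite cabs_gt0.
pose m := K * (16 * cabs (b / c1) ^+ 2).
have m0 : 0 <= m by apply: mulr_ge0 => //; apply: mulr_ge0 => //; exact: sqr_ge0.
pose q1 := K + cabs b + 1.
have q10 : 0 < q1 by rewrite /q1; have := cabs_ge0 b; lra.
(* Once [u >= Y] and [u >= 1], the quartic [cabs (h 0) * u ^+ 4] is at least [(q1 + m) * u ^+ 2],
   which exceeds [K + cabs b + m * u ^+ 2]. *)
pose Y := (q1 + m) / cabs (h 0).
have Y0 : 0 <= Y by rewrite divr_ge0 ?cabs_ge0//; lra.
have [n nX] := large (expR (4 * Y)).
set a := cabs (An n) in nX.
have a1 : 1 <= a by apply: le_trans nX; rewrite -[leLHS]expR0 ler_expR; lra.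
have := key n a1; rewrite -/a.
(* From [1 + x <= expR x] with [x = ln a / 4] follows [u ^+ 4 <= a], so the squared logarithm in
   [key], a multiple of [u ^+ 2], loses against [a]. *)
pose u := 1 + ln a / 4.
have lna : 4 * Y <= ln a.
  by rewrite -(expRK (4 * Y)) ler_ln ?posrE ?expR_gt0//; lra.
have u1 : 1 <= u by rewrite /u; lra.
have uY : Y <= u by rewrite /u; lra.
have -> : ln a + 4 = 4 * u by rewrite /u; field.
have au : u ^+ 4 <= a.
  have -> : a = expR (ln a / 4) ^+ 4.
    by rewrite -expRM_natl -mulr_natl mulrC divfK// lnK// posrE; lra.
  rewrite ler_pXn2r ?nnegrE ?expR_ge0//; first by exact: expR_ge1Dx.
  by lra.
have -> : K * (1 + (cabs (b / c1) * (4 * u)) ^+ 2) = K + m * u ^+ 2.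
  by rewrite /m; ring.
have u2 : 1 <= u ^+ 2 by rewrite expr_ge1//; lra.
have u22 : u <= u ^+ 2 by rewrite expr2 ler_peMl//; lra.
have h1 := ler_wpM2l (ltW hp) au.
have h2 : cabs (h 0) * Y = q1 + m by rewrite /Y mulrC divfK// gt_eqF.
have h3 : (q1 + m) * u ^+ 2 <= cabs (h 0) * u ^+ 4.
  rewrite -h2 (_ : 4 = 2 + 2)%N// exprD mulrA ler_wpM2r ?sqr_ge0//.
  by rewrite ler_wpM2l ?cabs_ge0//; lra.
have h4 : q1 * 1 <= q1 * u ^+ 2 by rewrite ler_wpM2l ?(ltW q10).
by move: h3; rewrite /q1 in h4 *; rewrite mulrDl; lra.
Qed.

End EntireFunctions.

(** * Marty's condition and limits of families that satisfy it *)

Section NormalLimits.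
Context {R : realType}.
Local Notation C := (Cplx R).
Implicit Types (f g h : C -> C).

Definition marty_on (z : C) (r K : R) f := holo_on z r f /\
  forall w, cabs (w - z) < r -> cabs (cder f w) <= K * (1 + cabs (f w) ^+ 2).

(** The squared chordal distance from [x] to infinity. *)
Definition invsq1 (x : C) : R := (1 + cabs x ^+ 2)^-1.

Lemma invsq1_den (x : C) : 0 < 1 + cabs x ^+ 2.
Proof. by rewrite ltr_pwDl// sqr_ge0. Qed.

(** Along a segment the derivative of [invsq1 f] is at most [2 |f| |f'| / (1 + |f|^2)^2] per unit
    length, and [2 |f| <= 1 + |f|^2] leaves the spherical derivative. *)
Lemma invsq1_lipschitz f z (r K : R) w1 w2 : marty_on z r K f ->
  cabs (w1 - z) < r -> cabs (w2 - z) < r ->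
  `|invsq1 (f w2) - invsq1 (f w1)| <= K * cabs (w2 - w1).
Proof.
move=> [hf fK] h1 h2; pose q := w2 - w1.
pose u t := cRe (1 * f (w1 + ofR t * q)).
pose v t := cRe (- imagi * f (w1 + ofR t * q)).
pose d t := cder f (w1 + ofR t * q).
have inD (t : R) : 0 <= t <= 1 -> cabs (w1 + ofR t * q - z) < r.
  by move=> t01; exact: disc_convex.
have Du (t : R) : 0 <= t <= 1 -> is_derive t 1 u (cRe (1 * d t * q)).
  by move=> t01; apply: is_derive_path; exact: (holo_cderiv hf (inD _ t01)).
have Dv (t : R) : 0 <= t <= 1 -> is_derive t 1 v (cRe (- imagi * d t * q)).
  by move=> t01; apply: is_derive_path; exact: (holo_cderiv hf (inD _ t01)).
have uvE t : u t * u t + v t * v t = cabs (f (w1 + ofR t * q)) ^+ 2.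
  rewrite /u /v sqr_cabs !ReM -[1]ofR1 Re_ofR Im_ofR ReN ImN Re_i Im_i.
  by ring.
pose k t := (1 + (u t * u t + v t * v t))^-1.
pose dk t := - (1 + (u t * u t + v t * v t)) ^- 2 *
  (2 * (u t * cRe (1 * d t * q) + v t * cRe (- imagi * d t * q))).
have Dk (t : R) : 0 <= t <= 1 -> is_derive t 1 k (dk t).
  move=> t01; have du := Du _ t01; have dv := Dv _ t01.
  have D1 : is_derive t 1 ((cst 1 : R -> R) + (u * u + v * v))
     (0 + ((u t *: cRe (1 * d t * q) + u t *: cRe (1 * d t * q)) +
      (v t *: cRe (- imagi * d t * q) + v t *: cRe (- imagi * d t * q)))).
    apply: is_deriveD; apply: is_deriveD.
  have nz : ((cst 1 : R -> R) + (u * u + v * v)) t != 0.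
    rewrite -[X in X != 0]/(1 + (u t * u t + v t * v t)) uvE.
    by rewrite gt_eqF// invsq1_den.
  have := is_deriveV nz D1.
  set a := (X in is_derive _ _ _ X -> _); suff -> : a = dk t by [].
  by rewrite /a /dk /GRing.scale /=; ring.
have [t t01 E] := path_MVT Dk.
have kE t' : k t' = invsq1 (f (w1 + ofR t' * q)) by rewrite /k uvE.
rewrite !kE ofR0 ofR1 mul0r mul1r addr0 in E.
have e : w1 + q = w2 by rewrite /q addrC subrK.
rewrite e in E; rewrite E /dk uvE.
have n0 := invsq1_den (f (w1 + ofR t * q)).
rewrite mulNr normrN normrM ger0_norm; last by rewrite invr_ge0 sqr_ge0.
rewrite mulrC ler_pdivrMr ?exprn_gt0// normrM (ger0_norm (ler0n _ 2)).
have -> : u t * cRe (1 * d t * q) + v t * cRe (- imagi * d t * q) =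
   cRe (cconj (f (w1 + ofR t * q)) * (d t * q)).
  rewrite /u /v !(ReM, ImM) Re_conj Im_conj -[1]ofR1 Re_ofR Im_ofR !(ReN, ImN) Re_i Im_i.
  by ring.
have H := Re_le_cabs (cconj (f (w1 + ofR t * q)) * (d t * q)).
rewrite !cabsM cabs_conj in H.
have {fK}H' := fK _ (inD _ t01); rewrite -/(d t) in H'.
rewrite -/q; set x := cabs (f _) in n0 H H' *.
have x0 : 0 <= x by exact: cabs_ge0.
have q0 := cabs_ge0 q.
have h3 : x * (cabs (d t) * cabs q) <= x * (K * (1 + x ^+ 2) * cabs q).
  by rewrite ler_wpM2l// ler_wpM2r.
have Kq : 0 <= K * (1 + x ^+ 2) by exact: le_trans (cabs_ge0 _) H'.
have h4 : 2 * x * (K * (1 + x ^+ 2) * cabs q) <= (1 + x ^+ 2) * (K * (1 + x ^+ 2) * cabs q).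
  apply: ler_wpM2r; first exact: mulr_ge0.
  by have := sqr_ge0 (x - 1); rewrite sqrrB1 mulr2n; lra.
have -> : K * cabs q * (1 + x ^+ 2) ^+ 2 = (1 + x ^+ 2) * (K * (1 + x ^+ 2) * cabs q).
  by ring.
move: H h3 h4; set y := `|_|; set a1 := x * (cabs _ * _); lra.
Qed.

(** On the half disc the Harnack quotient is at most 3, so [ln |f|] loses at most a factor 3, whence
    the cube. *)
Lemma harnack_large f z (r M : R) : 0 < r -> holo_on z r f ->
  (forall w, cabs (w - z) < r -> 1 < cabs (f w)) -> 1 <= M ->
  M ^+ 3 <= cabs (f z) -> forall w, cabs (w - z) < r / 2 -> M <= cabs (f w).
Proof.
move=> r0 hf f1 M1 Mz w wr.
have wr' : cabs (w - z) < r by lra.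
have M0 : 0 < M by lra.
have H := harnack_ln r0 hf f1 wr'.
have zr : cabs (z - z) < r by rewrite subrr cabs0.
have lnz : 3 * ln M <= ln (cabs (f z)).
  rewrite mulr_natl -lnXn//; rewrite ler_ln ?posrE ?exprn_gt0//.
  by apply: lt_trans (f1 _ zr).
have lM : 0 <= ln M by rewrite ln_ge0.
have lw : 0 < ln (cabs (f w)) by rewrite ln_gt0// f1.
rewrite -ler_ln ?posrE//; last by apply: lt_trans (f1 _ wr').
rewrite -(ler_pM2r r0).
have h1 : 3 * ln M * (r / 2) <= ln (cabs (f z)) * (r - cabs (w - z)).
  by apply: ler_pM => //; lra.
have h2 : ln (cabs (f w)) * (r + cabs (w - z)) <= ln (cabs (f w)) * (3 / 2 * r).
  by rewrite ler_wpM2l ?(ltW lw)//; lra.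
lra.
Qed.

Context {T : Type} {U : set_system T} {UU : UltraFilter U}.

(** A constant over the zero-free [F n] is holomorphic of modulus above 1 and huge at [z];
    [harnack_large] makes it huge on the half disc, so the limit of the [F n] vanishes there. *)
Lemma hurwitz (F : T -> C -> C) f z (r : R) : 0 < r ->
  (exists L, forall w, cabs (w - z) < r -> cabs (f w) <= L) ->
  (forall e : R, 0 < e -> \forall n \near U, holo_on z r (F n) /\
    forall w, cabs (w - z) < r -> cabs (F n w - f w) <= e) ->
  (\forall n \near U, forall w, cabs (w - z) < r -> F n w != 0) ->
  f z = 0 -> forall w, cabs (w - z) < r / 2 -> f w = 0.
Proof.
move=> r0 [L LP] cvF F0 fz w wr.
have zr : cabs (z - z) < r by rewrite subrr cabs0.
have L0 : 0 <= L by exact: le_trans (cabs_ge0 _) (LP z zr).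
apply/eqP; rewrite -cabs_eq0 eq_le cabs_ge0 andbT; apply/ler_addgt0Pl => e e0.
rewrite addr0 leNgt; apply/negP => fw.
(* Eventually [cabs (F n x) <= L + 1], so [B / F n] has modulus above 1. *)
pose B := L + 2; have B0 : 0 < B by rewrite /B; lra.
have fwL : cabs (f w) <= L by apply: LP; lra.
have eB : e / 2 < B by rewrite /B; lra.
have e2 : 0 < e / 2 by lra.
pose M := B / (e / 2).
have M1 : 1 <= M by rewrite ler_pdivlMr// mul1r ltW.
have M30 : 0 < B / M ^+ 3 by rewrite divr_gt0// exprn_gt0//; lra.
have [n [[[H1 H2] H3] H4]] := filter_ex (filterI (filterI (cvF _ ltr01) (cvF _ M30))
   (filterI F0 (cvF _ e2))).
case: H4 => H4 H5; have hF := H1.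
pose p x := ofR B * (F n x)^-1.
have pE x : cabs (p x) = B / cabs (F n x) by rewrite cabsM cabsV cabs_ofR gtr0_norm.
have hp : holo_on z r p.
  move=> x xr; eexists; apply: cderivZ; apply: cderivV; last exact: H4.
  exact: (holo_cderiv hF xr).
have Fp x : cabs (x - z) < r -> 0 < cabs (F n x) by move=> xr; rewrite cabs_gt0 H4.
have p1 x : cabs (x - z) < r -> 1 < cabs (p x).
  move=> xr; rewrite pE ltr_pdivlMr ?Fp// mul1r.
  have := H2 _ xr; have := LP _ xr; have := cabs_le (F n x) (f x); rewrite /B; lra.
have pz : M ^+ 3 <= cabs (p z).
  rewrite pE ler_pdivlMr ?Fp// mulrC -ler_pdivlMr ?exprn_gt0//; last lra.
  by have := H3.2 _ zr; rewrite fz subr0.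
have := harnack_large r0 hp p1 M1 pz wr.
have wr' : cabs (w - z) < r by lra.
rewrite pE ler_pdivlMr ?Fp// /M mulrAC ler_pdivrMr// ler_pM2l// => h.
by have := H5.2 _ wr'; have := cabs_le (f w) (F n w); rewrite (cabsB (f w)); lra.
Qed.

Context (F : T -> C -> C).

Definition locally_bounded_at z := exists2 r : R, 0 < r & exists M,
  \forall n \near U, forall w, cabs (w - z) < r -> cabs (F n w) <= M.

Definition locally_infinite_at z := exists2 r : R, 0 < r & forall M,
  \forall n \near U, forall w, cabs (w - z) < r -> M <= cabs (F n w).

(** Along [U], [invsq1 (F n z)] either stays above some [e] or tends to 0. The Lipschitz bound
    spreads the first case to a disc of boundedness. In the second it only gives modulus above 1 on
    a disc, which [harnack_large] improves to divergence. *)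
Lemma marty_dichotomy z (r K : R) : 0 < r ->
  (\forall n \near U, marty_on z r K (F n)) ->
  locally_bounded_at z \/ locally_infinite_at z.
Proof.
move=> r0 mF; have zr : cabs (z - z) < r by rewrite subrr cabs0.
pose K' := `|K| + 1; have K'0 : 0 < K' by rewrite ltr_wpDl.
have KK' : K <= K' by have := ler_norm K; rewrite /K'; lra.
have sub w1 w2 : K * cabs (w2 - w1) <= K' * cabs (w2 - w1).
  by rewrite ler_wpM2r ?cabs_ge0.
have [[e e0 H]|H] := pselect (exists2 e : R, 0 < e & \forall n \near U, e <= invsq1 (F n z)).
  left; pose s := Num.min r (e / (2 * K')).
  have e20 : 0 < e / (2 * K') by rewrite divr_gt0// mulr_gt0.
  exists s; first by rewrite lt_min r0 e20.
  exists (1 + 2 / e); move: mF H; apply: filterS2 => n mFn Hn w.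
  rewrite lt_min => /andP[wr we].
  have := invsq1_lipschitz mFn wr zr; have := sub w z.
  rewrite (cabsB z) => h1 h2.
  have h3 : K' * cabs (w - z) < e / 2.
    by move: we; rewrite ltr_pdivlMr ?mulr_gt0//; lra.
  have := ler_norm (invsq1 (F n z) - invsq1 (F n w)) => h4.
  have : e / 2 <= invsq1 (F n w) by lra.
  rewrite /invsq1 -[e / 2]invrK invf_ple ?posrE ?invr_gt0 ?invsq1_den//; last by lra.
  rewrite invf_div => h5.
  have h6 := sqr_ge0 (cabs (F n w)).
  by have := sqr_ge0 (cabs (F n w) - 1); rewrite sqrrB1 mulr2n; lra.
(* On this disc [invsq1] changes by less than 1/8; starting below 1/4 it stays below 1/2, which
   means modulus above 1. *)
right; pose s := Num.min r (8 * K')^-1.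
have s1 : 0 < (8 * K')^-1 by rewrite invr_gt0 mulr_gt0.
have s0 : 0 < s by rewrite lt_min r0 s1.
have small (e : R) : 0 < e -> \forall n \near U, invsq1 (F n z) < e.
  move=> e0; have [h|h] := ultra_dec (fun n => invsq1 (F n z) < e) => //.
  exfalso; apply: H; exists e => //; apply: filterS h => n /negP.
  by rewrite -leNgt.
exists (s / 2); first by rewrite divr_gt0.
move=> M0; pose M := `|M0| + 1.
have M1 : 1 <= M by rewrite lerDr.
have M0M : M0 <= M by have := ler_norm M0; rewrite /M; lra.
have e40 : 0 < 1 / 4 :> R by rewrite divr_gt0.
have M30 : 0 < M ^+ 3 by rewrite exprn_gt0//; lra.
have e60 : 0 < (1 + (M ^+ 3) ^+ 2)^-1 by rewrite invr_gt0 ltr_pwDl// sqr_ge0.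
have H1 := small _ e40; have H2 := small _ e60.
move: mF H1 H2; apply: filterS3 => n mFn h1 h2 w wr.
apply: (le_trans M0M).
apply: (@harnack_large (F n) z s M) => //.
- by apply: holo_sub mFn.1; rewrite subrr cabs0 add0r ge_min lexx.
- move=> x; rewrite lt_min => /andP[xr xs].
  have := invsq1_lipschitz mFn zr xr; have := sub z x => h3 h4.
  have h5 : K' * cabs (x - z) < 1 / 8.
    by move: xs; rewrite -[_^-1]mul1r ltr_pdivlMr ?mulr_gt0//; lra.
  have := ler_norm (invsq1 (F n x) - invsq1 (F n z)) => h6.
  have : invsq1 (F n x) < 2^-1 by lra.
  rewrite /invsq1 ltf_pV2 ?posrE ?invsq1_den// => h7.
  by rewrite -(@ltr_pXn2r _ 2) ?nnegrE ?cabs_ge0// expr1n; lra.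
- move: h2; rewrite /invsq1 ltf_pV2 ?posrE ?invsq1_den//; last by rewrite ltr_pwDl// sqr_ge0.
  rewrite ltrD2l ltr_pXn2r ?nnegrE ?cabs_ge0 ?(ltW M30)//.
  exact: ltW.
Qed.

Lemma open_cabs (A : set C) :
  (forall z, A z -> exists2 r : R, 0 < r & forall w, cabs (w - z) < r -> A w) ->
  open A.
Proof.
move=> H; rewrite openE => z /H[r r0 zA].
by apply/nbhs_cabs; exists r.
Qed.

Lemma open_locally_bounded : open [set z | locally_bounded_at z].
Proof.
apply: open_cabs => z [r r0 [M H]]; exists (r / 2); first by rewrite divr_gt0.
move=> w wr; exists (r / 2); first by rewrite divr_gt0.
exists M; apply: filterS H => n H x xw; apply: H.
by have := cabs_tri x w z; lra.
Qed.

Lemma open_locally_infinite : open [set z | locally_infinite_at z].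
Proof.
apply: open_cabs => z [r r0 H]; exists (r / 2); first by rewrite divr_gt0.
move=> w wr; exists (r / 2); first by rewrite divr_gt0.
move=> M; apply: filterS (H M) => n {}H x xw; apply: H.
by have := cabs_tri x w z; lra.
Qed.

(** The two alternatives of [marty_dichotomy] hold on disjoint open sets that cover [D]. *)
Lemma marty_connected (D : set C) : connected D ->
  (forall z, D z -> exists2 r : R, 0 < r & exists K,
     \forall n \near U, marty_on z r K (F n)) ->
  (forall z, D z -> locally_bounded_at z) \/
  (forall z, D z -> locally_infinite_at z).
Proof.
move=> cD mF.
have dich z : D z -> locally_bounded_at z \/ locally_infinite_at z.
  by move=> /mF[r r0 [K]]; exact: marty_dichotomy.
have disj z : locally_bounded_at z -> locally_infinite_at z -> False.
  move=> [r r0 [M H1]] [r' r'0 /(_ (M + 1)) H2].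
  have [n [h1 h2]] := filter_ex (filterI H1 H2).
  have := h1 z; have := h2 z; rewrite subrr cabs0 => /(_ r'0) + /(_ r0).
  by lra.
have [[z0 [Dz0 z0b]]|N] := pselect (exists z0, D z0 /\ locally_bounded_at z0); last first.
  right=> z Dz; have [h|//] := dich _ Dz.
  by exfalso; apply: N; exists z.
left=> z Dz.
suff E : D `&` [set z | locally_bounded_at z] = D.
  by move: Dz; rewrite -E => -[].
apply: cD.
- by exists z0.
- by exists [set z | locally_bounded_at z] => //; exact: open_locally_bounded.
- exists (~` [set z | locally_infinite_at z]).
    by rewrite closedC; exact: open_locally_infinite.
  apply/seteqP; split => x /= [Dx h]; split=> //.
    by move=> h'; exact: (disj _ h h').
  by have [|/h] := dich _ Dx.
Qed.

(** If uniform convergence failed, points where it fails would converge along [U] to some [l];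
    pointwise convergence at [l] and the common Lipschitz constant contradict this. *)
Lemma uniform_limit f z (r Lp : R) : 0 < r -> 0 <= Lp ->
  (\forall n \near U, forall w1 w2, cabs (w1 - z) < r -> cabs (w2 - z) < r ->
     cabs (F n w1 - F n w2) <= Lp * cabs (w1 - w2)) ->
  (forall w, cabs (w - z) < r ->
     forall e : R, 0 < e -> \forall n \near U, cabs (F n w - f w) < e) ->
  forall e : R, 0 < e -> \forall n \near U,
    forall w, cabs (w - z) < r / 2 -> cabs (F n w - f w) <= e.
Proof.
move=> r0 Lp0 lF cvF e e0.
have [//|H] := ultra_dec (fun n => forall w, cabs (w - z) < r / 2 ->
  cabs (F n w - f w) <= e).
exfalso.
have ch n : exists w, (~ forall w, cabs (w - z) < r / 2 -> cabs (F n w - f w) <= e) ->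
    cabs (w - z) < r / 2 /\ e < cabs (F n w - f w).
  have [h|h] := pselect (forall w, cabs (w - z) < r / 2 -> cabs (F n w - f w) <= e).
    by exists 0.
  move/existsNP: (h) => [w /not_implyP[h1 /negP]]; rewrite -ltNge => h2.
  by exists w.
have [w wP] := choice ch.
have {}H : \forall n \near U, cabs (w n - z) < r / 2 /\ e < cabs (F n (w n) - f (w n)).
  by apply: filterS H => n; exact: wP.
have [|l lP] := @ultra_lim R T U UU w (r / 2 + cabs z).
  by apply: filterS H => n [h _]; have := cabs_le (w n) z; lra.
have lr : cabs (l - z) <= r / 2.
  by apply: ultra_lim_le lP _; apply: filterS H => n [h _]; exact: ltW.
have lr' : cabs (l - z) < r by lra.
have lf w1 w2 : cabs (w1 - z) < r -> cabs (w2 - z) < r ->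
     cabs (f w1 - f w2) <= Lp * cabs (w1 - w2).
  move=> h1 h2; apply/ler_addgt0Pl => e' e'0; have e'2 : 0 < e' / 2 by lra.
  have [n [[n1 n2] n3]] := filter_ex (filterI (filterI (cvF _ h1 _ e'2) (cvF _ h2 _ e'2)) lF).
  have := n3 _ _ h1 h2.
  have -> : f w1 - f w2 = (F n w1 - F n w2) - (F n w1 - f w1) + (F n w2 - f w2) by ring.
  have := cabsD (F n w1 - F n w2 - (F n w1 - f w1)) (F n w2 - f w2).
  have := cabsBD (F n w1 - F n w2) (F n w1 - f w1).
  by lra.
have e4 : 0 < e / 4 by lra.
have d0 : 0 < e / (4 * (Lp + 1)) by rewrite divr_gt0//; lra.
have [n [[n1 [n2 n3]] [n4 n5]]] := filter_ex (filterI (filterI (lP _ d0) H)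
  (filterI (cvF _ lr' _ e4) lF)).
have wr : cabs (w n - z) < r by lra.
have h1 := n5 _ _ wr lr'; have h2 := lf _ _ wr lr'.
have h3 : Lp * cabs (w n - l) <= e / 4.
  move: n1; rewrite ltr_pdivlMr; last lra.
  by have := cabs_ge0 (w n - l); lra.
have E : F n (w n) - f (w n) = (F n (w n) - F n l) + (F n l - f l) - (f (w n) - f l).
  by ring.
rewrite E in n3.
have := cabsBD ((F n (w n) - F n l) + (F n l - f l)) (f (w n) - f l).
have := cabsD (F n (w n) - F n l) (F n l - f l).
by lra.
Qed.

(** Under local boundedness Marty's condition bounds the derivatives, so the family is
    equi-Lipschitz and the pointwise limit along [U] is locally uniform. *)
Lemma marty_limit (D : set C) :
  (forall z, D z -> exists2 r : R, 0 < r & exists K,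
     \forall n \near U, marty_on z r K (F n)) ->
  (forall z, D z -> locally_bounded_at z) ->
  exists f, forall z, D z -> exists2 r : R, 0 < r &
    forall e : R, 0 < e -> \forall n \near U, holo_on z r (F n) /\
      forall w, cabs (w - z) < r -> cabs (F n w - f w) <= e.
Proof.
move=> mF bF.
have lim w : exists l, locally_bounded_at w ->
    forall e : R, 0 < e -> \forall n \near U, cabs (F n w - l) < e.
  have [[r r0 [M H]]|] := pselect (locally_bounded_at w); last by exists 0.
  have [|l lP] := @ultra_lim R T U UU (fun n => F n w) M.
    by apply: filterS H => n; apply; rewrite subrr cabs0.
  by exists l.
have [f fP] := choice lim; exists f => z Dz.
have [r1 r10 [K mFz]] := mF _ Dz; have [r2 r20 [M bFz]] := bF _ Dz.
pose r := Num.min r1 r2.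
have r0 : 0 < r by rewrite lt_min r10.
exists (r / 2); first by rewrite divr_gt0.
have Lp0 : 0 <= `|K| * (1 + M ^+ 2).
  by rewrite mulr_ge0// addr_ge0// sqr_ge0.
have lF : \forall n \near U, forall w1 w2, cabs (w1 - z) < r -> cabs (w2 - z) < r ->
     cabs (F n w1 - F n w2) <= `|K| * (1 + M ^+ 2) * cabs (w1 - w2).
  move: mFz bFz; apply: filterS2 => n [hF dF] bFn w1 w2 h1 h2.
  apply: (@mean_value_disc R (F n) (cder (F n)) z w2 w1 r) => // x.
    rewrite lt_min => /andP[xr _]; exact: (holo_cderiv hF xr).
  rewrite lt_min => /andP[/dF xr /bFn xb]; apply: (le_trans xr).
  apply: (@le_trans _ _ (`|K| * (1 + cabs (F n x) ^+ 2))).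
    by rewrite ler_wpM2r ?ler_norm// ltW// invsq1_den.
  rewrite ler_wpM2l// lerD2l ler_pXn2r ?nnegrE ?cabs_ge0//.
  exact: le_trans (cabs_ge0 _) xb.
have cv w : cabs (w - z) < r ->
    forall e : R, 0 < e -> \forall n \near U, cabs (F n w - f w) < e.
  move=> wr; apply: fP; exists (r - cabs (w - z)); first by rewrite subr_gt0.
  exists M; apply: filterS bFz => n H x xw; apply: H.
  have : r <= r2 by rewrite ge_min lexx orbT.
  by have := cabs_tri x w z; lra.
move=> e e0; move: mFz (uniform_limit r0 Lp0 lF cv e0); apply: filterS2 => n [hF _] H.
split=> //; apply: holo_sub hF; rewrite subrr cabs0 add0r.
by have : r <= r1 by [rewrite ge_min lexx]; lra.
Qed.

End NormalLimits.

(** * Compactness and connectedness in the plane *)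

Section PlaneTopology.
Context {R : realType}.
Local Notation C := (Cplx R).

Lemma continuous_cabs (g : C -> C) z : cont_at g z ->
  {for z, continuous (fun w => cabs (g w))}.
Proof.
move=> /cont_cabsP cg A /nbhs_ballP[e /cg[d d0 dH] eA].
apply/nbhs_cabs; exists d => // w /dH h; apply: eA; rewrite /ball /=.
apply: le_lt_trans h; rewrite ler_norml.
have := cabs_le (g z) (g w); have := cabs_le (g w) (g z).
by rewrite (cabsB (g z) (g w)) => *; apply/andP; split; lra.
Qed.

(** The ultrafilter criterion for compactness: an ultrafilter on a bounded set converges by
    [ultra_lim] applied to the identity. *)
Lemma compact_in_disc (K : set C) z (r : R) :
  (forall w, K w -> cabs (w - z) <= r) -> closed K -> compact K.
Proof.
move=> Kr cK; rewrite compact_ultra => F FU FK.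
have [|l lP] := @ultra_lim R C F FU id (r + cabs z).
  by apply: filterS FK => w /Kr; have := cabs_le w z; lra.
have Fl : F --> l.
  by move=> A /nbhs_cabs[e e0 eA]; apply: filterS (lP _ e0) => w; exact: eA.
exists l; split=> //; apply: cK => B /Fl FB.
by have [w [Kw Bw]] := filter_ex (filterI FK FB); exists w.
Qed.

Lemma connected_plane : connected [set: C].
Proof.
move=> B [z Bz] [V opV BV] [Q cQ BQ]; apply/seteqP; split=> // w _.
pose phi (t : R) := z + ofR t * (w - z).
have cphi : continuous phi.
  move=> t A /nbhs_cabs[e e0 eA].
  have d0 : 0 < e / (cabs (w - z) + 1) by rewrite divr_gt0// ltr_wpDl// cabs_ge0.
  apply/nbhs_ballP; exists (e / (cabs (w - z) + 1)) => // s; rewrite /ball /= => st.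
  apply: eA; have -> : phi s - phi t = ofR (s - t) * (w - z).
    by rewrite /phi ofRD ofRN; ring.
  rewrite cabsM cabs_ofR distrC.
  move: st; rewrite ltr_pdivlMr; last by rewrite ltr_wpDl// cabs_ge0.
  by have := normr_ge0 (t - s); lra.
have cP : connected (phi @` `[0, 1]).
  apply: connected_continuous_connected; first exact: segment_connected.
  exact: continuous_subspaceT.
have P0 : (phi @` `[0, 1]) z.
  by exists 0; [rewrite /= in_itv /= lexx ler01|rewrite /phi ofR0 mul0r addr0].
have P1 : (phi @` `[0, 1]) w.
  exists 1; first by rewrite /= in_itv /= lexx ler01.
  by rewrite /phi ofR1 mul1r addrC subrK.
suff E : phi @` `[0, 1] `&` B = phi @` `[0, 1] by move: P1; rewrite -E => -[].
rewrite setTI in BV; rewrite setTI in BQ.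
apply: cP; first by exists z.
  by exists V => //; rewrite BV.
by exists Q => //; rewrite BQ.
Qed.

Lemma rational_near (x e : R) : 0 < e -> exists q : rat, `|ratr q - x| < e.
Proof.
move=> e0; have [|q] := @rat_in_itvoo R (x - e) (x + e); first lra.
by rewrite in_itv /= => /andP[h1 h2]; exists q; rewrite ltr_norml; lra.
Qed.

End PlaneTopology.

(** * From ultrafilter limits to subsequences *)

Section SubsequenceExtraction.
Context {R : realType}.
Local Notation C := (Cplx R).
Context (P : nat -> R -> C -> R -> Prop).
Hypothesis Pmono : forall n (e e' : R) z r z' r',
  e <= e' -> cabs (z' - z) + r' <= r -> P n e z r -> P n e' z' r'.
Context (U : set_system nat) {UU : UltraFilter U}.
Hypothesis sU : \oo `<=` U.

(* Discs with rational centre and radius [1/k], coded by integers, form a countable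
   family in which every point has arbitrarily small neighbourhoods. *)
Let code (m : nat) : rat * rat * nat := odflt (0, 0, 0%N) (unpickle m).
Let ctr m : C := ofR (ratr (code m).1.1) + imagi * ofR (ratr (code m).1.2).
Let rad m : R := (code m).2.+1%:R^-1.

Let code_dense (z : C) (r : R) : 0 < r -> exists m, cabs (ctr m - z) < rad m / 2 /\ rad m < r.
Proof.
move=> r0; have [N NH] := harmonic_small r0.
pose d : R := N.+1%:R^-1; have d0 : 0 < d / 4 by rewrite divr_gt0// invr_gt0.
have [p pP] := rational_near (cRe z) d0; have [q qP] := rational_near (cIm z) d0.
exists (pickle (p, q, N)); rewrite /ctr /rad /code pickleK /=; split; last exact: NH.
apply: le_lt_trans (cabs_le_ReIm _) _.
rewrite !(ReD, ImD, ReM, ImM, ReN, ImN, Re_ofR, Im_ofR, Re_i, Im_i).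
rewrite !(mul0r, mul1r, mulr0, subr0, addr0, add0r) -/d.
by lra.
Qed.

(** An ultrafilter does not itself provide a sequence of indices. As countably many discs suffice, a
    diagonal choice works: the index chosen at stage [j] meets precision [1 / (j + 1)] on those
    discs of code at most [j] where [P] holds along [U] for every precision. *)
Lemma extract_subsequence (D : set C) :
  (forall z, D z -> exists2 r : R, 0 < r &
     forall e, 0 < e -> \forall n \near U, P n e z r) ->
  exists2 phi : nat -> nat, {homo phi : m n / (m < n)%N} &
    forall z, D z -> exists2 r : R, 0 < r &
      forall e, 0 < e -> \forall n \near \oo, P (phi n) e z r.
Proof.
move=> H; pose A m := forall e : R, 0 < e -> \forall n \near U, P n e (ctr m) (rad m).
have step (j N : nat) : exists n, (N < n)%N /\
    forall m, (m <= j)%N -> A m -> P n j.+1%:R^-1 (ctr m) (rad m).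
  have E J : \forall n \near U,
      forall m, (m <= J)%N -> A m -> P n j.+1%:R^-1 (ctr m) (rad m).
    have j0 : 0 < j.+1%:R^-1 :> R by rewrite invr_gt0.
    have single m : \forall n \near U, A m -> P n j.+1%:R^-1 (ctr m) (rad m).
      have [h|h] := pselect (A m); last by apply: filterE => n /h.
      by apply: filterS (h _ j0).
    elim: J => [|J IH].
      by apply: filterS (single 0%N) => n Hn m; rewrite leqn0 => /eqP ->.
    move: IH (single J.+1); apply: filterS2 => n h1 h2 m.
    by rewrite leq_eqVlt => /predU1P[->|]; [exact: h2|exact: h1].
  have sN : \forall n \near U, (N < n)%N by apply: sU; exists N.+1.
  by have [n [n1 n2]] := filter_ex (filterI (E j) sN); exists n.
have [next nextP] : exists next : nat -> nat -> nat, forall j N, (N < next j N)%N /\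
    forall m, (m <= j)%N -> A m -> P (next j N) j.+1%:R^-1 (ctr m) (rad m).
  have /choice[nx nxP] : forall jN : nat * nat, exists n, (jN.2 < n)%N /\
    forall m, (m <= jN.1)%N -> A m -> P n jN.1.+1%:R^-1 (ctr m) (rad m).
    by move=> [j N]; exact: step.
  by exists (fun j N => nx (j, N)) => j N; exact: (nxP (j, N)).
pose phi := fix phi j := if j is j'.+1 then next j (phi j') else next 0%N 0%N.
have phiP j m : (m <= j)%N -> A m -> P (phi j) j.+1%:R^-1 (ctr m) (rad m).
  by case: j => [|j]; exact: (nextP _ _).2.
exists phi.
  apply: homo_ltn; first exact: ltn_trans.
  by move=> j; exact: (nextP j.+1 (phi j)).1.
move=> z Dz; have [r r0 rH] := H _ Dz.
have [|m [m1 m2]] := @code_dense z (r / 2); first by rewrite divr_gt0.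
have rm0 : 0 < rad m by rewrite invr_gt0.
have Am : A m.
  move=> e /rH; apply: filterS => n; apply: Pmono => //; lra.
(* The centre of the coded disc is within [rad m / 2] of [z], so this disc about [z] lies in it. *)
exists (rad m / 2); first by rewrite divr_gt0.
move=> e e0; have [N NH] := harmonic_small e0.
exists (maxn m N) => // j /=; rewrite geq_max => /andP[mj /NH /ltW ej].
apply: (Pmono ej _ (phiP _ _ mj Am)).
by rewrite (cabsB z (ctr m)); lra.
Qed.

End SubsequenceExtraction.

(** * Estimates for the chordal metric *)

Section Chordal.
Context {R : realType}.
Local Notation C := (Cplx R).

Lemma chordal_le_dist (z w : C) : chordal (to_sphere z) (to_sphere w) <= cabs (z - w).
Proof.
have s1 (x : C) : 1 <= Num.sqrt (1 + cabs x ^+ 2).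
  by rewrite -[leLHS]sqrtr1 ler_wsqrtr// lerDl sqr_ge0.
have s2 : 1 <= Num.sqrt (1 + cabs z ^+ 2) * Num.sqrt (1 + cabs w ^+ 2).
  by rewrite -[leLHS]mulr1; apply: ler_pM.
rewrite /chordal /to_sphere ler_pdivrMr; last by lra.
by rewrite ler_peMr// cabs_ge0.
Qed.

Lemma chordal_infty_lt (z : C) (e : R) : 0 < e -> e^-1 <= cabs z ->
  chordal (to_sphere z) (infty R) < e.
Proof.
move=> e0 ez; rewrite /chordal /to_sphere /infty.
have h : cabs z < Num.sqrt (1 + cabs z ^+ 2).
  rewrite -[ltLHS]ger0_norm ?cabs_ge0// -sqrtr_sqr ltr_sqrt; last exact: invsq1_den.
  by rewrite ltrDr.
have ei : 0 < e^-1 by rewrite invr_gt0.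
rewrite invf_plt ?posrE//; first exact: le_lt_trans h.
by lra.
Qed.

End Chordal.

(* Abstracting the moduli keeps [lra] from comparing complex expressions up to conversion. *)
Ltac lra_cabs := first [
  solve [repeat match goal with
    | H : is_true (_ <= _)%R |- _ => revert H
    | H : is_true (_ < _)%R |- _ => revert H
    | H : _ = ?y |- _ => match y with context [cabs _] => revert H end
    end;
    repeat match goal with |- context [cabs ?x] => generalize (cabs x); intro end;
    intros; lra]
  | lra].

(** * Limits of rescaled functions and the choice of rescaling *)

Section Rescaling.
Context {R : realType}.
Local Notation C := (Cplx R).

(** The hypotheses are what rescaling provides on every disc, eventually along [U]. They clash
    because the limit has constant derivative, of modulus at least [B] by its value at 0 and at most
    [A] by its value near a zero. *)
Lemma no_rescaled_limit (U : set_system nat) (UU : UltraFilter U)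
    (G : nat -> C -> C) (b : C) (A B K : R) : 0 <= A -> A < B -> b != 0 ->
  (forall r, \forall n \near U, marty_on 0 r K (G n)) ->
  (\forall n \near U, B * (1 + cabs (G n 0) ^+ 2) <= cabs (cder (G n) 0)) ->
  (forall r M, \forall n \near U, forall w, cabs w < r ->
     cder (G n) w = b -> M < cabs (G n w)) ->
  (forall r, \forall n \near U, forall w, cabs w < r -> G n w = 0 ->
     cabs (cder (G n) w) <= A) -> False.
Proof.
move=> A0 AB b0 mG G0 Gb Gz; have B0 : 0 < B by lra.
have holoG z r : \forall n \near U, marty_on z r K (G n).
  apply: filterS (mG (cabs z + r)) => n [h1 h2]; split.
    by apply: holo_sub h1; rewrite subr0.
  by move=> w wr; apply: h2; have := cabs_le w z; rewrite subr0; lra.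
have mG' z : [set: C] z -> exists2 r : R, 0 < r & exists K,
    \forall n \near U, marty_on z r K (G n).
  by move=> _; exists 1 => //; exists K; exact: holoG.
have [bG|iG] := marty_connected connected_plane mG'; last first.
  (* [1/G n] tends to 0 near 0 although its derivative at 0 stays above [B] *)
  have [r r0 iG0] := iG 0 I; pose M := 2 / (B * r) + 1.
  have M0 : 0 < 2 / (B * r) by rewrite divr_gt0// mulr_gt0.
  have [n [[h1 h2] [hG _]]] := filter_ex (filterI (filterI (iG0 M) G0) (holoG 0 r)).
  have r00 : cabs ((0 : C) - 0) < r by rewrite subrr cabs0.
  have nz w : cabs (w - 0) < r -> G n w != 0.
    by move=> /h1; rewrite -cabs_gt0 /M; lra.
  have dp w (wr : cabs (w - 0) < r) := cderivV (holo_cderiv hG wr) (nz _ wr).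
  have hp : holo_on 0 r (fun w => (G n w)^-1) by move=> w wr; eexists; exact: dp.
  have := @cauchy_estimate R _ 0 _ r M^-1 r0 hp _ (dp 0 r00).
  have Mp : 0 < M by rewrite /M; lra.
  rewrite cabsM cabsN cabsV cabsX => H.
  have {}H : cabs (cder (G n) 0) / cabs (G n 0) ^+ 2 * r <= 2 * M^-1.
    apply: H => w wr; rewrite cabsV lef_pV2 ?posrE//; first exact: h1.
    by apply: lt_le_trans (h1 _ wr).
  have Gp : 0 < cabs (G n 0) ^+ 2 by rewrite exprn_gt0// cabs_gt0 nz.
  have h3 : B <= cabs (cder (G n) 0) / cabs (G n 0) ^+ 2.
    by rewrite ler_pdivlMr//; lra.
  have h4 : B * r * M <= 2.
    have := ler_wpM2r (ltW r0) h3 => h5.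
    have := ler_wpM2r (ltW Mp) (le_trans h5 H).
    by rewrite divfK// gt_eqF.
  have h5 : B * r * (2 / (B * r)) = 2 by field; rewrite !gt_eqF.
  have := mulr_gt0 B0 r0; move: h4; rewrite /M mulrDr h5; lra.
have [g gP] := marty_limit mG' bG.
have cvG z : exists2 r : R, 0 < r & forall e : R, 0 < e -> \forall n \near U,
    [/\ holo_on z r (G n), forall w, cabs (w - z) < r -> cabs (G n w - g w) <= e &
     forall w, cabs (w - z) < r -> cabs (cder (G n) w - cder g w) <= e].
  have [r r0 H] := gP z I; exists (r / 2); first by rewrite divr_gt0.
  have r2 : 0 < r / 2 by rewrite divr_gt0.
  move=> e e0; have H2 : \forall n \near U, forall w, cabs (w - z) + r / 2 <= r ->
      cabs (cder (G n) w - cder g w) <= e by exact: (cder_limit H).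
  move: (H e e0) H2; apply: filterS2 => n [h1 h2] h3.
  split; first by apply: holo_sub h1; rewrite subrr cabs0; lra.
    by move=> w wr; apply: h2; lra.
  by move=> w wr; apply: h3; lra.
have eg : entire g.
  move=> z; have [r r0 H] := gP z I.
  have hg : holo_on z r g by apply: (holo_limit H).
  by apply: hg; rewrite subrr cabs0.
have eg' := entire_cder eg.
have point z (e : R) : 0 < e -> \forall n \near U,
    cabs (G n z - g z) <= e /\ cabs (cder (G n) z - cder g z) <= e.
  move=> e0; have [r r0 /(_ _ e0) H] := cvG z; apply: filterS H => n [_ h1 h2].
  by split; [apply: h1|apply: h2]; rewrite subrr cabs0.
have K0 : 0 <= K.
  have [n [_ /(_ 0)]] := filter_ex (holoG 0 1); rewrite subrr cabs0 => /(_ ltr01) h.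
  by rewrite -(ler_pM2r (invsq1_den (G n 0))) mul0r; exact: le_trans (cabs_ge0 _) h.
have gK w : cabs (cder g w) <= K * (1 + cabs (g w) ^+ 2).
  apply/ler_addgt0Pl => e e0.
  have [x xE] : exists x, x = cabs (g w) by eexists.
  rewrite -xE; have x0 : 0 <= x by rewrite xE cabs_ge0.
  have D0 : 0 < 1 + K * (2 * x + 1).
    by rewrite ltr_pwDl// mulr_ge0//; lra.
  (* For [e' <= 1], [(x + e') ^+ 2] exceeds [x ^+ 2] by at most [e' * (2 * x + 1)]; with the error
     [e'] of the derivative the total is the quantity bounded here by [e]. *)
  have [e' [e'0 e'1 e'e]] : exists e', [/\ 0 < e', e' <= 1 &
      e' * (1 + K * (2 * x + 1)) <= e].
    exists (Num.min 1 (e / (1 + K * (2 * x + 1)))).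
    by rewrite lt_min ltr01 divr_gt0// -ler_pdivlMr// !ge_min !lexx orbT.
  have [n [[h1 h2] [_ h3]]] := filter_ex (filterI (point w _ e'0) (holoG w 1)).
  have {}h3 := h3 w; rewrite subrr cabs0 in h3; have {}h3 := h3 ltr01.
  have h4 : cabs (G n w) <= x + e' by have := cabs_le (G n w) (g w); rewrite -xE; lra.
  have h5 : cabs (G n w) ^+ 2 <= x ^+ 2 + e' * (2 * x + 1).
    apply: (@le_trans _ _ ((x + e') ^+ 2)).
      by rewrite ler_pXn2r ?nnegrE ?cabs_ge0//; lra.
    rewrite sqrrD -mulr_natr.
    have : e' ^+ 2 <= e' * 1 by rewrite expr2 ler_wpM2l// ltW.
    lra.
  have h6 := ler_wpM2l K0 h5.
  apply: le_trans (cabs_le _ (cder (G n) w)) _; rewrite cabsB.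
  apply: le_trans (lerD h2 h3) _; apply: le_trans _ (lerD e'e (lexx _)).
  by move: h6; clear; lra.
have g'0 : B <= cabs (cder g 0).
  apply/ler_addgt0Pl => e e0.
  have [n [[_ h1] h2]] := filter_ex (filterI (point 0 _ e0) G0).
  have := cabs_le (cder (G n) 0) (cder g 0).
  have : B * 1 <= B * (1 + cabs (G n 0) ^+ 2).
    by rewrite ler_wpM2l ?(ltW B0)// lerDl sqr_ge0.
  lra_cabs.
have cg' w : cont_at (cder g) w by exact: cderiv_cont (entire_cderiv w eg').
(* Near [z] the [G n] are bounded, whereas [Gb] makes them large where their derivative is [b]. So
   [cder (G n) - b] is zero-free there, and Hurwitz's theorem makes its limit vanish around [z]. *)
have openb z : cder g z = b -> exists2 r : R, 0 < r &
    forall w, cabs (w - z) < r -> cder g w = b.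
  move=> gz; have [r1 r10 H1] := cvG z.
  have /cont_cabsP/(_ _ ltr01)[r2 r20 H2] := cderiv_cont (entire_cderiv z eg).
  have /cont_cabsP/(_ _ ltr01)[r3 r30 H3] := cg' z.
  pose r := Num.min r1 (Num.min r2 r3).
  have r0 : 0 < r by rewrite !lt_min r10 r20.
  have rr w : cabs (w - z) < r ->
      [/\ cabs (w - z) < r1, cabs (w - z) < r2 & cabs (w - z) < r3].
    by rewrite !lt_min => /andP[-> /andP[-> ->]].
  exists (r / 2); first by rewrite divr_gt0.
  move=> w wr; apply/eqP; rewrite -subr_eq0; apply/eqP.
  apply: (@hurwitz _ _ U _ (fun n w => cder (G n) w - b) (fun w => cder g w - b) z r) => //.
  - exists 1 => x /rr[_ _ /H3]; rewrite gz; exact: ltW.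
  - move=> e /H1; apply: filterS => n [h1 _ h3]; split.
      apply: holoB; last by move=> x _; exists 0; exact: cderiv_cst.
      apply: holo_sub (holo_cder h1).
      by rewrite subrr cabs0 add0r ge_min lexx.
    move=> x /rr[/h3 h _ _]; apply: le_trans h.
    by move: (cder (G n) x) (cder g x) => u v; rewrite opprB addrA subrK.
  - move: (H1 1 ltr01) (Gb (cabs z + r) (cabs (g z) + 2)).
    apply: filterS2 => n [_ h2 _] h x xr; apply/eqP => /eqP; rewrite subr_eq0 => /eqP xb.
    have [/h2 x1 /H2 x2 _] := rr _ xr.
    have xr' : cabs x < cabs z + r by have := cabs_le x z; lra.
    have := h _ xr' xb.
    by have := cabs_le (G n x) (g x); have := cabs_le (g x) (g z); lra.
  - by rewrite gz subrr.
have g'c w : cder g w = cder g 0.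
  have [[z gz]|N] := pselect (exists z, cder g z = b); last first.
    have gb x : cder g x != b by apply/eqP => xb; apply: N; exists x.
    exact: (affine_of_omitted_derivative eg b0 gK gb w).
  suff E : [set x | cder g x = b] = [set: C].
    have E' x : cder g x = b.
      have : [set: C] x by [].
      by rewrite -E.
    by rewrite (E' w) (E' 0).
  apply: connected_plane; first by exists z.
    exists [set x | cder g x = b]; last by rewrite setTI.
    exact: open_cabs.
  exists (~` [set x | cder g x <> b]).
    rewrite closedC; apply: open_cabs => x /eqP; rewrite -subr_eq0 -cabs_gt0 => xb.
    have /cont_cabsP/(_ _ xb)[r r0 rH] := cg' x; exists r => // y /rH h /= yb.
    by move: h; rewrite yb (cabsB b) ltxx.
  by rewrite setTI; apply/seteqP; split=> x /=; [move=> -> //|exact: contrapT].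
have [k kE] : exists k, k = cder g 0 by exists (cder g 0).
rewrite -kE in g'0; have g'k w : cder g w = k by rewrite kE; exact: g'c.
have k0 : k != 0 by rewrite -cabs_gt0; lra.
have gE w : g w = k * w + g 0.
  have D x : cderiv (fun w => g w - k * w) x (cder g x - k * 1).
    by apply: cderivB; [exact: entire_cderiv|apply: cderivZ; exact: cderiv_id].
  have D0 x : cder (fun w => g w - k * w) x = 0 by rewrite (cderE (D x)) g'k mulr1 subrr.
  have eD : entire (fun w => g w - k * w) by move=> x; eexists; exact: D.
  have := @entire_const _ _ eD D0 w; rewrite /= mulr0 subr0 => <-; ring.
have [z gz] : exists z, g z = 0.
  by exists (- g 0 / k); rewrite gE mulrC divfK// addNr.
have gd w : g w = k * (w - z).
  by rewrite -[LHS]subr0 -gz (gE w) (gE z) opprD addrACA subrr addr0 mulrBr.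
have [r r0 H] := cvG z.
(* Zero-free [G n] would force [g] to vanish around [z] by Hurwitz, against [k != 0]. So some [G n]
   has a zero near [z], where its derivative is at most [A] in modulus and yet within [(B - A) / 2]
   of [k]. *)
have [h|h] := ultra_dec (fun n => forall w, cabs (w - z) < r -> G n w != 0).
  have wz : cabs (z + ofR (r / 4) - z) < r / 2.
    by rewrite addrC addKr cabs_ofR gtr0_norm ?divr_gt0//; lra.
  have Lb : exists L, forall w, cabs (w - z) < r -> cabs (g w) <= L.
    exists (cabs k * r) => w wr.
    by rewrite gd cabsM ler_wpM2l ?cabs_ge0// ltW.
  have cv (e : R) : 0 < e -> \forall n \near U, holo_on z r (G n) /\
      forall w, cabs (w - z) < r -> cabs (G n w - g w) <= e.
    by move=> /H; apply: filterS => n [].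
  have : g (z + ofR (r / 4)) = 0 by apply: (hurwitz r0 Lb cv h gz wz).
  rewrite gd [z + _]addrC addrK.
  apply/eqP; rewrite mulf_neq0// ofR_eq0 gt_eqF// divr_gt0//.
have e0 : 0 < (B - A) / 2 by rewrite divr_gt0//; lra.
have [n [h1 [h2 [_ _ h3]]]] := filter_ex (filterI h (filterI (Gz (cabs z + r)) (H _ e0))).
apply: h1 => w wr; apply/eqP => w0.
have wr' : cabs w < cabs z + r by have := cabs_le w z; lra.
have := h2 _ wr' w0; have := h3 _ wr; rewrite g'k (cabsB _ k).
have := cabs_le k (cder (G n) w); lra.
Qed.

(* [z1] maximises [(r - |z - z0|)^2 (|f' z| - (A + 1)) / |f z - a|^2] where [|f'| >= A + 1],
   a set on which [f] omits [a]. *)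
Lemma point_picking f (a z0 : C) (r A N : R) : 0 < r -> 0 <= A -> 0 < N ->
  holo_on z0 (2 * r) f ->
  (forall z, cabs (z - z0) < 2 * r -> f z = a -> cabs (cder f z) <= A) ->
  (exists z, [/\ cabs (z - z0) < r, A + 1 <= cabs (cder f z) &
    N * cabs (f z - a) ^+ 2 < (r - cabs (z - z0)) ^+ 2 * (cabs (cder f z) - (A + 1))]) ->
  exists z1 rho, [/\ 0 < rho, cabs (z1 - z0) < r,
    N * rho ^+ 2 <= (A + 1) * (r - cabs (z1 - z0)) ^+ 2,
    cabs (cder f z1) = (A + 1) * (1 + (cabs (f z1 - a) / rho) ^+ 2) &
    forall z, cabs (z - z1) <= (r - cabs (z1 - z0)) / 2 ->
      cabs (cder f z) <= 4 * (A + 1) * (1 + (cabs (f z - a) / rho) ^+ 2)].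
Proof.
move=> r0 A0 N0 hf fa [z [zr zB zN]].
have [B BE] : exists B, B = A + 1 by eexists.
rewrite -BE in zB zN *; have B0 : 0 < B by lra_cabs.
pose Kc := [set w : C | cabs (w - z0) <= r /\ B <= cabs (cder f w)].
have in2 w : cabs (w - z0) <= r -> cabs (w - z0) < 2 * r by lra_cabs.
have cf' w : cabs (w - z0) <= r -> cont_at (cder f) w.
  by move=> /in2 h; exact: cderiv_cont (holo_cderiv (holo_cder hf) h).
have cf w : cabs (w - z0) <= r -> cont_at f w.
  by move=> /in2 h; exact: cderiv_cont (holo_cderiv hf h).
have fna w : Kc w -> 0 < cabs (f w - a).
  move=> [wr wB]; rewrite cabs_gt0 subr_eq0; apply/eqP => /(fa _ (in2 _ wr)).
  by lra_cabs.
have cK : closed Kc.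
  rewrite -openC; apply: open_cabs => w wK.
  have [wr|wr] := leP (cabs (w - z0)) r; last first.
    exists (cabs (w - z0) - r); first by rewrite subr_gt0.
    move=> x xw [xr _]; have := cabs_tri w x z0.
    rewrite leNgt (cabsB w x) (lt_le_trans (ltr_leD xw xr))//.
    by rewrite subrK.
  have [wB|wB] := leP B (cabs (cder f w)); first by case: wK.
  have wB' : 0 < B - cabs (cder f w) by rewrite subr_gt0.
  have /cont_cabsP/(_ _ wB')[d d0 dH] := cf' _ wr.
  exists d; first exact: d0.
  move=> x /dH h [_ xB].
  have := cabs_le (cder f x) (cder f w).
  by rewrite leNgt (lt_le_trans _ xB)// -ltrBrDr.
have cpt : compact Kc by apply: (@compact_in_disc _ Kc z0 r) => // w [].
pose Psi w : R := (r - cabs (w - z0)) ^+ 2 * (cabs (cder f w) - B) / cabs (f w - a) ^+ 2.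
have cPsi w : Kc w -> {for w, continuous Psi}.
  move=> Kw; have [wr _] := Kw.
  have c1 : {for w, continuous (fun x : C => cabs (x - z0))}.
    by apply: continuous_cabs; apply: contD; [exact: cont_id|exact: cont_cst].
  have c2 := continuous_cabs (cf' _ wr).
  have c3 : {for w, continuous (fun x => cabs (f x - a))}.
    by apply: continuous_cabs; apply: contD; [exact: cf|exact: cont_cst].
  have n0 : cabs (f w - a) ^+ 2 != 0 by rewrite expf_neq0// gt_eqF// fna.
  have cr : {for w, continuous (fun=> r : R)} by exact: cst_continuous.
  have cB : {for w, continuous (fun=> B : R)} by exact: cst_continuous.
  have c4 := continuousB cr c1; have c5 := continuousB c2 cB.
  have c6 := @continuousV R C (fun x => cabs (f x - a) ^+ 2) w n0 (continuousM c3 c3).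
  exact: (continuousM (continuousM (continuousM c4 c4) c5) c6).
have Kz : Kc z by split; [exact: ltW|].
have KnE : Kc !=set0 by exists z.
have [|z1 Kz1 z1max] := @compact_EVT_max _ R Psi Kc KnE cpt.
  by apply: continuous_in_subspaceT => w; rewrite inE; exact: cPsi.
rewrite inE in Kz1; have {}z1max w : Kc w -> Psi w <= Psi z1.
  by move=> Kw; apply: z1max; rewrite inE.
have [P PE] : exists P, P = Psi z1 by eexists.
have PN : N < P.
  rewrite PE; apply: lt_le_trans (z1max _ Kz).
  by rewrite ltr_pdivlMr// exprn_gt0// fna.
have P0 : 0 < P by lra_cabs.
have [z1r z1B] := Kz1.
(* The weight vanishes on the boundary circle, while the maximum is positive. *)
have z1r' : cabs (z1 - z0) < r.
  rewrite lt_neqAle z1r andbT; apply/eqP => E.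
  by move: P0; rewrite PE /Psi E subrr expr0n /= !mul0r ltxx.
have [w wE] : exists w, w = r - cabs (z1 - z0) by eexists.
have w0 : 0 < w by rewrite wE subr_gt0.
(* Chosen so that [P |f - a|^2 / w^2 = B (|f - a| / rho)^2]: the equation [Psi z1 = P] becomes the
   required formula for [cder f z1], and [N < P] makes [rho] small against [w]. *)
pose rho := w * Num.sqrt (B / P).
have rho0 : 0 < rho by rewrite mulr_gt0// sqrtr_gt0 divr_gt0.
have rho2 : rho ^+ 2 = w ^+ 2 * B / P.
  by rewrite exprMn sqr_sqrtr ?mulrA// divr_ge0 ?ltW.
have PF x : P * cabs x ^+ 2 / w ^+ 2 = B * (cabs x / rho) ^+ 2.
  by rewrite expr_div_n rho2; field; rewrite !gt_eqF.
exists z1, rho; rewrite -wE; split=> //.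
- have Bw : 0 <= B * w ^+ 2 by rewrite mulr_ge0 ?sqr_ge0// ltW.
  rewrite rho2 mulrA ler_pdivrMr//.
  by rewrite (_ : N * (w ^+ 2 * B) = B * w ^+ 2 * N) ?ler_wpM2l ?(ltW PN)//; ring.
- rewrite mulrDr mulr1 -PF PE /Psi -wE.
  have := fna _ Kz1; move: (cabs (f z1 - a)) (cabs (cder f z1)) => X Y X0.
  by field; rewrite !gt_eqF.
move=> x xw; have [xB|xB] := ltP (cabs (cder f x)) B.
  have h := mulr_ge0 (ltW B0) (sqr_ge0 (cabs (f x - a) / rho)).
  by move: xB h; move: (cabs (cder f x)) (_ ^+ 2) => c d; clear -B0; lra.
(* Within half the distance to the boundary the weight drops at most to a quarter, hence the factor
   4 in the conclusion. *)
have xr : r - cabs (x - z0) >= w / 2.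
  have -> : w / 2 = r - (w / 2 + cabs (z1 - z0)).
    by move: wE; move: (cabs (z1 - z0)) => c cE; clear -cE; lra.
  by rewrite lerD2l lerN2; apply: le_trans (cabs_tri x z1 z0) _; rewrite lerD2r.
have w20 : 0 <= w / 2 by rewrite divr_ge0 ?(ltW w0).
have Kx : Kc x by split; [rewrite -subr_ge0; exact: le_trans xr|exact: xB].
have := z1max _ Kx; rewrite -PE /Psi ler_pdivrMr ?exprn_gt0 ?fna// => H.
have h1 : (w / 2) ^+ 2 * (cabs (cder f x) - B) <= P * cabs (f x - a) ^+ 2.
  apply: le_trans H; rewrite ler_wpM2r ?subr_ge0//.
  by rewrite ler_pXn2r ?nnegrE//; exact: le_trans xr.
have h2 : cabs (cder f x) - B <= 4 * (B * (cabs (f x - a) / rho) ^+ 2).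
  rewrite -PF -(ler_pM2l (_ : 0 < (w / 2) ^+ 2)); last by rewrite exprn_gt0// divr_gt0.
  apply: le_trans h1 _; rewrite le_eqVlt; apply/orP; left; apply/eqP.
  by move: (cabs _) => c; field; rewrite gt_eqF.
have h := mulr_ge0 (ltW B0) (sqr_ge0 (cabs (f x - a) / rho)).
by move: h2 h; move: (cabs (cder f x)) (_ ^+ 2) => c d; clear -B0; lra.
Qed.

End Rescaling.

(** * A uniform Marty bound by rescaling *)

Section UniformMarty.
Context {R : realType}.
Local Notation C := (Cplx R).

(** If the weighted quotient has one bound [N] for the whole family, [K] is explicit; otherwise
    [point_picking] with [N = n.+1] yields a sequence that [no_rescaled_limit] forbids. The radius
    halves because the weight degenerates at distance [r]. *)
Lemma uniform_marty (F : set (C -> C)) (a b z0 : C) (r A e0 : R) :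
  0 < r -> 0 <= A -> 0 < e0 -> b != 0 ->
  (forall f, F f -> holo_on z0 (2 * r) f) ->
  (forall f, F f -> forall z, cabs (z - z0) < 2 * r -> f z = a ->
     cabs (cder f z) <= A) ->
  (forall f, F f -> forall z, cabs (z - z0) < 2 * r -> cder f z = b ->
     e0 <= cabs (f z - a)) ->
  exists K, forall f, F f -> marty_on z0 (r / 2) K f.
Proof.
move=> r0 A0 e00 b0 hF Fa Fb; have B0 : 0 < A + 1 by rewrite ltr_wpDl.
have [[N [N0 HN]]|HN] := pselect (exists N, 0 < N /\ forall f, F f -> forall z,
    cabs (z - z0) < r -> A + 1 <= cabs (cder f z) ->
    (r - cabs (z - z0)) ^+ 2 * (cabs (cder f z) - (A + 1)) <=
    N * cabs (f z - a) ^+ 2).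
  (* A factor 4 comes from the weight, at least [(r / 2) ^+ 2] on the half disc, and a factor 2 from
     [|f - a|^2 <= 2 |f|^2 + 2 |a|^2]. *)
  have [Q QE] : exists Q, Q = 8 * N / r ^+ 2 by eexists.
  have Q0 : 0 < Q by rewrite QE divr_gt0 ?mulr_gt0 ?exprn_gt0.
  have a20 := sqr_ge0 (cabs a).
  exists (A + 1 + Q * (1 + cabs a ^+ 2)) => f Ff; split.
    by apply: holo_sub (hF _ Ff); rewrite subrr cabs0 add0r; lra.
  move=> z zr; have fz20 := sqr_ge0 (cabs (f z)).
  have QQ : 0 <= Q * (1 + cabs a ^+ 2) * (1 + cabs (f z) ^+ 2).
    by apply: mulr_ge0; [apply: mulr_ge0; [exact: ltW|lra]|lra].
  have Bf : 0 <= (A + 1) * cabs (f z) ^+ 2 by rewrite mulr_ge0// ltW.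
  have [fB|fB] := ltP (cabs (cder f z)) (A + 1).
    apply: (le_trans (ltW fB)); move: QQ Bf.
    by move: (cabs (f z) ^+ 2) (cabs a ^+ 2) => c d; clear; lra.
  have zr' : cabs (z - z0) < r by apply: lt_trans zr _; lra.
  have := HN _ Ff _ zr' fB => H.
  have h1 : (r / 2) ^+ 2 <= (r - cabs (z - z0)) ^+ 2.
    have hr : r / 2 <= r - cabs (z - z0).
      by move: zr; move: (cabs (z - z0)) => c zr; clear -zr; lra.
    by rewrite ler_pXn2r ?nnegrE ?subr_ge0 ?(ltW zr')// divr_ge0// ltW.
  have d0 : 0 <= cabs (cder f z) - (A + 1) by rewrite subr_ge0.
  have h2 := le_trans (ler_wpM2r d0 h1) H.
  have h3 : cabs (f z - a) ^+ 2 <= 2 * cabs (f z) ^+ 2 + 2 * cabs a ^+ 2.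
    have h := cabsBD (f z) a.
    apply: (@le_trans _ _ ((cabs (f z) + cabs a) ^+ 2)).
      by rewrite ler_pXn2r ?nnegrE ?addr_ge0 ?cabs_ge0.
    move: (cabs (f z)) (cabs a) => c d; have := sqr_ge0 (c - d); clear.
    by rewrite sqrrB [in (c + d) ^+ 2]sqrrD !mulr2n; lra.
  have h4 : cabs (cder f z) - (A + 1) <= Q * (cabs (f z) ^+ 2 + cabs a ^+ 2).
    have r20 : 0 < (r / 2) ^+ 2 by rewrite exprn_gt0// divr_gt0.
    rewrite -(ler_pM2l r20); apply: (le_trans h2).
    apply: (le_trans (ler_wpM2l (ltW N0) h3)); rewrite QE le_eqVlt.
    apply/orP; left; apply/eqP; move: (cabs (f z)) (cabs a) => c d.
    by field; rewrite gt_eqF.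
  have h5 : 0 <= Q * (1 + cabs (f z) ^+ 2 * cabs a ^+ 2).
    by rewrite mulr_ge0 ?(ltW Q0)// addr_ge0// mulr_ge0.
  move: h4 h5 Bf; move: (cabs (cder f z)) (cabs (f z) ^+ 2) (cabs a ^+ 2) => c d e.
  by clear; lra.
exfalso.
have pick n : exists p : (C -> C) * C * R, [/\ F p.1.1, 0 < p.2,
    cabs (p.1.2 - z0) < r,
    n.+1%:R * p.2 ^+ 2 <= (A + 1) * (r - cabs (p.1.2 - z0)) ^+ 2 &
    cabs (cder p.1.1 p.1.2) = (A + 1) * (1 + (cabs (p.1.1 p.1.2 - a) / p.2) ^+ 2) /\
    forall z, cabs (z - p.1.2) <= (r - cabs (p.1.2 - z0)) / 2 ->
      cabs (cder p.1.1 z) <= 4 * (A + 1) * (1 + (cabs (p.1.1 z - a) / p.2) ^+ 2)].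
  have n0 : 0 < n.+1%:R :> R by rewrite ltr0n.
  have [f [Ff [z zP]]] : exists f, F f /\ exists z, [/\ cabs (z - z0) < r,
      A + 1 <= cabs (cder f z) & n.+1%:R * cabs (f z - a) ^+ 2 <
      (r - cabs (z - z0)) ^+ 2 * (cabs (cder f z) - (A + 1))].
    apply: contrapT => H; apply: HN; exists n.+1%:R; split=> // f Ff z zr zB.
    rewrite leNgt; apply/negP => h; apply: H; exists f; split=> //.
    by exists z.
  have [z1 [rho [h1 h2 h3 h4 h5]]] := point_picking r0 A0 n0 (hF _ Ff) (Fa _ Ff)
    (ex_intro _ z zP).
  by exists (f, z1, rho); split.
have [f [z [rho [w [wE Ff rho0 w0 seqP]]]]] : exists f z rho (w : nat -> R),
    [/\ forall n, w n = r - cabs (z n - z0), forall n, F (f n),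
     forall n, 0 < rho n, forall n, 0 < w n & forall n,
     [/\ n.+1%:R * rho n ^+ 2 <= (A + 1) * w n ^+ 2,
      cabs (cder (f n) (z n)) = (A + 1) * (1 + (cabs (f n (z n) - a) / rho n) ^+ 2) &
      forall x, cabs (x - z n) <= w n / 2 ->
      cabs (cder (f n) x) <= 4 * (A + 1) * (1 + (cabs (f n x - a) / rho n) ^+ 2)]].
  have [p pP] := choice pick.
  exists (fun n => (p n).1.1), (fun n => (p n).1.2), (fun n => (p n).2).
  exists (fun n => r - cabs ((p n).1.2 - z0)).
  split=> n //; have [h1 h2 h3 h4 [h5 h6]] := pP n.
  - exact: h1.
  - exact: h2.
  - by rewrite subr_gt0; exact: h3.
  - by split; [exact: h4|exact: h5|exact: h6].
have wr n : w n <= r by rewrite wE gerBl cabs_ge0.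
have [U UU sU] := nat_ultra.
(* Measured in units of [rho n], the disc of radius [w n / 2] about [z n] becomes arbitrarily large,
   so [G n] is controlled on any fixed disc. *)
have rho_small (t : R) : 0 < t -> \forall n \near U, rho n <= t * w n.
  move=> t0; have t20 : 0 < t ^+ 2 by rewrite exprn_gt0.
  have /archi_boundP := divr_ge0 (ltW B0) (ltW t20).
  set m := Num.bound _; rewrite ltr_pdivrMr// => mB.
  apply: sU; exists m => // n /= mn.
  have n0 : 0 < n.+1%:R :> R by rewrite ltr0n.
  have tw : 0 <= t * w n by rewrite mulr_ge0// ltW.
  rewrite -(@ler_pXn2r _ 2) ?nnegrE ?(ltW (rho0 n))// -(ler_pM2l n0).
  have [h _ _] := seqP n; apply: (le_trans h).
  rewrite exprMn [leRHS]mulrA.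
  apply: ler_wpM2r; first exact: sqr_ge0.
  apply: (le_trans (ltW mB)).
  by rewrite ler_pM2r// ler_nat leqW.
pose G n x := (ofR (rho n))^-1 * (f n (z n + ofR (rho n) * x) - a).
have rhoC n : ofR (rho n) != 0 :> C by rewrite ofR_eq0 gt_eqF.
have GE n x : cabs (G n x) = cabs (f n (z n + ofR (rho n) * x) - a) / rho n.
  by rewrite cabsM cabsV cabs_ofR gtr0_norm// mulrC.
have near_in (q : R) : \forall n \near U, forall x, cabs x < q ->
    cabs (z n + ofR (rho n) * x - z n) <= w n / 2.
  have q0 : 0 < 2 * (`|q| + 1) by rewrite mulr_gt0// ltr_wpDl.
  have t0 : 0 < (2 * (`|q| + 1))^-1 by rewrite invr_gt0.
  apply: filterS (rho_small _ t0) => n h x xq.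
  rewrite addrC addKr cabsM cabs_ofR gtr0_norm//.
  apply: (@le_trans _ _ ((2 * (`|q| + 1))^-1 * w n * (`|q| + 1))).
    apply: ler_pM => //; [exact: ltW|exact: cabs_ge0|].
    apply: (le_trans (ltW xq)); apply: (le_trans (ler_norm q)).
    by rewrite lerDl.
  rewrite le_eqVlt; apply/orP; left; apply/eqP.
  by field; rewrite gt_eqF// ltr_wpDl.
have in_disc n y : cabs (y - z n) <= w n / 2 -> cabs (y - z0) < 2 * r.
  move=> yw; apply: (le_lt_trans (cabs_tri y (z n) z0)).
  have := w0 n; move: yw; rewrite (wE n).
  by move: (cabs _) (cabs _) => c d yw; clear -yw r0; lra.
have dG n x : cabs (z n + ofR (rho n) * x - z n) <= w n / 2 ->
    cderiv (G n) x (cder (f n) (z n + ofR (rho n) * x)).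
  move=> /in_disc h; have Ffn := Ff n.
  have D1 : cderiv (fun x => z n + ofR (rho n) * x) x (0 + ofR (rho n) * 1).
    by apply: cderivD; [exact: cderiv_cst|apply: cderivZ; exact: cderiv_id].
  have D2 := cderiv_comp D1 (holo_cderiv (hF _ Ffn) h).
  have := cderivZ (ofR (rho n))^-1 (cderivB D2 (cderiv_cst a x)).
  rewrite add0r mulr1 subr0 mulrC mulfK//; exact.
apply: (@no_rescaled_limit R U UU G b A (A + 1) (4 * (A + 1))) => //.
- by rewrite ltrDl.
- move=> q; apply: filterS (near_in q) => n h; split.
    by move=> x; rewrite subr0 => /h hx; eexists; exact: (dG n x hx).
  move=> x; rewrite subr0 => /h hx; rewrite (cderE (dG n x hx)) GE.
  by have [_ _ H] := seqP n; exact: H.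
- apply: filterE => n.
  have h : cabs (z n + ofR (rho n) * 0 - z n) <= w n / 2.
    by rewrite mulr0 addr0 subrr cabs0 divr_ge0// ltW.
  rewrite (cderE (dG n 0 h)) GE mulr0 addr0.
  have [_ h1 _] := seqP n.
  by rewrite le_eqVlt; apply/orP; left; apply/eqP; exact: (esym h1).
(* Where the derivative is [b], [cabs (G n x)] is at least [e0 / rho n]; as [w n <= r], this
   threshold gives [(|M| + 1) * rho n <= e0 / 2]. *)
- move=> q M; have t0 : 0 < e0 / ((`|M| + 1) * (2 * r)).
    by rewrite divr_gt0// mulr_gt0 ?mulr_gt0// ltr_wpDl.
  move: (near_in q) (rho_small _ t0); apply: filterS2 => n h hrho x xq.
  have hx := h _ xq; rewrite (cderE (dG n x hx)) GE => xb.
  have Ffn := Ff n.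
  have := Fb _ Ffn _ (in_disc _ _ hx) xb => h1.
  rewrite ltr_pdivlMr//; apply: lt_le_trans h1.
  have M1 : 0 < `|M| + 1 by rewrite ltr_wpDl.
  apply: (@le_lt_trans _ _ ((`|M| + 1) * rho n)).
    by rewrite ler_wpM2r ?(ltW (rho0 n))//; apply: le_trans (ler_norm M) _; rewrite lerDl.
  have h2 : rho n <= e0 / ((`|M| + 1) * (2 * r)) * r.
    by apply: (le_trans hrho); rewrite ler_wpM2l// ltW.
  apply: (le_lt_trans (ler_wpM2l (ltW M1) h2)).
  have -> : (`|M| + 1) * (e0 / ((`|M| + 1) * (2 * r)) * r) = e0 / 2.
    by field; rewrite !gt_eqF.
  by rewrite ltr_pdivrMr// ltr_pMr// ltr1n.
- move=> q; apply: filterS (near_in q) => n h x xq.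
  have hx := h _ xq; rewrite (cderE (dG n x hx)) => /eqP.
  rewrite mulf_eq0 invr_eq0 (negbTE (rhoC n)) /= subr_eq0 => /eqP xa.
  have Ffn := Ff n.
  exact: (Fa _ Ffn _ (in_disc _ _ hx) xa).
Qed.

End UniformMarty.

(** * Normality and the main theorem *)

Section Normality.
Context {R : realType}.
Local Notation C := (Cplx R).

(** The sufficient half of Marty's theorem. Connectedness of [D] fixes one alternative along the
    ultrafilter; in either case the locally uniform spherical limit is then realised by a
    subsequence. *)
Lemma normal_of_marty (D : set C) (F : set (C -> C)) : domain D ->
  (forall z, D z -> exists2 r : R, 0 < r &
     exists K, forall f, F f -> marty_on z r K f) -> normal_in D F.
Proof.
move=> [_ _ cD] mF f Ff; have [U UU sU] := nat_ultra.
have mf z : D z -> exists2 r : R, 0 < r & exists K,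
    \forall n \near U, marty_on z r K (f n).
  move=> /mF[r r0 [K H]]; exists r => //; exists K.
  by apply: filterE => n; exact: H.
pose close (g : C -> Sphere R) (n : nat) (e : R) (z : C) (r : R) :=
  forall w, cabs (w - z) < r -> chordal (to_sphere (f n w)) (g w) < e.
have close_mono g n (e e' : R) z r z' r' : e <= e' -> cabs (z' - z) + r' <= r ->
    close g n e z r -> close g n e' z' r'.
  move=> ee' zr H w wr; apply: lt_le_trans ee'; apply: H.
  apply: (le_lt_trans (cabs_tri w z' z)); apply: lt_le_trans zr.
  by rewrite addrC ltrD2l.
have finish g : (forall z, D z -> exists2 r : R, 0 < r & forall e, 0 < e ->
      \forall n \near U, close g n e z r) ->
    exists2 phi : nat -> nat, {homo phi : m n / (m < n)%N} &
      spherical_cvg_locally_uniformly D (fun n z => to_sphere (f (phi n) z)) g.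
  move=> H; have [phi hphi Hphi] := extract_subsequence (close_mono g) sU H.
  exists phi => // z Dz; have [r r0 rH] := Hphi _ Dz.
  exists [set w | cabs (w - z) < r]; first by apply/nbhs_cabs; exists r.
  move=> e /rH; apply: filterS => n h w _; exact: h.
have [bf|infF] := marty_connected cD mf.
  have [h hP] := marty_limit mf bf.
  have [z Dz|phi hphi cv] := finish (fun z => to_sphere (h z)).
    have [r r0 H] := hP _ Dz; exists r => // e e0.
    have e2 : 0 < e / 2 by rewrite divr_gt0.
    apply: filterS (H _ e2) => n [_ hn] w wr.
    apply: (le_lt_trans (chordal_le_dist _ _)); apply: (le_lt_trans (hn _ wr)).
    by rewrite ltr_pdivrMr// ltr_pMr// ltr1n.
  exists phi => //; left; exists h => // z Dz.
  have [r r0 H] := hP _ Dz.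
  have hh : holo_on z r h by apply: (holo_limit H).
  have zr : cabs (z - z) < r by rewrite subrr cabs0.
  by have [] := cderiv_derivable (holo_cderiv hh zr).
have [z Dz|phi hphi cv] := finish (fun=> infty R).
  have [r r0 H] := infF _ Dz; exists r => // e e0.
  apply: filterS (H e^-1) => n hn w wr.
  by apply: chordal_infty_lt => //; exact: hn.
by exists phi => //; right.
Qed.

Lemma compact_cabs_bounded (S : set C) : compact S ->
  exists2 A : R, 0 <= A & forall x, S x -> cabs x <= A.
Proof.
move=> cS; have [[x0 Sx0]|N] := pselect (S !=set0); last first.
  by exists 0 => // x Sx; exfalso; apply: N; exists x.
have Sn0 : S !=set0 by exists x0.
have cc : {within S, continuous (@cabs R : C -> R)}.
  by apply: continuous_subspaceT => x; apply: continuous_cabs; exact: cont_id.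
have [c _ cP] := compact_EVT_max Sn0 cS cc.
exists (cabs c); first exact: cabs_ge0.
by move=> x Sx; apply: cP; rewrite inE.
Qed.

Lemma compact_dist_pos (S : set C) (a : C) : compact S -> ~ S a ->
  exists2 e : R, 0 < e & forall x, S x -> e <= cabs (x - a).
Proof.
move=> cS Sa; have [[x0 Sx0]|N] := pselect (S !=set0); last first.
  by exists 1 => // x Sx; exfalso; apply: N; exists x.
have Sn0 : S !=set0 by exists x0.
have cc : {within S, continuous (fun x : C => cabs (x - a))}.
  apply: continuous_subspaceT => x.
  apply: (@continuous_cabs R (fun x => x - a) x).
  exact: (contD (@cont_id R x) (@cont_cst R (- a) x)).
have [c Sc cP] := compact_EVT_min Sn0 cS cc; rewrite inE in Sc.
exists (cabs (c - a)); last by move=> x Sx; apply: cP; rewrite inE.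
by rewrite cabs_gt0 subr_eq0; apply/eqP => ca; apply: Sa; rewrite -ca.
Qed.

End Normality.

Theorem theorem2p1 (R : realType) (D : set (Cplx R))
    (F : set (Cplx R -> Cplx R)) (a b : Cplx R) (Sa Sb : set (Cplx R))
    (domD : domain D)
    (holF : forall f, F f -> holomorphic_in D f)
    (b_neq0 : b <> 0) (b_neqa : b <> a)
    (cptSa : compact Sa) (cptSb : compact Sb)
    (b_notin_Sa : ~ Sa b) (a_notin_Sb : ~ Sb a)
    (valF : forall f z, F f -> D z ->
      (f z = a -> Sa (f^`() z)) /\ (f^`() z = b -> Sb (f z))) :
  normal_in D F.
Proof.
apply: normal_of_marty (domD) _ => z0 Dz0.
have [A A0 SaA] := compact_cabs_bounded cptSa.
have [e0 e00 Sbe] := compact_dist_pos cptSb a_notin_Sb.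
have [_ oD _] := domD; move: oD; rewrite openE => /(_ _ Dz0).
move=> /nbhs_cabs[r1 r10 r1D].
(* [uniform_marty] needs its hypotheses on the disc of radius [2 * r], which must lie in [D]. *)
have [r rE] : exists r, r = r1 / 2 by eexists.
have r0 : 0 < r by rewrite rE divr_gt0.
have rD z : cabs (z - z0) < 2 * r -> D z by rewrite rE mulrC divfK//; exact: r1D.
exists (r / 2); first by rewrite divr_gt0.
apply: (@uniform_marty R F a b z0 r A e0) => //; first exact/eqP.
- move=> f Ff z /rD Dz; eexists; exact: (derivable_cderiv (holF f Ff z Dz)).
- by move=> f Ff z /rD Dz fz; apply: SaA; rewrite cder_derive1; apply: (valF f z Ff Dz).1.
- by move=> f Ff z /rD Dz fz; apply: Sbe; apply: (valF f z Ff Dz).2; rewrite -cder_derive1.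
Qed.
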